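(* Consider the interference limited regime $\sigma=0$, and let $\alpha\ge 2$, $\tau>0$. For each $*\in\{\mathcal V,S,I,\mathcal I,t\}$, the coverage probabilities $p^c_*=\mathbb P^0(\mathcal S_*\ge\tau)$ and $p^c_{*;\mathcal T}=\mathbb P^0(\mathcal S_{*;\mathcal T}\ge\tau)$ (additive and tropical interference) are scale invariant with respect to the intensity $\lambda$, i.e. they do not depend on $\lambda>0$, both with and without fading; in the case with fading they also do not depend on the fading parameter $\mu>0$.
   Context: Model. Let $\lambda,v>0$. $\Phi=\sum_i\delta_{X_i}$ is a homogeneous Poisson point process of intensity $\lambda$ on $\mathbb R^2$ and $(\Theta_i)$ are i.i.d. uniform angles on $[-\pi,\pi)$, independent of $\Phi$. Base station (BS) $i$ is at $X_i^t=X_i+vt(\cos\Theta_i,\sin\Theta_i)$ at time $t\in\mathbb R$; the user is at the origin; $d_i(t)=\|X_i^t\|$. The serving BS at time $t$ is the nearest one. Palm expectation. For a point process $N$ on the time axis $\mathbb R$ that is a time-shift-compatible function of the moving configuration and has intensity $\lambda_N\in(0,\infty)$, $\mathbb E^0_N[f]=\lambda_N^{-1}\,\mathbb E\big[\sum_{t\in N\cap[0,1]}f_t\big]$, where $f_t$ is the quantity $f$ observed at time $t$. $\mathbb P^0$ denotes the Palm probability of the relevant epoch process. Epochs. Let $T_i$ be the time at which $d_i$ is minimal and $H_i=d_i(T_i)$. - $\mathcal V$ (handover, min-signal/max-interference): times $s$ at which $d_i(s)=d_j(s)=h$ for some $i\neq j$ and no BS is at distance $<h$. $H_{\mathcal V}=h$;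 $\{D_k\}$: distances of all BSs other than $i,j$. - $S$ (max-signal): times $s=T_i$ at which BS $i$ is the nearest BS. $H_S=H_i$; $\{D_k\}$: distances of all other BSs. - $I$ (max-interference): times $s=T_i$ such that exactly one BS $j$ satisfies $d_j(s)<H_i$. $H_I=H_i$, $R_I=d_j(s)$; $\{D_k\}$: distances of all BSs other than $i,j$. - $\mathcal I$ (min-interference, tropical interference handover): times $s$ at which $d_i(s)=d_j(s)=h$ for some $i\ne j$ and exactly one BS $l$ satisfies $d_l(s)<h$. $H_{\mathcal I}=h$, $R_{\mathcal I}=d_l(s)$; $\{D_k\}$: distances of all BSs other than $i,j,l$. - $t$ (typical time): an arbitrary fixed time ($\mathbb P^0=\mathbb P$). $R$: distance to the nearest BS; $\{D_k\}$: distances of all other BSs. Performance metrics with fading: $\rho,\rho',\rho'',\rho_k$ are i.i.d. exponential with parameter $\mu$, independent of BS positions, and noise power is $\sigma^2$. With $\bar I=\sum_k\rho_kD_k^{-\alpha}$ and $\bar M=\max_k\rho_kD_k^{-\alpha}$: SINR: $\mathcal S_{\mathcal V}=\frac{\rho H_{\mathcal V}^{-\alpha}}{\sigma^2+\rho'H_{\mathcal V}^{-\alpha}+\bar I}$, $\mathcal S_S=\frac{\rho H_S^{-\alpha}}{\sigma^2+\bar I}$, $\mathcal S_I=\frac{\rho R_I^{-\alpha}}{\sigma^2+\rho'H_I^{-\alpha}+\bar I}$, $\mathcal S_{\mathcal I}=\frac{\rho R_{\mathcal I}^{-\alpha}}{\sigma^2+(\rho'+\rho'')H_{\mathcal I}^{-\alpha}+\bar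 I}$, $\mathcal S_t=\frac{\rho R^{-\alpha}}{\sigma^2+\bar I}$. STINR ($\mathcal S_{*;\mathcal T}$): the same expressions with the sum of all interfering powers replaced by their maximum, e.g. $\mathcal S_{\mathcal I;\mathcal T}=\frac{\rho R_{\mathcal I}^{-\alpha}}{\sigma^2+\max(\rho'H_{\mathcal I}^{-\alpha},\rho''H_{\mathcal I}^{-\alpha},\bar M)}$. Without fading: the same with all fading variables equal to $1$. Infinite interference is allowed, with the metric equal to $0$ in that case. *)

(* Defs.v *)
From HB Require Import structures.
From mathcomp Require Import all_boot all_order all_algebra.
From mathcomp Require Import all_classical all_reals all_analysis.
From mathcomp Require Import measurable_realfun.

Set Implicit Arguments.
Unset Strict Implicit.
Unset Printing Implicit Defensive.

Import Order.TTheory GRing.Theory Num.Theory.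
Import numFieldNormedType.Exports.

Local Open Scope classical_set_scope.
Local Open Scope ring_scope.

(* Only the product rule for distinct indices is asked for: the smaller
   subfamilies are covered by the quantification over [m]. *)
Definition independent_systems d (Omega : measurableType d) (R : realType)
    (P : probability Omega R) (I : Type) (F : I -> set_system Omega) : Prop :=
  forall (m : nat) (i : 'I_m -> I) (E : 'I_m -> set Omega),
    injective i -> (forall k, F (i k) (E k)) ->
    P (\bigcap_(k in [set: 'I_m]) E k) = (\prod_(k < m) P (E k))%E.

Definition independent_family d (Omega : measurableType d) (R : realType)
    (P : probability Omega R) (I : Type) d' (T : measurableType d')
    (X : I -> Omega -> T) : Prop :=
  independent_systems P
    (fun i => preimage_set_system [set: Omega] (X i) measurable).

Definition sigma_generated d (Omega : measurableType d) (I : Type)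
    d' (T : measurableType d') (X : I -> Omega -> T) : set_system Omega :=
  <<s \bigcup_i preimage_set_system [set: Omega] (X i) measurable >>.

Definition independent_pair d (Omega : measurableType d) (R : realType)
    (P : probability Omega R) (F G : set_system Omega) : Prop :=
  forall A B, F A -> G B -> P (A `&` B) = (P A * P B)%E.

Definition area (R : realType) (A : set (R * R)) : \bar R :=
  (lebesgue_measure \x lebesgue_measure)%E A.

Definition point_count (R : realType) (Omega : Type)
    (X : nat -> Omega -> R * R) (A : set (R * R)) (w : Omega) : \bar R :=
  (\sum_(0 <= i <oo) (\1_A (X i w))%:E)%E.

(* The second argument of [poisson_prob] is a dummy; unlike [poisson_pmf],
   [poisson_prob] is the correct law (Dirac mass at 0) when the rate is 0. *)
Definition poisson_process d (Omega : measurableType d) (R : realType)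
    (P : probability Omega R) (lambda : R) (X : nat -> Omega -> R * R) : Prop :=
  (forall A : set (R * R), measurable A -> (area A < +oo)%E -> forall n : nat,
     P [set w | point_count X A w = n%:R%:E] =
     poisson_prob (lambda * fine (area A)) 0%N [set n]) /\
  (forall (m : nat) (A : 'I_m -> set (R * R)),
     (forall k, measurable (A k)) -> (forall k, (area (A k) < +oo)%E) ->
     trivIset setT A ->
     independent_family P (fun k => point_count X (A k))).

Lemma ltNpipi (R : realType) : - pi < pi :> R.
Proof. by rewrite gtrN// pi_gt0. Qed.

(* [X] is an arbitrary enumeration of the atoms of the Poisson process (almost
   surely infinite in number).  The angles are independent of the enumerated
   atoms; closed versus half-open support is immaterial for their law. *)
Record network d (Omega : measurableType d) (R : realType)
    (P : probability Omega R) (lambda : R) := Network {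
  station : nat -> {RV P >-> (R * R)%type};
  angle : nat -> {RV P >-> R};
  station_poisson : poisson_process P lambda station;
  angle_uniform : forall i (A : set R), measurable A ->
    distribution P (angle i) A = uniform_prob (@ltNpipi R) A;
  angle_independent : independent_family P angle;
  station_angle_independent :
    independent_pair P (sigma_generated station) (sigma_generated angle)
}.

Definition euclidean_norm (R : realType) (z : R * R) : R :=
  Num.sqrt (z.1 ^+ 2 + z.2 ^+ 2).

Definition position (R : realType) (v : R) (x : R * R) (theta t : R) : R * R :=
  (x.1 + v * t * cos theta, x.2 + v * t * sin theta).

Definition distance d (Omega : measurableType d) (R : realType)
    (P : probability Omega R) (lambda : R) (N : network P lambda) (v : R)
    (w : Omega) (i : nat) (t : R) : R :=
  euclidean_norm (position v (station N i w) (angle N i w) t).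

(* [Rho], [Rho'], [Rho''] go with the distinguished stations of a metric;
   [RhoAt k] goes with station [k] when it is not distinguished. *)
Inductive fading_index := Rho | Rho' | Rho'' | RhoAt of nat.

Record exponential_fading d (Omega : measurableType d) (R : realType)
    (P : probability Omega R) (lambda : R) (N : network P lambda) (mu : R) :=
  ExponentialFading {
  fading : fading_index -> {RV P >-> R};
  fading_exponential : forall j (A : set R), measurable A ->
    distribution P (fading j) A = exponential_prob mu A;
  fading_independent : independent_family P fading;
  network_fading_independent :
    independent_pair P
      (sigma_generated (fun i w => (station N i w, angle N i w)))
      (sigma_generated fading)
}.

Definition no_fading (R : realType) (Omega : Type) (w : Omega)
    (j : fading_index) : R := 1.

Definition nearest_at (R : realType) (D : nat -> R -> R) (s : R) (i : nat) :=
  forall k, D i s <= D k s.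

Definition closest_approach (R : realType) (D : nat -> R -> R) (s : R)
    (i : nat) := forall t, D i s <= D i t.

Definition handover_at (R : realType) (D : nat -> R -> R) (s : R)
    (i j : nat) : Prop :=
  [/\ i <> j, D i s = D j s & forall k, ~ (D k s < D i s)].

Definition max_signal_at (R : realType) (D : nat -> R -> R) (s : R)
    (i : nat) : Prop :=
  closest_approach D s i /\ nearest_at D s i.

Definition max_interference_at (R : realType) (D : nat -> R -> R) (s : R)
    (i j : nat) : Prop :=
  closest_approach D s i /\ (forall k, D k s < D i s <-> k = j).

Definition min_interference_at (R : realType) (D : nat -> R -> R) (s : R)
    (i j l : nat) : Prop :=
  [/\ i <> j, D i s = D j s & forall k, D k s < D i s <-> k = l].

Inductive epoch := Handover | MaxSignal | MaxInterference | MinInterference.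

Definition epoch_times (R : realType) (e : epoch) (D : nat -> R -> R) : set R :=
  match e with
  | Handover => [set s | exists i j, handover_at D s i j]
  | MaxSignal => [set s | exists i, max_signal_at D s i]
  | MaxInterference => [set s | exists i j, max_interference_at D s i j]
  | MinInterference => [set s | exists i j l, min_interference_at D s i j l]
  end.

Inductive interference := Additive | Tropical.

Definition combine (R : realType) (m : interference) (x y : \bar R) : \bar R :=
  match m with
  | Additive => (x + y)%E
  | Tropical => maxe x y
  end.

Definition aggregate (R : realType) (m : interference) (K : set nat)
    (p : nat -> R) : \bar R :=
  match m with
  | Additive => \esum_(k in K) (p k)%:E
  | Tropical => ereal_sup [set (p k)%:E | k in K]
  end.

(* In [\bar R], [x%:E / +oo] is 0.  Distances are almost surely positive, so
   the value of [powR] at 0 does not matter. *)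
Definition power (R : realType) (alpha rho r : R) : R := rho * r `^ (- alpha).

Definition ratio (R : realType) (sigma signal : R) (itf : \bar R) : \bar R :=
  (signal%:E / ((sigma ^+ 2)%:E + itf))%E.

Definition others_interference (R : realType) (m : interference) (alpha : R)
    (rho : fading_index -> R) (D : nat -> R -> R) (s : R) (K : set nat) :
    \bar R :=
  aggregate m K (fun k => power alpha (rho (RhoAt k)) (D k s)).

(* The values of the metric observed at time [s]: almost surely a singleton for
   all times [s] at which the epoch occurs, and empty at all other times. *)
Definition epoch_metric (R : realType) (m : interference) (sigma alpha : R)
    (e : epoch) (rho : fading_index -> R) (D : nat -> R -> R) (s : R) :
    set (\bar R) :=
  let others := others_interference m alpha rho D s in
  match e with
  | Handover =>
      [set x | exists i j, handover_at D s i j /\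
        x = ratio sigma (power alpha (rho Rho) (D i s))
              (combine m (power alpha (rho Rho') (D i s))%:E
                 (others [set k | k <> i /\ k <> j]))]
  | MaxSignal =>
      [set x | exists i, max_signal_at D s i /\
        x = ratio sigma (power alpha (rho Rho) (D i s))
              (others [set k | k <> i])]
  | MaxInterference =>
      [set x | exists i j, max_interference_at D s i j /\
        x = ratio sigma (power alpha (rho Rho) (D j s))
              (combine m (power alpha (rho Rho') (D i s))%:E
                 (others [set k | k <> i /\ k <> j]))]
  | MinInterference =>
      [set x | exists i j l, min_interference_at D s i j l /\
        x = ratio sigma (power alpha (rho Rho) (D l s))
              (combine m
                 (combine m (power alpha (rho Rho') (D i s))%:E
                    (power alpha (rho Rho'') (D i s))%:E)
                 (others [set k | [/\ k <> i, k <> j & k <> l]]))]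
  end.

Definition typical_metric (R : realType) (m : interference) (sigma alpha : R)
    (rho : fading_index -> R) (D : nat -> R -> R) (s : R) : set (\bar R) :=
  [set x | exists i, nearest_at D s i /\
    x = ratio sigma (power alpha (rho Rho) (D i s))
          (others_interference m alpha rho D s [set k | k <> i])].

Definition exceeds (R : realType) (tau : R) (S : set (\bar R)) : Prop :=
  exists2 x, S x & (tau%:E <= x)%E.

Definition intensity d (Omega : measurableType d) (R : realType)
    (P : probability Omega R) (N : Omega -> set R) : \bar R :=
  (\int[P]_w \esum_(t in N w `&` `[0%R, 1%R]) 1)%E.

Definition palm_expectation d (Omega : measurableType d) (R : realType)
    (P : probability Omega R) (N : Omega -> set R) (f : Omega -> R -> \bar R) :
    \bar R :=
  ((intensity P N)^-1 * \int[P]_w \esum_(t in N w `&` `[0%R, 1%R]) f w t)%E.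

Definition palm_probability d (Omega : measurableType d) (R : realType)
    (P : probability Omega R) (N : Omega -> set R) (E : Omega -> set R) :
    \bar R :=
  palm_expectation P N (fun w t => (\1_(E w) t)%:E).

Inductive vantage (R : realType) := AtEpoch of epoch | AtTime of R.

Definition coverage_probability d (Omega : measurableType d) (R : realType)
    (P : probability Omega R) (lambda : R) (N : network P lambda)
    (v sigma alpha tau : R) (rho : Omega -> fading_index -> R)
    (m : interference) (star : vantage R) : \bar R :=
  match star with
  | AtEpoch e =>
      palm_probability P (fun w => epoch_times e (distance N v w))
        (fun w => [set s | exceeds tau
           (epoch_metric m sigma alpha e (rho w) (distance N v w) s)])
  | AtTime t =>
      P [set w | exceeds tau
           (typical_metric m sigma alpha (rho w) (distance N v w) t)]
  end.

(* Main.v *)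
Require Import Defs.
From HB Require Import structures.
From mathcomp Require Import all_boot all_order all_algebra.
From mathcomp Require Import all_classical all_reals all_analysis.
From mathcomp Require Import measurable_realfun.
From mathcomp Require Import ring lra.

Set Implicit Arguments.
Unset Strict Implicit.
Unset Printing Implicit Defensive.

Import Order.TTheory GRing.Theory Num.Theory.
Import numFieldNormedType.Exports.
Import HBNNSimple.

Local Open Scope classical_set_scope.
Local Open Scope ring_scope.

(** Dilating the plane by [c] turns a Poisson process of intensity [lambda]
    into one of intensity [lambda / c ^+ 2].  Combined with the dilation of time
    by the same [c], it sends straight motion at speed [v] to straight motion at
    speed [v], so each distance at time [c * t] is [c] times what it was at time
    [t].  Epochs are therefore stretched by [c], and the powers received at an
    epoch all get the factor [c `^ (- alpha)].  Multiplying exponential marks of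
    parameter [mu1] by [mu1 / mu2] gives exponential marks of parameter [mu2]
    and again puts one factor in front of all powers.  Without noise the metric
    is a quotient of powers, so both factors cancel.  With
    [c = Num.sqrt (lambda1 / lambda2)] the second network has the law of the
    dilated first one; hence its mean numbers of epochs, and of covered epochs,
    in [0, 1] are those of the first network in [0, 1 / c].  By stationarity
    both carry the factor [1 / c] ([mean_count_window]), which drops out of the
    Palm quotient.  For an observation at a fixed time, stationarity brings
    [t / c] back to [t].

    The two networks live on different probability spaces and list their atoms
    in arbitrary orders, so having the same law must be given a meaning that
    ignores the enumeration.  It is carried by the generating functional [pgf],
    the limit of the expectations of [\prod_(i < m) g (e i w)].  The Poisson
    counts determine it ([poisson_pgf]); independent angles and fading marks
    replace [g] by its average over the marks ([marking]); and changes of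
    variables in the plane give its behaviour under the motion and the
    dilation ([exponent_shift], [exponent_scale]).  At indicators it yields the
    void probabilities ([pgf_void]), and these determine the expectation of
    every symmetric measurable functional ([same_law_integral]): almost surely
    the stations have distinct distances to the origin, finitely many below any
    bound ([ae_keyed]), so they can be listed by increasing distance, and the
    list is a measurable function of the void events
    ([void_event_readable]).

    The number of epochs in a window is such a functional.  If the initial
    distances are distinct, an epoch solves an equation
    [D i s = D j s] or is a time of closest approach; both are linear in [s], so
    the epochs lie among countably many measurable times
    ([events_candidate]), which makes their number measurable
    ([measurable_simple_count]). *)

(** * Integrals of products and independence *)

Lemma measurable_preimage d1 d2 (T1 : measurableType d1) (T2 : measurableType d2)
  (f : T1 -> T2) (A : set T2) :
  measurable_fun setT f -> measurable A -> measurable (f @^-1` A).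
Proof. by move=> mf mA; rewrite -[X in measurable X]setTI; exact: mf. Qed.

Lemma integral_indic_comp d1 d2 (T1 : measurableType d1) (T2 : measurableType d2) (R : realType)
  (mu : {measure set T1 -> \bar R}) (f : T1 -> T2) (A : set T2) :
  measurable_fun setT f -> measurable A ->
  (\int[mu]_w (\1_A (f w))%:E = mu (f @^-1` A))%E.
Proof.
move=> mf mA; rewrite -[X in mu X]setIT -integral_indic//.
exact: measurable_preimage.
Qed.

Section probability_tools.
Context d (Om : measurableType d) (R : realType) (P : probability Om R).

Lemma bounded_cvg (f_ : nat -> Om -> R) (f : Om -> R) :
  (forall n, measurable_fun setT (f_ n)) -> measurable_fun setT f ->
  (forall n w, 0 <= f_ n w <= 1) ->
  {ae P, forall w, f_ n w @[n --> \oo] --> f w} ->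
  (\int[P]_w (f_ n w)%:E @[n --> \oo] --> \int[P]_w (f w)%:E)%E.
Proof.
move=> mf_ mf f01 ff.
have h1 n : measurable_fun setT (EFin \o f_ n) by exact/measurable_EFinP.
have h2 : measurable_fun setT (EFin \o f) by exact/measurable_EFinP.
have h3 : {ae P, forall w, setT w -> (EFin \o f_ n) w @[n --> \oo] --> (EFin \o f) w}.
  apply: filterS ff => w h _; apply/fine_cvgP; split => //; exact: nearW.
have h4 : P.-integrable setT (EFin \o cst 1) by exact: finite_measure_integrable_cst.
have h5 : {ae P, forall w n, setT w -> (`|(EFin \o f_ n) w| <= (EFin \o cst (1%R : R)) w)%E}.
  apply: aeW => w n _; rewrite /= lee_fin.
  by have /andP[? ?] := f01 n w; rewrite ger0_norm.
by have [_ _] := dominated_convergence measurableT h1 h2 h3 h4 h5.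
Qed.

Lemma integral01 (f : Om -> R) : measurable_fun setT f -> (forall w, 0 <= f w <= 1) ->
  (0 <= \int[P]_w (f w)%:E <= 1)%E.
Proof.
move=> mf f01; apply/andP; split.
  by apply: integral_ge0 => w _; rewrite lee_fin; case/andP: (f01 w).
apply: (@le_trans _ _ (\int[P]_w (cst 1 w))%E); last first.
  by rewrite integral_cst//= [X in (_ * X)%E](@probability_setT _ _ _ P) mule1.
apply: ge0_le_integral => //.
- by move=> w _; rewrite lee_fin; case/andP: (f01 w).
- exact/measurable_EFinP.
- by move=> w _; rewrite lee_fin; case/andP: (f01 w).
Qed.
End probability_tools.

Lemma prod01 (R : realType) (I : Type) (s : seq I) (p : I -> R) :
  (forall i, 0 <= p i <= 1) -> 0 <= \prod_(i <- s) p i <= 1.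
Proof.
move=> p01; elim/big_ind: _ => // [|x y /andP[x0 x1] /andP[y0 y1]].
  by rewrite ler01 lexx.
by rewrite mulr_ge0//= mulr_ile1.
Qed.

Section law.
Context d1 d2 (Om : measurableType d1) (T : measurableType d2) (R : realType).
Variables (mu : {measure set Om -> \bar R}) (nu : {measure set T -> \bar R}).
Variables (Y : Om -> T) (W : Om -> R).
Hypothesis mY : measurable_fun setT Y.
Hypothesis mW : measurable_fun setT W.
Hypothesis W0 : forall w, 0 <= W w.
Hypothesis muE : forall A, measurable A -> (\int[mu]_w ((\1_A (Y w))%:E * (W w)%:E) = nu A)%E.

(** The usual passage from indicators to nonnegative functions through simple
    functions and monotone convergence.  The weight [W] is what lets the factors
    of a product of independent variables be handled one at a time. *)
Lemma weighted_law (f : T -> \bar R) : measurable_fun setT f -> (forall x, 0 <= f x)%E ->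
  (\int[mu]_w (f (Y w) * (W w)%:E) = \int[nu]_x f x)%E.
Proof.
move=> mf f0.
pose g := nnsfun_approx measurableT mf.
have mWE : measurable_fun setT (EFin \o W) by exact/measurable_EFinP.
have m1 (A : set T) : measurable A -> measurable_fun setT (fun w => (\1_A (Y w))%:E * (W w)%:E)%E.
  move=> mA; apply: emeasurable_funM => //.
  by apply/measurable_EFinP; apply: measurableT_comp.
have sg (h : {nnsfun T >-> R}) : (\int[mu]_w ((h (Y w))%:E * (W w)%:E) = \int[nu]_x (h x)%:E)%E.
  transitivity (\int[mu]_w (\sum_(k \in range h) (k%:E * ((\1_(h @^-1` [set k]) (Y w))%:E * (W w)%:E))))%E.
    apply: eq_integral => w _.
    rewrite fimfunE -fsumEFin// ge0_mule_fsuml//.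
      by apply: eq_fsbigr => k _; rewrite EFinM muleA.
    by move=> k; rewrite EFinM nnfun_muleindic_ge0.
  rewrite ge0_integral_fsum//; last 2 first.
  - by move=> k; apply: measurable_funeM; exact: m1.
  - by move=> k w _; rewrite muleA mule_ge0 ?lee_fin//; exact: nnfun_muleindic_ge0.
  rewrite integralT_nnsfun sintegralE; apply: eq_fsbigr => k /set_mem [x _ <-].
  rewrite ge0_integralZl//=; first by rewrite muE.
  - exact: m1.
  - by move=> w _; rewrite mule_ge0// lee_fin.
  - by rewrite lee_fin.
transitivity (\int[mu]_w limn (fun n => ((g n (Y w))%:E * (W w)%:E)))%E.
  apply: eq_integral => w _; apply/esym/cvg_lim => //; apply: cvgeZr => //.
  exact: cvg_nnsfun_approx.
rewrite monotone_convergence//=; last 3 first.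
- move=> n; apply: emeasurable_funM => //; apply/measurable_EFinP.
  exact: measurableT_comp.
- by move=> n w _; rewrite mule_ge0// lee_fin.
- move=> w _ a b ab; rewrite lee_pmul// ?lee_fin//.
  exact/lefP/nd_nnsfun_approx.
under eq_fun do rewrite sg.
rewrite -monotone_convergence//=; last 3 first.
- by move=> n; apply/measurable_EFinP.
- by move=> n x _; rewrite lee_fin.
- by move=> x _ a b ab; rewrite lee_fin; exact/lefP/nd_nnsfun_approx.
by apply: eq_integral => x _; apply/cvg_lim => //; exact: cvg_nnsfun_approx.
Qed.
End law.

Section rv.
Context d1 d2 (Om : measurableType d1) (T : measurableType d2) (R : realType).
Variables (P : probability Om R) (Y : Om -> T) (mY : measurable_fun setT Y).

Definition rv : {RV P >-> T} := HB.pack Y (isMeasurableFun.Build _ _ _ _ Y mY).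

Lemma distribution_rvE A : distribution P rv A = P (Y @^-1` A).
Proof. by []. Qed.

Lemma integral_rv (f : T -> \bar R) : measurable_fun setT f -> (forall x, 0 <= f x)%E ->
  (\int[distribution P rv]_x f x = \int[P]_w f (Y w))%E.
Proof. by move=> mf f0; rewrite ge0_integral_distribution. Qed.
End rv.

Section independent_expectation.
Context d d' (Om : measurableType d) (T : measurableType d') (R : realType) (P : probability Om R).
Variables (m : nat) (X : 'I_m -> Om -> T).
Hypothesis mX : forall i, measurable_fun setT (X i).
Hypothesis indX : independent_family P X.

Lemma measurable_prod_fun d0 (T0 : measurableType d0) I (s : seq I) (h : I -> T0 -> R) :
  (forall i, measurable_fun setT (h i)) -> measurable_fun setT (fun w => \prod_(i <- s) h i w).
Proof.
move=> mh; elim: s => [|i s IH].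
  by under eq_fun do rewrite big_nil; exact: measurable_cst.
by under eq_fun do rewrite big_cons; exact: measurable_funM.
Qed.

(** Independence is the case where all factors are indicators.  Indicators are
    traded for general functions one coordinate at a time: with the other
    factors gathered in a weight, [weighted_law] applies to the remaining one. *)
Lemma independent_expectation (f : 'I_m -> T -> R) :
  (forall i, measurable_fun setT (f i)) -> (forall i x, 0 <= f i x <= 1) ->
  (\int[P]_w (\prod_i f i (X i w))%:E = \prod_i \int[P]_w (f i (X i w))%:E)%E.
Proof.
move=> mf f01.
(* The statement for functions which are indicators from index [j] on. *)
suff H (j : nat) : forall f : 'I_m -> T -> R,
  (forall i, measurable_fun setT (f i)) -> (forall i x, 0 <= f i x <= 1) ->
  (forall i : 'I_m, (j <= i)%N -> exists2 A, measurable A & f i = \1_A) ->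
  (\int[P]_w (\prod_i f i (X i w))%:E = \prod_i \int[P]_w (f i (X i w))%:E)%E.
  by apply: (H m) => // i; rewrite leqNgt ltn_ord.
elim: j {f mf f01} => [|j IH] f mf f01 fA.
  have {}fA i : exists A, measurable A /\ f i = \1_A.
    by have [A mA ->] := fA i (leq0n _); exists A.
  have /choice[A /all_and2[mA fE]] := fA.
  have mXA i : measurable (X i @^-1` A i).
    exact: measurable_preimage.
  transitivity (P (\bigcap_(k in [set: 'I_m]) (X k @^-1` A k))).
    rewrite -[LHS](_ : \int[P]_w (\1_(\bigcap_(k in [set: 'I_m]) (X k @^-1` A k)) w)%:E = _)%E.
      rewrite integral_indic ?setIT//.
      by apply: fin_bigcap_measurable => //; exact: finite_finset.
    apply: eq_integral => w _; congr (_%:E).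
    under eq_bigr do rewrite fE indicE.
    rewrite indicE; case: (boolP (w \in _)) => [/set_mem h|/negP h].
      by rewrite big1// => i _; rewrite mem_set//; exact: h.
    have [i /negP/negbTE hi] : exists i, ~ (X i w \in A i).
      apply/existsNP => h'; apply: h; apply/mem_set => i _; exact: set_mem (h' i).
    by rewrite (bigD1 i)//= hi mul0r.
  rewrite (indX (i := id))//; last first.
    by move=> k; exists (A k) => //; rewrite setTI.
  apply: eq_bigr => i _; rewrite fE integral_indic_comp; [by []|exact: mX|exact: mA].
have [jm|mj] := ltnP j m; last first.
  apply: IH => // i ji; have := leq_trans mj ji; by rewrite leqNgt ltn_ord.
pose j0 := Ordinal jm.
pose W w := \prod_(i | i != j0) f i (X i w).
pose c := (\prod_(i | i != j0) \int[P]_w (f i (X i w))%:E)%E.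
have key (g : T -> R) : measurable_fun setT g -> (forall x, 0 <= g x <= 1) ->
  (exists2 A, measurable A & g = \1_A) ->
  (\int[P]_w ((g (X j0 w))%:E * (W w)%:E) = \int[P]_w (g (X j0 w))%:E * c)%E.
  move=> mg g01 gA.
  pose f' i := if i == j0 then g else f i.
  have mf' i : measurable_fun setT (f' i) by rewrite /f'; case: eqP.
  have f'01 i x : 0 <= f' i x <= 1 by rewrite /f'; case: eqP.
  have f'0 : f' j0 = g by rewrite /f' eqxx.
  have f'n i : i != j0 -> f' i = f i by rewrite /f' => /negbTE ->.
  have f'A (i : 'I_m) : (j <= i)%N -> exists2 A, measurable A & f' i = \1_A.
    move=> ji; rewrite /f'; case: eqP => // /eqP ij; apply: fA.
    by rewrite ltn_neqAle ji andbT; apply: contra ij => /eqP ij; apply/eqP/val_inj.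
  have := IH f' mf' f'01 f'A.
  rewrite (bigD1 j0)//= f'0.
  under [X in (_ * X)%E]eq_bigr => i ij do rewrite f'n//.
  move=> <-; apply: eq_integral => w _; rewrite (bigD1 j0)//= f'0 EFinM.
  by congr (_ * _%:E)%E; apply: eq_bigr => i ij; rewrite f'n.
have W01 w : 0 <= W w <= 1.
  rewrite /W; elim/big_ind: _ => [|x y /andP[x0 x1] /andP[y0 y1]|i _].
  - by rewrite ler01 lexx.
  - by rewrite mulr_ge0//= mulr_ile1.
  - exact: f01.
have mW : measurable_fun setT W.
  rewrite /W; under eq_fun do rewrite -big_filter.
  by apply: measurable_prod_fun => i; exact: measurableT_comp.
have I01 i : (0 <= \int[P]_w (f i (X i w))%:E <= 1)%E.
  by apply: integral01 => // ; exact: measurableT_comp.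
have c01 : (0 <= c <= 1)%E.
  rewrite /c; elim/big_ind: _ => [|x y /andP[x0 x1] /andP[y0 y1]|i _].
  - by rewrite lee_fin ler01 lexx.
  - by rewrite mule_ge0//= -[leRHS]mule1 lee_pmul.
  - exact: I01.
have [/andP[c0 c1] cf] : (0 <= fine c <= 1) /\ c = (fine c)%:E.
  by case: (c) c01 => [r| |] /andP[]//=; rewrite !lee_fin => -> ->.
rewrite (bigD1 j0)//= -/c.
under eq_integral do rewrite (bigD1 j0)//= -/(W _).
(* The weighted law of [X j0] is its law times the product of the other
   expectations. *)
pose nu := mscale (NngNum c0) (distribution P (rv P (mX j0))).
have nuE A : measurable A -> (\int[P]_w ((\1_A (X j0 w))%:E * (W w)%:E) = nu A)%E.
  move=> mA; rewrite key//; last 2 first.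
  - by move=> x; rewrite indicE; case: (_ \in _); rewrite ?lexx ler01.
  - by exists A.
  rewrite /nu /mscale/= [in LHS]cf muleC; congr (_ * _)%E.
  exact: integral_indic_comp.
rewrite (weighted_law (nu := nu) (mX j0) mW _ nuE (f := EFin \o f j0)); last 3 first.
- by move=> w; case/andP: (W01 w).
- exact/measurable_EFinP.
- by move=> x; rewrite lee_fin; case/andP: (f01 j0 x).
rewrite /nu ge0_integral_mscale//; last 2 first.
- exact/measurable_EFinP.
- by move=> x _; rewrite lee_fin; case/andP: (f01 j0 x).
rewrite -cf muleC; congr (_ * _)%E.
rewrite integral_rv//; first exact/measurable_EFinP.
by move=> x; rewrite lee_fin; case/andP: (f01 j0 x).
Qed.
End independent_expectation.

Section decoupling.
Context d (Om : measurableType d) (R : realType) (P : probability Om R).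
Variables (F G : set (set Om)).
Hypothesis mF : <<s F >> `<=` measurable.
Hypothesis mG : <<s G >> `<=` measurable.
Hypothesis FG : independent_pair P <<s F >> <<s G >>.

Local Notation OF := (g_sigma_algebraType F).
Local Notation OG := (g_sigma_algebraType G).

Lemma measurable_toF : measurable_fun setT (id : Om -> OF).
Proof. by move=> _ A mA; rewrite setTI; exact: mF. Qed.

Lemma measurable_toG : measurable_fun setT (id : Om -> OG).
Proof. by move=> _ A mA; rewrite setTI; exact: mG. Qed.

(** Two independent sigma-algebras on one space behave like the two factors of a
    product space: the law of the diagonal map into the product of the two
    coarser measurable spaces is a product measure, and Tonelli applies. *)
Lemma decoupling (H : OF * OG -> \bar R) : measurable_fun setT H -> (forall x, 0 <= H x)%E ->
  (\int[P]_w H (w, w) = \int[P]_w \int[P]_w' H (w, w'))%E.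
Proof.
move=> mH H0.
pose PF := distribution P (rv P measurable_toF).
pose PG := distribution P (rv P measurable_toG).
have md : measurable_fun setT (fun w : Om => (w, w) : OF * OG).
  by apply/measurable_fun_pairP; split; [exact: measurable_toF|exact: measurable_toG].
have E : (\int[PF \x PG]_x H x = \int[distribution P (rv P md)]_x H x)%E.
  apply: eq_measure_integral => A mA _.
  by apply: product_measure_unique => // B C mB mC; exact: FG.
transitivity (\int[distribution P (rv P md)]_x H x)%E; first by rewrite integral_rv.
rewrite -E fubini_tonelli1//= integral_rv//=; last 2 first.
- exact: measurable_fun_fubini_tonelli_F.
- by move=> x; exact: integral_ge0.
apply: eq_integral => w _; rewrite /fubini_F integral_rv//.
apply: measurableT_comp => //; exact: pair1_measurable.
Qed.
End decoupling.

(** * Generating functionals and independent marks *)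

Section pgf.
Context d d' (Om : measurableType d) (T : measurableType d') (R : realType).
Variable P : probability Om R.

(** The probability generating functional of the points [e i], weighted by an
    event [B] about further random variables.  The infinite product over all
    points enters as a limit of expectations of finite ones, so that a single
    notion covers functions [g] for which the exponent is infinite. *)
Definition pgf (e : nat -> Om -> T) (B : set Om) (Psi : (T -> R) -> \bar R) : Prop :=
  forall g : T -> R, measurable_fun setT g -> (forall x, 0 <= g x <= 1) ->
    (\int[P]_w ((\prod_(i < m) g (e i w)) * \1_B w)%:E)%E @[m --> \oo] -->
    (expeR (- Psi g) * P B)%E.
End pgf.

Section marking.
Context d d1 d2 (Om : measurableType d) (T : measurableType d1) (M : measurableType d2) (R : realType).
Variables (P : probability Om R) (nu : probability M R).

Definition average (g : T * M -> R) (x : T) : R := fine (\int[nu]_y (g (x, y))%:E)%E.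

Section average.
Variable g : T * M -> R.
Hypotheses (mg : measurable_fun setT g) (g01 : forall x, 0 <= g x <= 1).

Let average_bounds x : (0 <= \int[nu]_y (g (x, y))%:E <= 1)%E.
Proof.
apply: integral01 => [|y]; last exact: g01.
by apply: measurableT_comp => //; exact: pair1_measurable.
Qed.

Lemma averageE x : ((average g x)%:E = \int[nu]_y (g (x, y))%:E)%E.
Proof.
rewrite /average fineK//; have /andP[h0 h1] := average_bounds x.
by rewrite ge0_fin_numE// (le_lt_trans h1)// ltry.
Qed.

Lemma average01 x : 0 <= average g x <= 1.
Proof. by rewrite -!lee_fin averageE; exact: average_bounds. Qed.

Lemma measurable_average : measurable_fun setT (average g).
Proof.
apply: (measurableT_comp (f := fine)) => //.
apply: (@measurable_fun_fubini_tonelli_F _ _ T M R nu (EFin \o g)).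
- exact/measurable_EFinP.
- by move=> x; rewrite lee_fin; case/andP: (g01 x).
Qed.
End average.

Variables (e : nat -> Om -> T) (J : Type) (mark : J -> Om -> M) (k : nat -> J).
Hypothesis me : forall i, measurable_fun setT (e i).
Hypothesis mmark : forall j, measurable_fun setT (mark j).
Hypothesis ind : independent_pair P (sigma_generated e) (sigma_generated mark).
Variable B : set Om.
Hypothesis GB : sigma_generated mark B.
(* The marks attached to the points are independent with law [nu], and
   independent of [B]. *)
Hypothesis markB : forall m (f : 'I_m -> M -> R),
  (forall i, measurable_fun setT (f i)) -> (forall i x, 0 <= f i x <= 1) ->
  (\int[P]_w ((\prod_i f i (mark (k i) w)) * \1_B w)%:E = (\prod_i \int[nu]_y (f i y)%:E) * P B)%E.

Lemma sigma_generated_measurable (I : Type) d0 (T0 : measurableType d0) (X : I -> Om -> T0) :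
  (forall i, measurable_fun setT (X i)) -> sigma_generated X `<=` measurable.
Proof.
move=> mX; apply: smallest_sub; first exact: sigma_algebra_measurable.
by move=> A [i _ [C mC <-]]; exact: mX.
Qed.

(** Conditionally on the points, the marks average each factor [g (e i, mark)]
    independently, so the marked functional at [g] is the unmarked one at the
    averaged function. *)
Lemma marking Psi : pgf P e setT Psi ->
  pgf P (fun i w => (e i w, mark (k i) w)) B (fun g => Psi (average g)).
Proof.
move=> Pe g mg g01.
have mB : measurable B := sigma_generated_measurable mmark GB.
have fB : P B \is a fin_num by apply: fin_num_measure.
have := Pe _ (measurable_average mg g01) (average01 mg g01).
rewrite probability_setT mule1 => h.
suff -> : (fun m => \int[P]_w ((\prod_(i < m) g (e i w, mark (k i) w)) * \1_B w)%:E)%E =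
   (fun m => \int[P]_w (\prod_(i < m) average g (e i w) * \1_setT w)%:E * P B)%E.
  apply: cvgeZr => //.
apply/funext => m.
pose F := \bigcup_i preimage_set_system [set: Om] (e i) measurable.
pose G := \bigcup_i preimage_set_system [set: Om] (mark i) measurable.
pose OF := g_sigma_algebraType F.
pose OG := g_sigma_algebraType G.
pose H (x : OF * OG) := ((\prod_(i < m) g (e i x.1, mark (k i) x.2)) * \1_B x.2)%:E.
rewrite -[LHS]/(\int[P]_w H (w, w))%E.
rewrite (@decoupling _ _ _ P F G _ _ _ H); last 5 first.
- exact: sigma_generated_measurable.
- exact: sigma_generated_measurable.
- exact: ind.
- apply/measurable_EFinP; apply: measurable_funM.
    apply: measurable_prod_fun => i; apply: (measurableT_comp mg).
    apply/measurable_fun_pairP; split.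
      apply: (measurableT_comp (f := (e i : OF -> T))) => //.
      move=> _ A mA; apply: sub_sigma_algebra; exists i => //; exists A => //.
    apply: (measurableT_comp (f := (mark (k i) : OG -> M))) => //.
    move=> _ A mA; apply: sub_sigma_algebra; exists (k i) => //; exists A => //.
  apply: (measurableT_comp (f := (\1_B : OG -> R))) => //.
- move=> x; rewrite lee_fin mulr_ge0// prodr_ge0// => i _.
  by case/andP: (g01 (e i x.1, mark (k i) x.2)).
under eq_integral => w _.
  rewrite (markB (f := fun i y => g (e i w, y))); last 2 first.
    by move=> i; apply: (measurableT_comp mg); exact: pair1_measurable.
    by move=> i x; exact: g01.
  under eq_bigr do rewrite -averageE//.
  rewrite prodEFin.
  over.
rewrite ge0_integralZr//; last 2 first.
- apply/measurable_EFinP; apply: measurable_prod_fun => i.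
  by apply: measurableT_comp (me i); exact: measurable_average.
- move=> w _; rewrite lee_fin prodr_ge0// => i _.
  by case/andP: (average01 mg g01 (e i w)).
by congr (_ * _)%E; apply: eq_integral => w _; rewrite indicT mulr1.
Qed.
End marking.

(** * The generating functional of a Poisson process *)

Lemma cvg_natr_eventually (R : realType) (u : nat -> nat) (n : nat) :
  ((u m)%:R%:E : \bar R) @[m --> \oo] --> (n%:R%:E : \bar R) -> \forall m \near \oo, u m = n.
Proof.
move=> h; have {}h : ((u m)%:R : R) @[m --> \oo] --> (n%:R : R) by exact: (fine_cvg h).
have /cvgrPdist_lt/(_ 1 ltr01) := h.
apply: filterS => m; rewrite distrC.
rewrite ltr_norml => /andP[h1 h2]; case: (ltngtP (u m) n) => // un.
  have : (u m).+1%:R <= n%:R :> R by rewrite ler_nat.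
  by rewrite -natr1 => ?; exfalso; lra.
have : n.+1%:R <= (u m)%:R :> R by rewrite ler_nat.
by rewrite -natr1 => ?; exfalso; lra.
Qed.

Lemma nneseries_expR (R : realType) (x : R) : 0 <= x ->
  (\sum_(0 <= n <oo) (x ^+ n / n`!%:R)%:E = (expR x)%:E)%E.
Proof.
move=> x0; rewrite expRE -EFin_lim; last first.
  rewrite /pseries/=; under eq_fun do rewrite mulrC.
  exact: is_cvg_series_exp_coeff.
apply/congr_lim/funext => n/=; rewrite /pseries/= /series/= -sumEFin//.
by under eq_bigr do rewrite mulrC.
Qed.

Lemma area_rectangle (R : realType) (i j : interval R) :
  area ([set` i] `*` [set` j]) = (lebesgue_measure [set` i] * lebesgue_measure [set` j])%E.
Proof. by apply: product_measure1E; exact: measurable_itv. Qed.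

Section pgf_monotone_limit.
Context d d' (Om : measurableType d) (T : measurableType d') (R : realType).
Variables (P : probability Om R) (e : nat -> Om -> T).
Hypothesis me : forall i, measurable_fun setT (e i).

Let a (f : T -> R) m := (\int[P]_w (\prod_(i < m) f (e i w))%:E)%E.

Let ma (f : T -> R) m : measurable_fun setT f ->
  measurable_fun setT (fun w => \prod_(i < m) f (e i w)).
Proof. by move=> mf; apply: measurable_prod_fun => i; exact: measurableT_comp. Qed.

Lemma pgf_nonincreasing (f : T -> R) : measurable_fun setT f -> (forall x, 0 <= f x <= 1) ->
  nonincreasing_seq (a f).
Proof.
move=> mf f01; apply/nonincreasing_seqP => m; apply: ge0_le_integral => //.
- by move=> w _; rewrite lee_fin; have /andP[] := prod01 (index_enum 'I_m.+1) (fun i : 'I_m.+1 => f01 (e i w)).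
- by apply/measurable_EFinP; exact: ma.
- by apply/measurable_EFinP; exact: ma.
- move=> w _; rewrite lee_fin big_ord_recr/= ler_piMr//.
    by have /andP[] := prod01 (index_enum 'I_m) (fun i : 'I_m => f01 (e i w)).
  by have /andP[] := f01 (e m w).
Qed.

(** Both limits decrease, in [m] because the factors are at most 1 and in [n]
    because the [gn n] lie above [g]; this is why they may be exchanged. *)
Lemma pgf_monotone_limit (g : T -> R) (gn : nat -> T -> R) (I : \bar R) (In : nat -> \bar R) :
  measurable_fun setT g -> (forall x, 0 <= g x <= 1) ->
  (forall n, measurable_fun setT (gn n)) -> (forall n x, 0 <= gn n x <= 1) ->
  (forall n x, g x <= gn n x) -> (forall x, gn n x @[n --> \oo] --> g x) ->
  (forall n, a (gn n) m @[m --> \oo] --> expeR (- In n)) ->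
  (forall n, In n <= I)%E -> In n @[n --> \oo] --> I ->
  a g m @[m --> \oo] --> expeR (- I).
Proof.
move=> mg g01 mgn gn01 ggn gn_cvg simple InI I_cvg.
have agn m : a (gn n) m @[n --> \oo] --> a g m.
  apply: bounded_cvg => [n||n w|]; [exact: ma|exact: ma|exact: prod01|].
  apply: aeW => w; elim: (index_enum _) => [|i s IH].
    by under eq_fun do rewrite big_nil; rewrite big_nil; exact: cvg_cst.
  by under eq_fun do rewrite big_cons; rewrite big_cons; exact: cvgM.
have ag_cvg := ereal_nonincreasing_cvgn (pgf_nonincreasing mg g01).
suff <- : ereal_inf (range (a g)) = expeR (- I) by exact: ag_cvg.
apply/eqP; rewrite eq_le; apply/andP; split; last first.
  apply: le_ereal_inf_tmp => _ [m _ <-].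
  rewrite -(cvg_lim _ (agn m))//; apply: lime_ge; first by apply/cvg_ex; exists (a g m).
  apply: nearW => n; rewrite (@le_trans _ _ (expeR (- In n)))//.
    by rewrite lee_expeR leeN2.
  rewrite -(cvg_lim _ (simple n))//; apply: lime_le; first by apply/cvg_ex; eexists; exact: simple.
  by exists m => // k mk; exact: pgf_nonincreasing.
have le_n n : (ereal_inf (range (a g)) <= expeR (- In n))%E.
  rewrite -(cvg_lim _ ag_cvg)// -(cvg_lim _ (simple n))//; apply: lee_lim.
  - by apply/cvg_ex; eexists; exact: ag_cvg.
  - by apply/cvg_ex; eexists; exact: simple.
  - apply: nearW => m; apply: ge0_le_integral => //.
    + by move=> w _; rewrite lee_fin; have /andP[] := prod01 (index_enum 'I_m) (fun i : 'I_m => g01 (e i w)).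
    + by apply/measurable_EFinP; exact: ma.
    + by apply/measurable_EFinP; exact: ma.
    + by move=> w _; rewrite lee_fin; apply: ler_prod => i _; rewrite ggn andbT; case/andP: (g01 (e i w)).
have i0 : (0 <= ereal_inf (range (a g)))%E.
  by apply: le_ereal_inf_tmp => _ [m _ <-]; case/andP: (integral01 P (ma m mg) (fun w => prod01 (index_enum 'I_m) (fun i : 'I_m => g01 (e i w)))).
have [y yE] := expeR_total i0.
rewrite -yE lee_expeR leeNr -(cvg_lim _ I_cvg)//; apply: lime_le.
  by apply/cvg_ex; eexists; exact: I_cvg.
by apply: nearW => n; rewrite leeNr -lee_expeR yE.
Qed.
End pgf_monotone_limit.

Section poisson_pgf.
Context d (Om : measurableType d) (R : realType) (P : probability Om R).
Variables (lambda : R) (X : nat -> Om -> R * R).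
Hypothesis lambda0 : 0 <= lambda.
Hypothesis mX : forall i, measurable_fun setT (X i).
Hypothesis pX : poisson_process P lambda X.

Lemma measurable_point_count A : measurable A -> measurable_fun setT (point_count X A).
Proof.
move=> mA; apply: ge0_emeasurable_sum => [i w _ _|i _]; first by rewrite lee_fin.
by apply/measurable_EFinP; apply: measurableT_comp (mX i).
Qed.

Lemma poisson_prob_set1 (r : R) n : 0 <= r ->
  poisson_prob r 0%N [set n] = (r ^+ n / n`!%:R * expR (- r))%:E.
Proof.
rewrite /poisson_prob le_eqVlt => /predU1P[<-|r0].
  rewrite ltxx diracE oppr0 expR0 mulr1; case: n => [|n].
    by rewrite mem_set// expr0 fact0 divr1.
  by rewrite memNset// expr0n/= mul0r.
rewrite r0 esum_set1; first by rewrite /poisson_pmf r0.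
by rewrite lee_fin poisson_pmf_ge0.
Qed.

(* A real exponent makes [c ^ N] measurable in [N] and total on infinite counts;
   on finite counts it is the usual power, with [0 ^ 0 = 1]. *)
Let cpow (c : R) (y : \bar R) : R := c `^ `|fine y|.

(** The generating function [E (c ^ N)] of a Poisson variable, by summing the
    exponential series over the values of [N].  Summing at [c = 1] shows that
    the count is almost surely finite. *)
Lemma expected_cpow A c : measurable A -> (area A < +oo)%E -> 0 <= c <= 1 ->
  (\int[P]_w (cpow c (point_count X A w))%:E = (expR (- (lambda * fine (area A) * (1 - c))))%:E)%E
  /\ {ae P, forall w, exists n : nat, point_count X A w = n%:R%:E}.
Proof.
move=> mA fA /andP[c0 c1].
set r := lambda * fine (area A).
have r0 : 0 <= r by rewrite mulr_ge0// fine_ge0// measure_ge0.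
pose N := point_count X A.
have mN : measurable_fun setT N by exact: measurable_point_count.
pose D (n : nat) := N @^-1` [set n%:R%:E].
have mD n : measurable (D n) by apply: measurable_preimage.
have PD n : P (D n) = (r ^+ n / n`!%:R * expR (- r))%:E.
  by rewrite -poisson_prob_set1// -(pX.1 A)//.
have tD : trivIset setT D.
  apply/trivIsetP => i j _ _ ij; apply/seteqP; split=> // w []; rewrite /D/= => -> [] /eqP.
  by rewrite eqr_nat (negbTE ij).
have series (q : R) : 0 <= q ->
    (\sum_(0 <= n <oo) (q ^+ n * (r ^+ n / n`!%:R * expR (- r)))%:E = (expR (- (r * (1 - q))))%:E)%E.
  move=> q0; transitivity (\sum_(0 <= n <oo) ((expR (- r))%:E * ((q * r) ^+ n / n`!%:R)%:E))%E.
    apply: eq_eseriesr => n _; rewrite -EFinM; congr _%:E; rewrite (exprMn n q r).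
    by move: (expR _) (q ^+ n) (r ^+ n) (n`!%:R^-1) => a1 a2 a3 a4; ring.
  rewrite nneseriesZl//; last by move=> n _; rewrite lee_fin divr_ge0// exprn_ge0// mulr_ge0.
  rewrite (nneseries_expR (mulr_ge0 q0 r0)) -EFinM -expRD; congr (expR _)%:E; ring.
have PU : P (\bigcup_n D n) = 1%E.
  rewrite measure_bigcup// (@eq_eseriesl _ _ xpredT); last by move=> n; rewrite in_setT.
  have := series 1 ler01; rewrite subrr mulr0 oppr0 expR0 => <-.
  by apply: eq_eseriesr => n _; rewrite expr1n mul1r; exact: PD.
have ae : {ae P, forall w, exists n : nat, N w = n%:R%:E}.
  exists (~` (\bigcup_n D n)); split.
  - by apply: measurableC; exact: bigcup_measurable.
  - by rewrite probability_setC ?PU ?subee//; exact: bigcup_measurable.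
  - by apply: subsetC => w [n _ Dn]; exists n.
split => //.
have mc : measurable_fun setT (fun w => (cpow c (N w))%:E).
  apply/measurable_EFinP; apply: (measurableT_comp (measurable_powRr c)).
  by apply: measurableT_comp => //; apply: measurableT_comp.
have mU : measurable (\bigcup_n D n) by exact: bigcup_measurable.
transitivity (\int[P]_(w in \bigcup_n D n) (cpow c (N w))%:E)%E.
  have nU : P (~` (\bigcup_n D n)) = 0 by rewrite probability_setC// PU subee.
  rewrite (ge0_negligible_integral _ measurableT mc _ nU)//; last 2 first.
  - exact: measurableC.
  - by move=> w _; rewrite lee_fin powR_ge0.
  by rewrite setTD setCK.
rewrite ge0_integral_bigcup//; last 2 first.
- exact: measurable_funTS.
- by move=> w _; rewrite lee_fin powR_ge0.
rewrite -series//; apply: eq_eseriesr => n _.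
transitivity (\int[P]_(w in D n) (cst (c ^+ n)%:E w))%E.
  apply: eq_integral => w /set_mem; rewrite /D/= /cpow => ->/=.
  by rewrite normr_nat powR_mulrn.
by rewrite integral_cst// [RHS]EFinM; congr (_ * _)%E; exact: PD.
Qed.

(** For [1 - g] a simple function on disjoint sets [A k], the product over the
    points equals the product over [k] of [(1 - dl k) ^ N (A k)], and the counts
    of disjoint sets are independent. *)
Lemma poisson_simple n (A : 'I_n -> set (R * R)) (dl : 'I_n -> R) :
  (forall k, measurable (A k)) -> (forall k, area (A k) < +oo)%E -> trivIset setT A ->
  (forall k, 0 <= dl k <= 1) ->
  (\int[P]_w (\prod_(i < m) (1 - \sum_k dl k * \1_(A k) (X i w)))%:E)%E @[m --> \oo] -->
  (expR (- (lambda * \sum_k dl k * fine (area (A k)))))%:E.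
Proof.
move=> mA fA tA d01.
have c01 k : 0 <= 1 - dl k <= 1 by have := d01 k; lra.
pose N k := point_count X (A k).
have E : (\int[P]_w (\prod_k cpow (1 - dl k) (N k w))%:E =
    (expR (- (lambda * \sum_k dl k * fine (area (A k)))))%:E)%E.
  rewrite (@independent_expectation _ _ _ _ _ P n N _ _ (fun k => cpow (1 - dl k))).
  - rewrite (eq_bigr (fun k => (expR (- (lambda * (dl k * fine (area (A k))))))%:E)); last first.
      move=> k _; rewrite (expected_cpow (mA k) (fA k) (c01 k)).1; congr (expR _)%:E; ring.
    rewrite prodEFin -expR_sum; congr (expR _)%:E.
    by rewrite mulr_sumr sumrN.
  - by move=> k; exact: measurable_point_count.
  - exact: pX.2.
  - move=> k; apply: (measurableT_comp (measurable_powRr (1 - dl k))).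
    by apply: measurableT_comp => //; exact: fine_measurable.
  - move=> k y; rewrite powR_ge0/=; have /andP[h0 h1] := c01 k.
    rewrite /cpow; have e : 1 `^ `|fine y| = 1 :> R by rewrite powR1.
    by rewrite -[leRHS]e ge0_ler_powR// nnegrE.
have dE x : 1 - \sum_k dl k * \1_(A k) x = \prod_k (1 - dl k * \1_(A k) x).
  have [[j Aj]|nA] := pselect (exists j, A j x).
    have nj k : k != j -> \1_(A k) x = 0 :> R.
      move=> kj; rewrite indicE memNset// => Ak.
      by move/eqP: kj; apply; apply: tA => //; exists x.
    rewrite (bigD1 j)//= big1 => [|k kj]; last by rewrite nj// mulr0.
    rewrite (bigD1 j)//= [X in _ = _ * X]big1 => [|k kj]; last by rewrite nj// mulr0 subr0.
    by rewrite addr0 mulr1.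
  have nj k : \1_(A k) x = 0 :> R by rewrite indicE memNset// => Ak; apply: nA; exists k.
  rewrite !big1 ?subr0// => k _; by rewrite nj mulr0 ?subr0.
have b01 m w : 0 <= \prod_(i < m) (1 - \sum_k dl k * \1_(A k) (X i w)) <= 1.
  apply: prod01 => i; rewrite dE; apply: prod01 => k; have := d01 k.
  by rewrite indicE; case: (_ \in _); rewrite ?mulr1 ?mulr0; lra.
rewrite -E; apply: bounded_cvg => //.
- move=> m; apply: measurable_prod_fun => i; apply: measurable_funB => //.
  rewrite (_ : (fun w => _) = (fun x => \sum_k dl k * \1_(A k) x) \o X i)//.
  apply: measurableT_comp => //; apply: measurable_sum => k.
  by apply: measurable_funM => //; exact: measurable_indic.
- apply: measurable_prod_fun => k; apply: (measurableT_comp (measurable_powRr (1 - dl k))).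
  apply: measurableT_comp => //; apply: (measurableT_comp (f := fine)) => //.
  exact: measurable_point_count.
have : {ae P, forall w, forall k, exists n : nat, N k w = n%:R%:E}.
  apply: filter_forall => k; exact: (expected_cpow (mA k) (fA k) (c01 k)).2.
apply: filterS => w /choice[nk Nw].
pose u k m := (\sum_(i < m) (X i w \in A k))%N.
have uE k m : \prod_(i < m) (1 - dl k * \1_(A k) (X i w)) = (1 - dl k) ^+ (u k m).
  rewrite /u -prodrXr; apply: eq_bigr => i _; rewrite indicE.
  by case: (_ \in _); rewrite ?mulr1 ?mulr0 ?subr0.
apply: cvg_near_cst.
have : \forall m \near \oo, forall k, u k m = nk k.
  apply: filter_forall => k; apply: (@cvg_natr_eventually R).
  rewrite -Nw (_ : (fun m => _) = fun m => \sum_(0 <= i < m) (\1_(A k) (X i w))%:E)%E; last first.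
    apply/funext => m; rewrite /u natr_sum sumEFin big_mkord.
    by congr _%:E.
  by apply: is_cvg_nneseries => i _ _; rewrite lee_fin.
apply: filterS => m um.
rewrite (eq_bigr (fun i : 'I_m => \prod_k (1 - dl k * \1_(A k) (X i w)))) => [|i _]; last exact: dE.
rewrite exchange_big; apply: eq_bigr => k _; rewrite uE um /cpow Nw/=.
by rewrite normr_nat powR_mulrn//; have := c01 k; lra.
Qed.

Local Notation leb2 := ((@lebesgue_measure R) \x (@lebesgue_measure R))%E.

(** Simple functions of bounded support increase to [1 - g]; the truncation to the
    squares [K n] keeps the areas finite. *)
Lemma poisson_pgf : pgf P X setT (fun g => lambda%:E * \int[leb2]_x (1 - g x)%:E)%E.
Proof.
move=> g mg g01.
pose h x := (1 - g x)%:E : \bar R.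
have mh : measurable_fun setT h by apply/measurable_EFinP; exact: measurable_funB.
have h0 x : (0 <= h x)%E by rewrite lee_fin subr_ge0; case/andP: (g01 x).
pose hn := nnsfun_approx measurableT mh.
have hn_nd x : {homo (fun n => hn n x) : a b / (a <= b)%N >-> a <= b}.
  by move=> a b ab; exact/lefP/nd_nnsfun_approx.
have hn_cvg x : (hn n x)%:E @[n --> \oo] --> h x by exact: cvg_nnsfun_approx.
have hn_le n x : hn n x <= 1 - g x.
  rewrite -lee_fin -[leRHS]/(h x) -(cvg_lim _ (hn_cvg x))//; apply: lime_ge.
    by apply/cvg_ex; exists (h x).
  by exists n => // k nk; rewrite /= lee_fin; exact: hn_nd.
pose K (n : nat) : set (R * R) := [set` `[- n%:R, n%:R]] `*` [set` `[- n%:R, n%:R]].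
have mK n : measurable (K n) by exact: measurableX.
have K_nd n m : (n <= m)%N -> K n `<=` K m.
  move=> nm x [/=]; rewrite !in_itv/= => /andP[a b] /andP[c e'].
  have nm' : n%:R <= m%:R :> R by rewrite ler_nat.
  by split => /=; rewrite in_itv/=; apply/andP; split; lra.
have aK n : (area (K n) < +oo)%E.
  rewrite /K area_rectangle !lebesgue_measure_itv/=.
  by case: ifP => _; rewrite ?mule0 ?ltry// -EFinB -EFinM ltry.
pose gn n x := 1 - hn n x * \1_(K n) x.
have mgn n : measurable_fun setT (gn n).
  by apply: measurable_funB => //; apply: measurable_funM => //; exact: measurable_indic.
have gn01 n x : 0 <= gn n x <= 1.
  rewrite /gn; have := hn_le n x; have := g01 x; have : 0 <= hn n x by [].
  by rewrite indicE; case: (_ \in _); rewrite ?mulr1 ?mulr0; lra.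
have ggn n x : g x <= gn n x.
  rewrite /gn; have := hn_le n x; have := g01 x; have : 0 <= hn n x by [].
  by rewrite indicE; case: (_ \in _); rewrite ?mulr1 ?mulr0; lra.
have gn_cvg x : gn n x @[n --> \oo] --> g x.
  have h1 : hn n x @[n --> \oo] --> 1 - g x by exact: (fine_cvg (hn_cvg x)).
  have h2 : (\1_(K n) x : R) @[n --> \oo] --> (1 : R).
    apply: cvg_near_cst.
    have [M [Mx1 Mx2]] : exists M : nat, `|x.1| <= M%:R /\ `|x.2| <= M%:R.
      exists (Num.bound (`|x.1| + `|x.2|)).
      have := archi_boundP (addr_ge0 (normr_ge0 x.1) (normr_ge0 x.2)).
      by have := normr_ge0 x.1; have := normr_ge0 x.2; split; lra.
    exists M => // n /= Mn; rewrite indicE mem_set//; apply: K_nd Mn _ _.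
    by split; rewrite /= in_itv/= -ler_norml.
  rewrite -[X in _ --> X](_ : 1 - (1 - g x) * 1 = g x); last by ring.
  by apply: cvgB; [exact: cvg_cst|exact: cvgM].
have simple n : ((\int[P]_w (\prod_(i < m) gn n (X i w))%:E) @[m --> \oo] -->
    expeR (- (lambda%:E * \int[leb2]_x (1 - gn n x)%:E)))%E.
  have /finite_seqP[s' s'E] : finite_set (range (hn n)) by [].
  pose s := undup s'; have s_uniq : uniq s := undup_uniq s'.
  have sE x : (x \in s) = (x \in range (hn n)).
    by rewrite mem_undup s'E; apply/idP/idP => [xs|/set_mem//]; exact: mem_set.
  pose dl (k : 'I_(size s)) := nth 0 s k.
  pose A k := hn n @^-1` [set dl k] `&` K n.
  have mA k : measurable (A k) by exact: measurableI.
  have fA k : (area (A k) < +oo)%E.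
    apply: le_lt_trans (aK n); apply: le_measure; rewrite ?inE; [exact: mA|exact: mK|].
    exact: subIsetr.
  have tA : trivIset setT A.
    move=> i j _ _ [x [[/= xi _] [/= xj _]]]; apply/val_inj/eqP => /=.
    by rewrite -(nth_uniq 0 _ _ s_uniq) ?ltn_ord//; apply/eqP; exact: etrans (esym xi) xj.
  have d01 k : 0 <= dl k <= 1.
    have : dl k \in s by apply: mem_nth.
    rewrite sE => /set_mem [x _ <-].
    by have := hn_le n x; have := g01 x; have : 0 <= hn n x by []; lra.
  have gE x : gn n x = 1 - \sum_k dl k * \1_(A k) x.
    rewrite /gn; congr (1 - _).
    have hs : hn n x \in s by rewrite sE mem_set//; exists x.
    have hs' : (index (hn n x) s < size s)%N by rewrite index_mem.
    rewrite (bigD1 (Ordinal hs'))//= big1 => [|k kj].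
      rewrite addr0 /dl nth_index//; congr (_ * _); rewrite !indicE; congr ((_ : bool)%:R).
      apply/idP/idP => /set_mem h'; apply/mem_set; last by case: h'.
      by split => //=; rewrite /dl/= nth_index.
    rewrite indicE memNset ?mulr0// => -[/= xk _]; move/eqP: kj; apply; apply/val_inj => /=.
    by rewrite xk index_uniq.
  have := poisson_simple mA fA tA d01.
  rewrite (_ : (fun m => _) = fun m => (\int[P]_w (\prod_(i < m) gn n (X i w))%:E)%E); last first.
    by apply/funext => m; apply: eq_integral => w _; congr _%:E; apply: eq_bigr => i _; rewrite gE.
  suff -> : (lambda%:E * \int[leb2]_x (1 - gn n x)%:E = (lambda * \sum_k dl k * fine (area (A k)))%:E)%E by [].
  rewrite EFinM; congr (_ * _)%E; rewrite -sumEFin.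
  transitivity (\int[leb2]_x (\sum_k (dl k)%:E * (\1_(A k) x)%:E))%E.
    apply: eq_integral => x _; rewrite gE opprB addrC subrK -sumEFin.
    by apply: eq_bigr => k _; rewrite EFinM.
  rewrite ge0_integral_sum//.
  - apply: eq_bigr => k _; rewrite ge0_integralZl//.
    + have E := @integral_indic _ _ _ leb2 setT measurableT _ (mA k).
      by rewrite setIT in E; rewrite E EFinM fineK// ge0_fin_numE//; exact: fA.
    + apply/measurable_EFinP; apply: measurable_indic; exact: mA.
    + by rewrite lee_fin; case/andP: (d01 k).
  - by move=> k; apply: measurable_funeM; apply/measurable_EFinP; apply: measurable_indic; exact: mA.
  - by move=> k x _; rewrite mule_ge0// lee_fin; case/andP: (d01 k).
pose I (f : R * R -> R) := (lambda%:E * \int[leb2]_x (1 - f x)%:E)%E.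
rewrite probability_setT mule1.
rewrite (_ : (fun m => _) = fun m => (\int[P]_w (\prod_(i < m) g (X i w))%:E)%E); last first.
  by apply/funext => m; apply: eq_integral => w _; rewrite indicT mulr1.
apply: (@pgf_monotone_limit _ _ _ _ _ _ _ mX g gn _ (fun n => I (gn n))) => //.
- move=> n; apply: lee_pmul => //.
    by apply: integral_ge0 => x _; rewrite lee_fin subr_ge0; case/andP: (gn01 n x).
  apply: ge0_le_integral => //.
  + by move=> x _; rewrite lee_fin subr_ge0; case/andP: (gn01 n x).
  + by apply/measurable_EFinP; apply: measurable_funB => //; exact: mgn.
  + by move=> x _; rewrite lee_fin lerB.
- apply: cvgeZl => //.
  rewrite (_ : (\int[leb2]_x (1 - g x)%:E = \int[leb2]_x limn (fun n => (1 - gn n x)%:E))%E); last first.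
    apply: eq_integral => x _; apply/esym/cvg_lim => //; apply/cvg_EFin; first exact: nearW.
    by apply: cvgB; [exact: cvg_cst|exact: gn_cvg].
  apply: cvg_monotone_convergence => //.
  + by move=> n; apply/measurable_EFinP; apply: measurable_funB => //; exact: mgn.
  + by move=> n x _; rewrite lee_fin subr_ge0; case/andP: (gn01 n x).
  + move=> x _ n m nm; rewrite lee_fin lerB// /gn lerB// ler_pM//.
      exact: hn_nd.
    rewrite !indicE; case: (boolP (x \in K n)) => // /set_mem Kx.
    by rewrite mem_set//; exact: K_nd Kx.
Qed.
End poisson_pgf.

(** * Ordering the points of a configuration *)

Section ordered_enumeration.
Context (R : realType).
Implicit Types (h : nat -> R).

Definition locally_finite h := forall x, finite_set [set i | h i < x].

Lemma exists_argmin h (A : set nat) : locally_finite h -> A !=set0 ->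
  exists2 i, A i & forall j, A j -> h i <= h j.
Proof.
move=> hf [i0 Ai0].
have /finite_seqP[s sE] : finite_set (A `&` [set j | h j < h i0 + 1]).
  by apply: sub_finite_set (hf (h i0 + 1)); exact: subIsetr.
have sA i : i \in s -> A i.
  by move=> si; have : [set` s] i by []; rewrite -sE => -[].
pose t := i0 :: s.
have [k _ kh] := @arg_minP _ _ 'I_(size t) ord0 xpredT (fun k => h (nth i0 t k)) isT.
have {}kh j : j \in t -> h (nth i0 t k) <= h j.
  move=> jt; have js : (index j t < size t)%N by rewrite index_mem.
  by have := kh (Ordinal js) isT; rewrite /= nth_index.
have H : nth i0 t k \in t by exact: mem_nth.
exists (nth i0 t k).
  by move: H; rewrite inE => /orP[/eqP ->//|/sA].
move=> j Aj; have [ji|ij] := ltP (h j) (h i0 + 1).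
  by apply: kh; rewrite inE; apply/orP; right; have : [set` s] j by rewrite -sE.
by rewrite (le_trans _ ij)// ler_wpDr// kh// mem_head.
Qed.

(** Start at the minimum and move each time to the least value above the current
    one.  No index is missed, since finitely many lie below any given value. *)
Lemma increasing_enumeration h : locally_finite h -> injective h ->
  exists2 s : nat -> nat, bijective s & forall k, h (s k) < h (s k.+1).
Proof.
move=> hf hi.
have unb i : [set j | h i < h j] !=set0.
  apply: contrapT => ne.
  apply: infinite_nat; apply: sub_finite_set (hf (h i + 1)) => j _ /=.
  rewrite (@le_lt_trans _ _ (h i)) ?ltrDl// leNgt; apply/negP => ij.
  by apply: ne; exists j.
have [i0 _ h0] := exists_argmin hf (ex_intro [set: nat] 0%N I).
have /choice[nxt nxtP] : forall i, exists j, h i < h j /\ forall k, h i < h k -> h j <= h k.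
  by move=> i; have [j ij jm] := exists_argmin hf (unb i); exists j.
pose s k := iter k nxt i0.
have sS k : h (s k) < h (s k.+1) by rewrite /s iterS; have [] := nxtP (s k).
have smono : {homo (h \o s) : a b / (a < b)%N >-> a < b} by apply: homo_ltn => //; exact: lt_trans.
have sinj : injective s.
  move=> a b sab; case: (ltngtP a b) => // /smono /=; by rewrite sab ltxx.
have ssurj i : exists k, s k = i.
  apply: contrapT => /forallNP ns.
  have lt k : h (s k) < h i.
    elim: k => [|k IH]; rewrite lt_neqAle; apply/andP; split.
    - by apply/eqP => /hi /(ns 0%N).
    - exact: h0.
    - by apply/eqP => /hi /(ns k.+1).
    - by rewrite /s iterS; apply: (nxtP _).2.
  apply: infinite_nat; have : finite_set (s @^-1` [set j | h j < h i]).
    by apply: finite_preimage => //; move=> a b _ _; exact: sinj.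
  by apply: sub_finite_set => k _ /=.
exists s => //; have /choice[g gK] := ssurj.
by exists g => // k; apply: sinj.
Qed.

End ordered_enumeration.

Section two_points.
Context d d' (Om : measurableType d) (T : measurableType d') (R : realType).
Variables (P : probability Om R) (e : nat -> Om -> T).
Hypothesis me : forall i, measurable_fun setT (e i).

Definition two_points (C : set T) : set Om :=
  [set w | exists i j, [/\ i != j, C (e i w) & C (e j w)]].

Lemma measurable_two_points C : measurable C -> measurable (two_points C).
Proof.
move=> mC.
rewrite (_ : two_points C = \bigcup_i \bigcup_(j in [set j | i != j]) (e i @^-1` C `&` e j @^-1` C)).
  apply: bigcup_measurable => i _; apply: bigcup_measurable => j _.
  by apply: measurableI; exact: measurable_preimage.
apply/seteqP; split => w.
  by move=> [i [j [ij Ci Cj]]]; exists i => //; exists j.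
by move=> [i _ [j ij [Ci Cj]]]; exists i, j.
Qed.

(** With [N] the number of points in [C] and [g t = E ((1 - t) ^ N)], the pointwise
    bound [1_(N >= 2) + 4 * 2 ^ (- N) <= 2 + 2 * 0 ^ N] gives
    [P (N >= 2) <= 2 + 2 * g 1 - 4 * g 2^-1 = 2 * (1 - expR (- L / 2)) ^+ 2],
    and [1 - expR (- x) <= x]. *)
Lemma two_points_le C (L : R) : measurable C -> 0 <= L ->
  (forall t : R, 0 <= t <= 1 ->
    (\int[P]_w (\prod_(i < m) (1 - t * \1_C (e i w)))%:E)%E @[m --> \oo] --> (expR (- (t * L)))%:E) ->
  (P (two_points C) <= (L ^+ 2 / 2)%:E)%E.
Proof.
move=> mC L0 pg.
pose N m w := (\sum_(i < m) (e i w \in C))%N.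
pose two m : set Om := [set w | (2 <= N m w)%N].
have prodE m (t : R) w : \prod_(i < m) (1 - t * \1_C (e i w)) = (1 - t) ^+ N m w.
  rewrite /N -prodrXr; apply: eq_bigr => i _; rewrite indicE.
  by case: (_ \in _); rewrite ?mulr1 ?mulr0 ?subr0.
have mprod m (t : R) : measurable_fun setT (fun w => \prod_(i < m) (1 - t * \1_C (e i w))).
  apply: measurable_prod_fun => i; apply: measurable_funB => //; apply: measurable_funM => //.
  by apply: measurableT_comp (me i); exact: measurable_indic.
have prod_01 m (t : R) w : 0 <= t <= 1 -> 0 <= \prod_(i < m) (1 - t * \1_C (e i w)) <= 1.
  move=> t01; apply: prod01 => i; rewrite indicE.
  by case: (_ \in _); rewrite ?mulr1 ?mulr0; lra.
have mtwo m : measurable (two m).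
  rewrite (_ : two m = \bigcup_(i in [set i | (i < m)%N]) \bigcup_(j in [set j | (j < m)%N && (i != j)]) (e i @^-1` C `&` e j @^-1` C)).
    apply: bigcup_measurable => i _; apply: bigcup_measurable => j _.
    by apply: measurableI; exact: measurable_preimage.
  apply/seteqP; split => w.
    rewrite /two/= /N => N2.
    have [i Ci] : exists i : 'I_m, e i w \in C.
      by apply/existsP; move: N2; apply: contraTT => /existsPn h; rewrite big1// => i _; rewrite (negbTE (h i)).
    have [j /andP[ij Cj]] : exists j : 'I_m, (i != j) && (e j w \in C).
      apply/existsP; move: N2; apply: contraTT => /existsPn h; rewrite (bigD1 i)//= Ci big1// => j ji.
      by have := h j; rewrite eq_sym ji/= => /negbTE ->.
    exists i => //=; exists j => /=; first by rewrite ltn_ord.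
    by split; exact: set_mem.
  move=> [i /= im [j /= /andP[jm ij] [Ci Cj]]]; rewrite /two/= /N.
  rewrite (bigD1 (Ordinal im))//= (bigD1 (Ordinal jm))/=; last by rewrite eq_sym.
  by rewrite !mem_set.
have two_nd : nondecreasing_seq two.
  apply/nondecreasing_seqP => m; apply/subsetPset => w; rewrite /two/= /N big_ord_recr/= => h.
  by rewrite (leq_trans h)// leq_addr.
have sub : two_points C `<=` \bigcup_m two m.
  move=> w [i [j [ij Ci Cj]]].
  have h m : (i < m)%N -> (j < m)%N -> two m w.
    move=> im jm; rewrite /two/= /N (bigD1 (Ordinal im))//= (bigD1 (Ordinal jm))/=; last by rewrite eq_sym.
    by rewrite !mem_set.
  by exists (i + j).+1 => //; apply: h; rewrite ltnS ?leq_addr ?leq_addl.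
have mU : measurable (\bigcup_m two m) by exact: bigcup_measurable.
have Pcvg : P (two m) @[m --> \oo] --> P (\bigcup_m two m).
  exact: nondecreasing_cvg_mu.
have ineq m : (P (two m) + 4%:E * \int[P]_w (\prod_(i < m) (1 - 2^-1 * \1_C (e i w)))%:E <=
    2%:E + 2%:E * \int[P]_w (\prod_(i < m) (1 - 1 * \1_C (e i w)))%:E)%E.
  rewrite -(setIT (two m)) -integral_indic// -!ge0_integralZl//; last first.
  - by move=> w _; rewrite lee_fin; case/andP: (prod_01 m 2^-1 w ltac:(lra)).
  - by apply/measurable_EFinP; exact: mprod.
  - by move=> w _; rewrite lee_fin; case/andP: (prod_01 m 1 w ltac:(lra)).
  - by apply/measurable_EFinP; exact: mprod.
  have two1 : ((2%R : R)%:E = \int[P]_w cst ((2%R : R)%:E) w)%E.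
    by rewrite integral_cst// [X in (_ * X)%E](@probability_setT _ _ _ P) mule1.
  rewrite [X in (X + \int[_]_x (2 * _))%E]two1.
  have p0 (t : R) w : 0 <= t <= 1 -> (0 <= (\prod_(i < m) (1 - t * \1_C (e i w)))%:E)%E.
    by move=> t01; rewrite lee_fin; case/andP: (prod_01 m t w t01).
  have mp (t : R) : measurable_fun setT (fun w => (\prod_(i < m) (1 - t * \1_C (e i w)))%:E).
    by apply/measurable_EFinP; exact: mprod.
  have m1 : measurable_fun setT (fun w => (\1_(two m) w : R)%:E).
    by apply/measurable_EFinP; exact: measurable_indic.
  rewrite -!ge0_integralD//; first last.
  - by apply: measurable_funeM; exact: mp.
  - by move=> w _; apply: mule_ge0; [by rewrite lee_fin|by apply: p0; lra].
  - by apply: measurable_funeM; exact: mp.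
  - by move=> w _; apply: mule_ge0; [by rewrite lee_fin|by apply: p0; lra].
  - by move=> w _; rewrite lee_fin.
  apply: ge0_le_integral => //.
  - by move=> w _; apply: adde_ge0; [by rewrite lee_fin|apply: mule_ge0; [by rewrite lee_fin|by apply: p0; lra]].
  - by apply: emeasurable_funD => //; apply: measurable_funeM; exact: mp.
  - by apply: emeasurable_funD => //; apply: measurable_funeM; exact: mp.
  move=> w _; rewrite !prodE -!EFinM -!EFinD lee_fin subrr.
  rewrite indicE; case: (leqP 2 (N m w)) => n2.
    rewrite mem_set// expr0n; have -> : (N m w == 0) = false by case: (N m w) n2.
    rewrite mulr0 addr0.
    have : (1 - 2^-1) ^+ N m w <= (1 - 2^-1 : R) ^+ 2 by apply: ler_wiXn2l => //; lra.
    by rewrite /= expr2; lra.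
  rewrite memNset => [|/=]; last by rewrite /two/= leqNgt n2.
  by case: (N m w) n2 => [|[|//]] _; rewrite ?expr0 ?expr1/= ?mulr0n; lra.
apply: (@le_trans _ _ (P (\bigcup_m two m))).
  by apply: le_measure => //; rewrite inE//; exact: measurable_two_points.
have lim1 : (P (two m) + 4%:E * \int[P]_w (\prod_(i < m) (1 - 2^-1 * \1_C (e i w)))%:E)%E @[m --> \oo] -->
   (P (\bigcup_m two m) + 4%:E * (expR (- (2^-1 * L)))%:E)%E.
  apply: cvgeD => //; first by rewrite fin_num_adde_defl//.
  by apply: cvgeZl => //; apply: pg; lra.
have lim2 : (2%:E + 2%:E * \int[P]_w (\prod_(i < m) (1 - 1 * \1_C (e i w)))%:E)%E @[m --> \oo] -->
   (2%:E + 2%:E * (expR (- (1 * L)))%:E)%E.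
  apply: cvgeD => //; first exact: cvg_cst.
  by apply: cvgeZl => //; apply: pg; lra.
have : (P (\bigcup_m two m) + 4%:E * (expR (- (2^-1 * L)))%:E <= 2%:E + 2%:E * (expR (- (1 * L)))%:E)%E.
  rewrite -(cvg_lim _ lim1)// -(cvg_lim _ lim2)//; apply: lee_lim.
  - by apply/cvg_ex; eexists; exact: lim1.
  - by apply/cvg_ex; eexists; exact: lim2.
  - exact: nearW.
have fU : P (\bigcup_m two m) \is a fin_num by rewrite fin_num_measure.
rewrite -(fineK fU) -!EFinM -!EFinD !lee_fin.
have -> : expR (- (1 * L)) = expR (- (2^-1 * L)) ^+ 2 by rewrite expr2 -expRD; congr expR; lra.
have := expR_ge1Dx (- (2^-1 * L)); have := expR_gt0 (- (2^-1 * L)).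
have : expR (- (2^-1 * L)) <= 1 by rewrite -[leRHS]expR0 ler_expR; lra.
move: (expR _) (fine _) => x p; nra.
Qed.
End two_points.

Section keyed.
Context d d' (Om : measurableType d) (T : measurableType d') (R : realType).
Variables (P : probability Om R) (e : nat -> Om -> T) (key : T -> R) (c : R).
Hypothesis me : forall i, measurable_fun setT (e i).
Hypothesis mkey : measurable_fun setT key.
Hypothesis key0 : forall x, 0 <= key x.
Hypothesis c0 : 0 <= c.

Let slice p q : set T := key @^-1` [set` `[p, q[].

Hypothesis slice_pgf : forall p q t : R, 0 <= p <= q -> 0 <= t <= 1 ->
  (\int[P]_w (\prod_(i < m) (1 - t * \1_(slice p q) (e i w)))%:E)%E @[m --> \oo] -->
  (expR (- (t * (c * (q - p)))))%:E.

(** Configurations that can be listed by strictly increasing key. *)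
Definition keyed (x : nat -> T) : Prop :=
  injective (fun i => key (x i)) /\ locally_finite (fun i => key (x i)).

Let bad (n : nat) : set Om := [set w |
  (exists i j, [/\ i != j, key (e i w) < n%:R & key (e i w) = key (e j w)]) \/
  infinite_set [set i | key (e i w) < n%:R]].

(* Two points of the same key below [n], or infinitely many of key below [n],
   force two points into one of [M] slices of width [n / M].  This has
   probability of order [M * (1 / M) ^+ 2]. *)
Let U (n M : nat) : set Om := \big[setU/set0]_(k < M)
  two_points e (slice (k%:R * (n%:R / M%:R)) (k.+1%:R * (n%:R / M%:R))).

Let mU n M : measurable (U n M).
Proof.
apply: bigsetU_measurable => k _; apply: measurable_two_points => //.
exact: measurable_preimage.
Qed.

Let U_le n M : (0 < M)%N -> (P (U n M) <= ((c * n%:R) ^+ 2 / 2 / M%:R)%:E)%E.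
Proof.
move=> M0; apply: le_trans; first apply: (@Boole_inequality _ _ _ P
  (fun k => two_points e (slice (k%:R * (n%:R / M%:R)) (k.+1%:R * (n%:R / M%:R)))) M).
  by move=> k _; apply: measurable_two_points => //; exact: measurable_preimage.
have M0' : 0 < M%:R :> R by rewrite ltr0n.
apply: (@le_trans _ _ (\sum_(k < M) ((c * n%:R / M%:R) ^+ 2 / 2)%:E)%E).
  apply: lee_sum => k _; apply: two_points_le => //.
  - exact: measurable_preimage.
  - by rewrite !mulr_ge0// invr_ge0.
  move=> t t01.
  have := @slice_pgf (k%:R * (n%:R / M%:R)) (k.+1%:R * (n%:R / M%:R)) t _ t01.
  rewrite (_ : c * (_ - _) = c * n%:R / M%:R); last by rewrite -mulrBl -natr1; ring.
  apply; rewrite !mulr_ge0 ?invr_ge0//= ler_wpM2r ?ler_nat//.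
rewrite sumEFin lee_fin sumr_const card_ord -mulr_natr.
have : M%:R != 0 :> R by rewrite gt_eqF.
by move=> h; rewrite le_eqVlt; apply/orP; left; apply/eqP; field.
Qed.

Let badU n M : (0 < M)%N -> bad n `<=` U n M.
Proof.
move=> M0.
have M0' : 0 < M%:R :> R by rewrite ltr0n.
have sl w i : key (e i w) < n%:R -> exists k : 'I_M,
    slice (k%:R * (n%:R / M%:R)) (k.+1%:R * (n%:R / M%:R)) (e i w).
  move=> lt; have n0 : 0 < n%:R :> R by exact: le_lt_trans lt.
  pose y := key (e i w) * M%:R / n%:R.
  have y0 : 0 <= y by rewrite /y !mulr_ge0// invr_ge0.
  have /andP[h1 h2] := truncn_itv y0.
  have kM : (Num.truncn y < M)%N.
    rewrite -(ltr_nat R); apply: le_lt_trans h1 _.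
    by rewrite /y ltr_pdivrMr// mulrC ltr_pM2l.
  exists (Ordinal kM); rewrite /slice/= in_itv/=; apply/andP; split.
    by rewrite mulrA ler_pdivrMr// -ler_pdivlMr.
  by rewrite mulrA ltr_pdivlMr// -ltr_pdivrMr.
move=> w bw; apply: contrapT; rewrite /U.
rewrite -(bigcup_mkord M (fun k => two_points e (slice (k%:R * (n%:R / M%:R)) (k.+1%:R * (n%:R / M%:R))))) => nU.
have one k i j : (k < M)%N -> slice (k%:R * (n%:R / M%:R)) (k.+1%:R * (n%:R / M%:R)) (e i w) ->
    slice (k%:R * (n%:R / M%:R)) (k.+1%:R * (n%:R / M%:R)) (e j w) -> i = j.
  move=> kM si sj; apply: contrapT => /eqP ij; apply: nU; exists k => //.
  by exists i, j.
case: bw => [[i [j [ij lt eq]]]|inf].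
  have [k sk] := sl w i lt.
  have sj : slice (k%:R * (n%:R / M%:R)) (k.+1%:R * (n%:R / M%:R)) (e j w).
    by move: sk; rewrite /slice/= eq.
  by move: ij; rewrite (one k i j (ltn_ord k) sk sj) eqxx.
apply: inf; apply: (@sub_finite_set _ _ (\bigcup_(k in [set: 'I_M])
   [set i | slice (k%:R * (n%:R / M%:R)) (k.+1%:R * (n%:R / M%:R)) (e i w)])).
  by move=> i /= lt; have [k sk] := sl w i lt; exists k.
apply: bigcup_finite => [|k _]; first exact: finite_finset.
have [[i si]|ne] := pselect (exists i, slice (k%:R * (n%:R / M%:R)) (k.+1%:R * (n%:R / M%:R)) (e i w)).
  apply: sub_finite_set (finite_set1 i) => j /= sj.
  exact: one (ltn_ord k) sj si.
apply: sub_finite_set (finite_set0 _) => j /= sj; by apply: ne; exists j.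
Qed.

Lemma ae_keyed : {ae P, forall w, keyed (e^~ w)}.
Proof.
have nb n : {ae P, forall w, ~ bad n w}.
  exists (\bigcap_M U n M.+1); split.
  - by apply: bigcap_measurable => // M _; exact: mU.
  - apply/eqP; rewrite eq_le measure_ge0 andbT; apply/lee_addgt0Pr => eps eps0.
    rewrite add0e.
    pose K := (c * n%:R) ^+ 2 / 2.
    have K0 : 0 <= K by rewrite /K mulr_ge0// sqr_ge0.
    pose M := Num.bound (K / eps).
    apply: (@le_trans _ _ (P (U n M.+1))).
      apply: le_measure; rewrite ?inE//; last by move=> w; apply.
      by apply: bigcap_measurable => // k _; exact: mU.
    apply: (le_trans (U_le n (ltn0Sn M))); rewrite lee_fin -/K ler_pdivrMr ?ltr0n//.
    have := archi_boundP (divr_ge0 K0 (ltW eps0)); rewrite -/M ltr_pdivrMr// => h.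
    rewrite (le_trans (ltW h))// mulrC ler_pM2l// ler_nat//.
  - by move=> w /= /contrapT bw M _; exact: badU bw.
have : {ae P, forall w, forall n, ~ bad n w} by exact: ae_foralln.
apply: filterS => w nbw; split.
  move=> i j /= eq; apply: contrapT => /eqP ij.
  apply: (nbw (Num.bound (key (e i w)))); left; exists i, j; split => //.
  exact: archi_boundP.
move=> x; apply: contrapT => inf; apply: (nbw (Num.bound `|x|)); right => fin.
apply: inf; apply: sub_finite_set fin => i /= h.
by apply: lt_trans h _; apply: le_lt_trans (archi_boundP (normr_ge0 x)); exact: ler_norm.
Qed.

End keyed.

(** * Void probabilities determine symmetric functionals *)

Section configurations.
Context d d' (T : measurableType d) (Z : measurableType d') (n : nat) (R : realType).

Definition config : Type := ((nat -> T) * ('I_n -> Z))%type.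
HB.instance Definition _ := Pointed.on config.

(** Generators of the product sigma-algebra on configurations, where the
    enumeration of the points is visible. *)
Definition cylinders : set (set config) := [set C |
  (exists i A, measurable A /\ C = [set x | A (x.1 i)]) \/
  (exists j D, measurable D /\ C = [set x | D (x.2 j)])].

(** Events that see only which regions contain no point, and the extra variables.
    They are stable under intersection, so a probability is determined by its values on them. *)
Definition void_events : set (set config) := [set V | exists C D,
  [/\ measurable C, forall j, measurable (D j) &
    V = [set x | (forall i, ~ C (x.1 i)) /\ forall j : 'I_n, D j (x.2 j)]]].

Lemma void_eventsI : setI_closed void_events.
Proof.
move=> _ _ [C [D [mC mD ->]]] [C' [D' [mC' mD' ->]]].
exists (C `|` C'), (fun j => D j `&` D' j); split; [exact: measurableU|by move=> j; exact: measurableI|].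
apply/seteqP; split => x /=.
  by move=> [[xC xD] [xC' xD']]; split => [i []|j]; [exact: xC|exact: xC'|by split].
move=> [h hD]; split; split => i; do ?[by move=> xi; apply: (h i); by [left|right]]; by case: (hD i).
Qed.

Definition invariant (B : set config) :=
  forall x (s : nat -> nat), bijective s -> B (x.1 \o s, x.2) <-> B x.

Variable key : T -> R.
Hypothesis mkey : measurable_fun setT key.

Let V := g_sigma_algebraType void_events.

Let hit (A : set T) (p q : R) : set V :=
  [set x | exists i, A (x.1 i) /\ p <= key (x.1 i) < q].

Let measurable_hit A p q : measurable A -> measurable (hit A p q).
Proof.
move=> mA; rewrite -[hit A p q]setCK; apply: measurableC; apply: sub_sigma_algebra.
exists (A `&` key @^-1` [set` `[p, q[]), (fun=> setT); split => //.
  by apply: measurableI => //; exact: measurable_preimage.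
apply/seteqP; split => x /=.
  move=> h; split => // i [Ai]; rewrite /= in_itv/= => ki; by apply: h; exists i.
by move=> [h _] [i [Ai ki]]; apply: (h i); split => //=; rewrite in_itv.
Qed.

(* For a configuration enumerated by increasing key: at least [l] points have a
   key below [q].  The points are told apart by rational levels separating
   their keys. *)
Let Fixpoint atleast (l : nat) (q : R) : set V :=
  match l with
  | 0%N => setT
  | l'.+1 => \bigcup_(p : rat) ([set _ | ratr p < q] `&` (atleast l' (ratr p) `&` hit setT (ratr p) q))
  end.

Let measurable_atleast l q : measurable (atleast l q).
Proof.
elim: l q => [|l IH] q //=; apply: bigcupT_measurable_rat => p.
have [pq|pq] := boolP (ratr p < q).
  rewrite (_ : [set _ | _] = setT) ?setTI; last by apply/seteqP; split.
  by apply: measurableI => //; exact: measurable_hit.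
by rewrite (_ : [set _ | _] = set0) ?set0I//; apply/seteqP; split.
Qed.

(* The point of rank [k] lies in [A]: rational levels [p] and [q] isolate its
   key, and the points of key in [[p, q[] meet [A]. *)
Let select k A : set V := \bigcup_(p : rat) \bigcup_(q : rat)
  (atleast k (ratr p) `&` ~` atleast k.+1 (ratr p) `&` (hit A (ratr p) (ratr q) `&` ~` atleast k.+2 (ratr q))).

Let measurable_select k A : measurable A -> measurable (select k A).
Proof.
move=> mA; apply: bigcupT_measurable_rat => p; apply: bigcupT_measurable_rat => q.
apply: measurableI; apply: measurableI; rewrite ?setTD; try apply: measurableC.
- exact: measurable_atleast.
- exact: measurable_atleast.
- exact: measurable_hit.
- exact: measurable_atleast.
Qed.

Definition enumerates (x : nat -> T) (s : nat -> nat) :=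
  bijective s /\ forall k, key (x (s k)) < key (x (s k.+1)).

Section enumerated.
Variables (x : config) (s : nat -> nat).
Hypothesis xs : enumerates x.1 s.

Let y k := key (x.1 (s k)).

Let y_mono : {homo y : i j / (i < j)%N >-> i < j}.
Proof. by apply: homo_ltn => [? ? ?|k]; [exact: lt_trans|exact: xs.2]. Qed.

Let surj i : exists k, i = s k.
Proof. by have [[g _ gK] _] := xs; exists (g i). Qed.

Let below l : exists p : rat, ratr p < y l /\ forall k, (k < l)%N -> y k < ratr p.
Proof.
case: l => [|l].
  have [p] := @rat_in_itvoo _ (y 0%N - 1) (y 0%N) ltac:(by rewrite gtrDl ltrN10).
  by rewrite in_itv/= => /andP[_ p0]; exists p.
have [p] := rat_in_itvoo (y_mono (ltnSn l)).
rewrite in_itv/= => /andP[np pn]; exists p; split => // k kn.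
by rewrite (le_lt_trans _ np)//; move: kn; rewrite ltnS leq_eqVlt => /predU1P[->//|/y_mono/ltW].
Qed.

Let atleastP l q : atleast l q x <-> forall k, (k < l)%N -> y k < q.
Proof.
elim: l q => [|l IH] q /=; first by split.
split.
  move=> [p _ [/= pq [/IH np [i [_ /andP[pi iq]]]]]].
  have [j ij] := surj i; move: pi iq; rewrite ij -/(y j) => pj jq k kn.
  have nj : (l <= j)%N by rewrite leqNgt; apply/negP => /np; rewrite ltNge pj.
  rewrite (le_lt_trans _ jq)//; have : (k <= j)%N by rewrite (leq_trans _ nj).
  by rewrite leq_eqVlt => /predU1P[->//|/y_mono/ltW].
move=> h; have [p [pn np]] := below l.
exists p => //; split; first by rewrite /= (lt_trans pn)// h.
by split; [exact/IH|exists (s l); split => //; rewrite (ltW pn) h].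
Qed.

Lemma selectP k A : select k A x <-> A (x.1 (s k)).
Proof.
split.
  move=> [p _ [q _ [[/atleastP kp nkp] [[i [Ai /andP[pi iq]]] nkq]]]].
  have [j ij] := surj i; move: Ai pi iq; rewrite ij -/(y j) => Aj pj jq.
  suff <- : j = k by [].
  apply/eqP; rewrite eqn_leq; apply/andP; split; rewrite leqNgt; apply/negP => jk.
    apply: nkq; apply/atleastP => l; rewrite ltnS => lk.
    rewrite (le_lt_trans _ jq)//; have : (l <= j)%N by rewrite (leq_trans lk).
    by rewrite leq_eqVlt => /predU1P[->//|/y_mono/ltW].
  by move: pj; rewrite leNgt kp.
move=> Ak; have [p [pk kp]] := below k; have [q [qk kq]] := below k.+1.
exists p => //; exists q => //; split; split.
- exact/atleastP.
- by move/atleastP => /(_ k (ltnSn k)); rewrite ltNge (ltW pk).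
- by exists (s k); split => //; rewrite (ltW pk) kq.
- by move/atleastP => /(_ k.+1 (ltnSn _)); rewrite ltNge (ltW qk).
Qed.

End enumerated.

(** Once the points are listed by increasing key, the position of the point of
    rank [k] can be read off the void events, hence so can every event about the
    ordered list. *)
Lemma void_event_readable (B : set config) : <<s cylinders >> B ->
  exists B' : set config, <<s void_events >> B' /\
    forall x s, enumerates x.1 s -> B (x.1 \o s, x.2) <-> B' x.
Proof.
pose C : set (set config) := [set B | exists B' : set V, measurable B' /\
    forall x s, enumerates x.1 s -> B (x.1 \o s, x.2) <-> B' x].
suff sub : <<s cylinders >> `<=` C by move=> /sub [B' [mB' BB']]; exists B'.
apply: smallest_sub.
  split.
  - by exists set0; split => // x s _; split.
  - move=> A [A' [mA' AA']]; exists (~` A'); split; first exact: measurableC.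
    by move=> x s xs; have := AA' x s xs; rewrite /setC/=; tauto.
  - move=> A /choice[A' /all_and2[mA' AA']]; exists (\bigcup_l A' l); split.
      exact: bigcupT_measurable.
    move=> x s xs; split => -[l _ Al]; exists l => //; exact/(AA' l x s xs).
move=> _ [[i [A [mA ->]]]|[j [D [mD ->]]]].
  exists (select i A); split; first exact: measurable_select.
  by move=> x s xs; exact: iff_sym (selectP xs i A).
exists [set x | D (x.2 j)]; split; last by move=> x s xs.
apply: sub_sigma_algebra; exists set0, (fun k => if k == j then D else setT); split => //.
  by move=> k; case: ifP.
apply/seteqP; split => x /= => [Dx|[_ /(_ j)]]; last by rewrite eqxx.
by split => [i []|k]; case: eqP => // ->.
Qed.

End configurations.

Lemma ae_iff_measure d (Om : measurableType d) (R : realType) (P : probability Om R) (A B : set Om) :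
  measurable A -> measurable B -> {ae P, forall w, A w <-> B w} -> P A = P B.
Proof.
move=> mA mB AB; rewrite -[A]setIT -[B]setIT -!integral_indic//.
apply: ge0_ae_eq_integral => //.
- by apply/measurable_EFinP; exact: measurable_indic.
- by apply/measurable_EFinP; exact: measurable_indic.
apply: filterS AB => w AB _; congr (_%:E); rewrite !indicE; congr ((_ : bool)%:R).
by apply/idP/idP => /set_mem/AB/mem_set.
Qed.

Section transfer.
Context d0 d1 (T : measurableType d0) (Z : measurableType d1) (n : nat) (R : realType).
Variable key : T -> R.
Hypothesis mkey : measurable_fun setT key.

Local Notation config := (config T Z n).
Local Notation cylinders := (@cylinders _ _ T Z n).
Local Notation void_events := (@void_events _ _ T Z n).
Local Notation Conf := (g_sigma_algebraType cylinders).
Local Notation Void := (g_sigma_algebraType void_events).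

Definition invariant_sets : set (set config) := [set B | <<s cylinders >> B /\ invariant B].

Lemma invariant_sets_salgebra : sigma_algebra setT invariant_sets.
Proof.
split.
- by split; [exact: sigma_algebra0|move=> x s _; split].
- move=> A [mA iA]; rewrite setTD; split; first by apply: (@measurableC _ Conf A).
  by move=> x s bs; have := iA x s bs; rewrite /setC/=; tauto.
- move=> A /all_and2[mA iA]; split; first by apply: (@bigcupT_measurable _ Conf A).
  by move=> x s bs; split => -[l _ Al]; exists l => //; exact/(iA l x s bs).
Qed.

Local Notation Inv := (g_sigma_algebraType invariant_sets).

Section one_space.
Context d (Om : measurableType d) (P : probability Om R).
Variables (e : nat -> Om -> T) (z : 'I_n -> Om -> Z).
Hypothesis me : forall i, measurable_fun setT (e i).
Hypothesis mz : forall j, measurable_fun setT (z j).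

Definition conf (w : Om) : config := (e^~ w, z^~ w).

Lemma measurable_conf : measurable_fun setT (conf : Om -> Conf).
Proof.
apply: (@measurability _ _ Om Conf setT conf cylinders) => // _ [_ [[i [A [mA ->]]]|[j [D [mD ->]]]] <-].
  by rewrite setTI; exact: (measurable_preimage (me i)).
by rewrite setTI; exact: (measurable_preimage (mz j)).
Qed.

Lemma measurable_conf_void : measurable_fun setT (conf : Om -> Void).
Proof.
apply: (@measurability _ _ Om Void setT conf void_events) => // _ [_ [C [D [mC mD ->]]] <-].
rewrite setTI (_ : _ @^-1` _ = (\bigcap_i e i @^-1` (~` C)) `&` \bigcap_(j in [set: 'I_n]) z j @^-1` D j).
  apply: measurableI; last by apply: fin_bigcap_measurable => // j _; exact: measurable_preimage.
  by apply: bigcap_measurable => // i _; apply: measurable_preimage => //; exact: measurableC.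
by apply/seteqP; split => w /= [h zw]; split => i; [move=> _; exact: h|move=> _; exact: zw|exact: (h i I)|exact: (zw i I)].
Qed.

Lemma measurable_conf_inv : measurable_fun setT (conf : Om -> Inv).
Proof.
apply: (@measurability _ _ Om Inv setT conf invariant_sets) => // _ [B [mB _] <-].
by rewrite setTI; exact: (measurable_preimage measurable_conf).
Qed.
End one_space.

Section two_spaces.
Context d (Om : measurableType d) (P : probability Om R).
Context d' (Om' : measurableType d') (P' : probability Om' R).
Variables (e : nat -> Om -> T) (z : 'I_n -> Om -> Z) (e' : nat -> Om' -> T) (z' : 'I_n -> Om' -> Z).
Hypothesis me : forall i, measurable_fun setT (e i).
Hypothesis mz : forall j, measurable_fun setT (z j).
Hypothesis me' : forall i, measurable_fun setT (e' i).
Hypothesis mz' : forall j, measurable_fun setT (z' j).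
Hypothesis ke : {ae P, forall w, keyed key (e^~ w)}.
Hypothesis ke' : {ae P', forall w, keyed key (e'^~ w)}.
Hypothesis same_void : forall C D, measurable C -> (forall j, measurable (D j)) ->
  P [set w | (forall i, ~ C (e i w)) /\ forall j, D j (z j w)] =
  P' [set w | (forall i, ~ C (e' i w)) /\ forall j, D j (z' j w)].

(** The pi-system argument for [void_events]. *)
Lemma same_law_void (B : set Void) : measurable B ->
  P (conf e z @^-1` B) = P' (conf e' z' @^-1` B).
Proof.
move=> mB.
pose m1 := distribution P (rv P (measurable_conf_void me mz)).
pose m2 := distribution P' (rv P' (measurable_conf_void me' mz')).
apply: (@measure_unique _ R Void void_events (fun=> setT) _ _ _ _ m1 m2) => //.
- exact: void_eventsI.
- move=> _; exists set0, (fun=> setT); split => //; apply/seteqP; split => x //= _.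
  by split => // i [].
- by rewrite bigcup_const//; exists 0%N.
- by move=> _ [C [D [mC mD ->]]]; exact: same_void.
- by move=> _; rewrite [X in (X < _)%E](@probability_setT _ _ _ P) ltry.
Qed.

(** A symmetric event holds for a configuration exactly when it holds for its
    list by increasing key, and the latter is determined by void events. *)
Lemma same_law_invariant (B : set Inv) : measurable B ->
  P (conf e z @^-1` B) = P' (conf e' z' @^-1` B).
Proof.
move=> mB; have [mcB iB] : invariant_sets B.
  by move: mB; rewrite /measurable/= sigma_algebra_id//; exact: invariant_sets_salgebra.
have [B' [mB' BB']] := void_event_readable mkey mcB.
have aux d2 (O : measurableType d2) (Q : probability O R) (f : nat -> O -> T) (y : 'I_n -> O -> Z) :
    (forall i, measurable_fun setT (f i)) -> (forall j, measurable_fun setT (y j)) ->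
    {ae Q, forall w, keyed key (f^~ w)} -> Q (conf f y @^-1` B) = Q (conf f y @^-1` B').
  move=> mf my kf; apply: ae_iff_measure.
  - exact: (measurable_preimage (measurable_conf mf my) mcB).
  - exact: (measurable_preimage (measurable_conf_void mf my) mB').
  apply: filterS kf => w [inj lf].
  have [s bs s_lt] := increasing_enumeration lf inj.
  exact: iff_trans (iff_sym (iB (conf f y w) s bs)) (BB' (conf f y w) s (conj bs s_lt)).
by rewrite (aux _ _ P)// (aux _ _ P')// same_law_void.
Qed.

(** A symmetric measurable function is measurable for the sigma-algebra of
    symmetric events, on which the two laws agree. *)
Lemma same_law_integral (G : Conf -> \bar R) : measurable_fun setT G ->
  (forall x, 0 <= G x)%E ->
  (forall (x : config) s, bijective s -> G (x.1 \o s, x.2) = G x) ->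
  (\int[P]_w G (conf e z w) = \int[P']_w G (conf e' z' w))%E.
Proof.
move=> mG G0 sG.
have mG' : measurable_fun setT (G : Inv -> \bar R).
  move=> _ B mB; rewrite setTI; apply: sub_sigma_algebra; split.
    exact: (measurable_preimage mG mB).
  by move=> x s bs; rewrite /= (sG x s bs).
rewrite -(integral_rv P (measurable_conf_inv me mz) mG' G0).
rewrite -(integral_rv P' (measurable_conf_inv me' mz') mG' G0).
by apply: eq_measure_integral => B mB _; exact: same_law_invariant.
Qed.

End two_spaces.
End transfer.

(** * Scaling and shifting marked points of the plane *)

Section lebesgue_affine.
Context (R : realType).
Local Notation mu := (@lebesgue_measure R).
Local Notation leb2 := (mu \x mu)%E.
Variables (c : R).
Hypothesis c0 : 0 < c.

Let affine (b : R) : R -> R := fun x => c * x + b.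

Let measurable_affine b : measurable_fun setT (affine b : measurableTypeR R -> measurableTypeR R).
Proof.
have h : measurable_fun [set: R] (affine b) by apply: measurable_funD => //; exact: measurable_funM.
exact: h.
Qed.

Let image (b : R) : {measure set (measurableTypeR R) -> \bar R} :=
  measure_function_pushforward__canonical__measure_function_Measure mu (measurable_affine b).

Lemma integral_affine (b : R) (h : R -> \bar R) : measurable_fun setT h -> (forall x, 0 <= h x)%E ->
  (\int[mu]_x h x = c%:E * \int[mu]_x h (c * x + b)%R)%E.
Proof.
move=> mh h0.
pose nu := mscale (NngNum (ltW c0)) (image b).
have H X : ocitv X -> mu X = nu X.
  move=> [[x y]] _ <-; rewrite /nu /mscale/= /pushforward/=.
  rewrite (_ : _ @^-1` _ = `](x - b) / c, (y - b) / c]%classic).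
    rewrite !lebesgue_measure_itv/= !lte_fin ltr_pM2r ?invr_gt0// ltrD2r.
    case: ifPn => _; rewrite ?mule0// -!EFinB -EFinM; congr _%:E; field.
    by rewrite gt_eqF.
  apply/seteqP; split => z; rewrite /= /affine !in_itv/= ltr_pdivrMr// ler_pdivlMr//.
    by move=> /andP[? ?]; apply/andP; split; lra.
  by move=> /andP[? ?]; apply/andP; split; lra.
transitivity (\int[nu]_x h x)%E.
  by apply: eq_measure_integral => A mA _; exact: (@lebesgue_measure_unique R nu H A mA).
rewrite ge0_integral_mscale//=; congr (_ * _)%E.
by rewrite (ge0_integral_pushforward (measurable_affine b)).
Qed.

Lemma integral_affine2 (b1 b2 : R) (h : R * R -> \bar R) : measurable_fun setT h -> (forall x, 0 <= h x)%E ->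
  (\int[leb2]_x h x = (c ^+ 2)%:E * \int[leb2]_x h (c * x.1 + b1, c * x.2 + b2)%R)%E.
Proof.
move=> mh h0.
have m2 : measurable_fun setT (fun x : R * R => (c * x.1 + b1, c * x.2 + b2) : R * R).
  apply/measurable_fun_pairP; split; apply: measurable_funD => //; exact: measurable_funM.
pose h' (x : R * R) := h (c * x.1 + b1, c * x.2 + b2)%R.
have mh' : measurable_fun setT h' by exact: (measurableT_comp mh m2).
rewrite [LHS](fubini_tonelli1 (m1 := mu) (m2 := mu) h mh h0).
rewrite [X in (_ * X)%E](fubini_tonelli1 (m1 := mu) (m2 := mu) h' mh' (fun x => h0 _)).
rewrite expr2 EFinM -muleA (integral_affine b1)//=; last 2 first.
- exact: (@measurable_fun_fubini_tonelli_F _ _ (measurableTypeR R) (measurableTypeR R) R mu h mh h0).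
- by move=> x; exact: integral_ge0.
congr (_ * _)%E; rewrite -ge0_integralZl//=.
- apply: eq_integral => x _; apply: integral_affine => //.
  by apply: measurableT_comp => //; exact: pair1_measurable.
- exact: (@measurable_fun_fubini_tonelli_F _ _ (measurableTypeR R) (measurableTypeR R) R mu h' mh' (fun x => h0 _)).
- by move=> x _; apply: integral_ge0 => y _; exact: h0.
- by rewrite lee_fin ltW.
Qed.

End lebesgue_affine.

Section average_facts.
Context d1 d2 (T : measurableType d1) (M : measurableType d2) (R : realType).
Variable nu : probability M R.

Lemma average_complement (g : T * M -> R) x : measurable_fun setT g -> (forall x, 0 <= g x <= 1) ->
  ((1 - average nu g x)%:E = \int[nu]_y (1 - g (x, y))%:E)%E.
Proof.
move=> mg g01.
have mgx : measurable_fun setT (fun y => g (x, y)).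
  by apply: measurableT_comp => //; exact: pair1_measurable.
rewrite EFinB averageE//.
have <- : (\int[nu]_y (1 - g (x, y))%:E + \int[nu]_y (g (x, y))%:E = 1)%E.
  rewrite -ge0_integralD//.
  - under eq_integral do rewrite -EFinD subrK.
    by rewrite integral_cst// [X in (_ * X)%E](@probability_setT _ _ _ nu) mule1.
  - by move=> y _; rewrite lee_fin subr_ge0; case/andP: (g01 (x, y)).
  - by apply/measurable_EFinP; exact: measurable_funB.
  - by move=> y _; rewrite lee_fin; case/andP: (g01 (x, y)).
  - exact/measurable_EFinP.
rewrite addeK// ge0_fin_numE; last first.
  by apply: integral_ge0 => y _; rewrite lee_fin; case/andP: (g01 (x, y)).
have := integral01 nu mgx (fun y => g01 (x, y)).
by move=> /andP[_ /le_lt_trans]; apply; rewrite ltry.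
Qed.

Lemma average_cst (g : T * M -> R) x (r : R) : (forall y, g (x, y) = r) -> average nu g x = r.
Proof.
move=> gr; rewrite /average; under eq_integral do rewrite gr.
by rewrite integral_cst// [X in (_ * X)%E](@probability_setT _ _ _ nu) mule1.
Qed.
End average_facts.

Section plane.
Context (R : realType).
Local Notation mu := (@lebesgue_measure R).

Lemma sigma_finite_area : sigma_finite setT (mu \x mu)%E.
Proof.
exists (fun n => [set` `[- n%:R, n%:R]] `*` [set` `[- n%:R, n%:R]]).
  apply/esym/seteqP; split => // x _; exists (Num.bound (`|x.1| + `|x.2|)) => //.
  have := archi_boundP (addr_ge0 (normr_ge0 x.1) (normr_ge0 x.2)).
  move: (Num.bound _)%:R => n h; have := normr_ge0 x.1; have := normr_ge0 x.2 => h1 h2.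
  by split; rewrite /= in_itv/= -ler_norml; lra.
move=> n; split; first by apply: measurableX; exact: measurable_itv.
rewrite [X in (X < _)%E]area_rectangle !lebesgue_measure_itv/=.
by case: ifP => _; rewrite ?mule0 ?ltry// -EFinB -EFinM ltry.
Qed.

(** Area bundled with its sigma-finiteness, as Tonelli's theorem for a product of
    the plane and a space of marks requires. *)
Definition plane_measure : {sigma_finite_measure set (measurableTypeR R * measurableTypeR R)%type -> \bar R} :=
  HB.pack (mu \x mu)%E (@Measure_isSigmaFinite.Build _ _ _ (mu \x mu)%E sigma_finite_area).
End plane.

Section marked_points.
Context (R : realType).
Local Notation mu := (@lebesgue_measure R).
Local Notation leb2 := (mu \x mu)%E.

Definition marked : Type := ((R * R) * R * R)%type.

Definition sqr_norm (x : R * R) : R := x.1 ^+ 2 + x.2 ^+ 2.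

(** The exponent of the generating functional of a Poisson process with
    independent angles of law [U] and fading marks of law [Q]. *)
Definition exponent (lambda : R) (U Q : probability R R) (g : (R * R) * R * R -> R) : \bar R :=
  (lambda%:E * \int[leb2]_x (1 - average U (average Q g) x)%:E)%E.

Let disc (q : R) : set (R * R) := [set x | sqr_norm x < q].

Lemma measurable_sqr_norm : measurable_fun setT sqr_norm.
Proof. by apply: measurable_funD; apply: measurable_funX; [exact: measurable_fst|exact: measurable_snd]. Qed.

Let measurable_disc q : measurable (disc q).
Proof.
rewrite (_ : disc q = sqr_norm @^-1` `]-oo, q[).
  by apply: measurable_preimage => //; exact: measurable_sqr_norm.
by apply/seteqP; split => x; rewrite /disc/= in_itv.
Qed.

Definition unit_area : R := fine (area (disc 1)).

Lemma area_integral (A : set (R * R)) : measurable A -> (\int[leb2]_x (\1_A x)%:E = area A)%E.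
Proof. by move=> mA; have := @integral_indic _ _ _ leb2 setT measurableT _ mA; rewrite setIT. Qed.

Let area_disc1 : area (disc 1) = unit_area%:E.
Proof.
rewrite /unit_area fineK// ge0_fin_numE//.
apply: (@le_lt_trans _ _ (area ([set` `[-1, 1]] `*` [set` `[-1, 1]]))).
  apply: le_measure; rewrite ?inE; [exact: measurable_disc|exact: measurableX|].
  move=> x; rewrite /disc/= /sqr_norm => h; split; rewrite /= in_itv/=; apply/andP; split; nra.
rewrite area_rectangle !lebesgue_measure_itv/=.
by case: ifP => _; rewrite ?mule0 ?ltry// -EFinB -EFinM ltry.
Qed.

Lemma unit_area_ge0 : 0 <= unit_area.
Proof. by rewrite /unit_area fine_ge0// measure_ge0. Qed.

Let area_disc q : 0 <= q -> area (disc q) = (unit_area * q)%:E.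
Proof.
rewrite le_eqVlt => /predU1P[<-|q0].
  rewrite mulr0 (_ : disc 0 = set0) ?measure0//.
    by rewrite /area measure0.
  by apply/seteqP; split => x //=; rewrite /disc/= /sqr_norm; nra.
rewrite -area_integral// (@integral_affine2 _ (Num.sqrt q) _ 0 0); last 3 first.
- by rewrite sqrtr_gt0.
- by apply/measurable_EFinP; exact: measurable_indic.
- by move=> x; rewrite lee_fin.
rewrite sqr_sqrtr ?ltW// mulrC EFinM -area_disc1 -area_integral//; congr (_ * _)%E.
apply: eq_integral => x _; congr _%:E; rewrite !indicE; congr ((_ : bool)%:R).
have -> : (x \in disc 1) = (sqr_norm x < 1) by apply/idP/idP => [/set_mem//|h]; apply/mem_set.
set y := (X in (X \in _)).
have -> : (y \in disc q) = (sqr_norm y < q) by apply/idP/idP => [/set_mem//|h]; apply/mem_set.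
by rewrite /sqr_norm /y/= !addr0 !exprMn sqr_sqrtr ?ltW// -mulrDr -[ltRHS]mulr1 ltr_pM2l.
Qed.

Definition annulus p q : set (R * R) := sqr_norm @^-1` [set` `[p, q[].

Lemma measurable_annulus p q : measurable (annulus p q).
Proof. by apply: measurable_preimage => //; exact: measurable_sqr_norm. Qed.

Lemma area_annulus p q : 0 <= p <= q -> area (annulus p q) = (unit_area * (q - p))%:E.
Proof.
move=> /andP[p0 pq].
rewrite (_ : annulus p q = disc q `\` disc p).
  rewrite /area measureD//=; last 3 first.
  - exact: measurable_disc.
  - exact: measurable_disc.
  - by rewrite [X in (X < _)%E](area_disc (le_trans p0 pq)) ltry.
  rewrite setIidr; last by move=> x; rewrite /disc/= => /lt_le_trans; apply.
  rewrite [X in (X - _)%E](area_disc (le_trans p0 pq)) [X in (_ - X)%E](area_disc p0).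
  by rewrite -EFinB mulrBr.
apply/seteqP; split => x; rewrite /annulus/disc/= in_itv/=.
  by move=> /andP[? ?]; split => //; apply/negP; rewrite -leNgt.
by move=> [-> /negP]; rewrite -leNgt => ->.
Qed.

Variables (U Q : probability R R).

(** The rings on which [ae_keyed] compares keys: the square of the distance to the
    origin is the key for which the exponent is proportional to the length of
    the slice. *)
Lemma exponent_annulus lambda p q (t : R) : 0 <= p <= q -> 0 <= t <= 1 ->
  exponent lambda U Q (fun e => 1 - t * \1_((fun e => sqr_norm e.1.1) @^-1` [set` `[p, q[]) e) =
  (t * (lambda * unit_area * (q - p)))%:E.
Proof.
move=> pq t01; rewrite /exponent.
under eq_integral => x _.
  rewrite (@average_cst _ _ _ _ _ _ _ _ (1 - t * \1_(annulus p q) x)); last first.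
    by move=> y; apply: average_cst => z.
  rewrite opprB addrC subrK EFinM.
  over.
rewrite ge0_integralZl//; last 2 first.
- by apply/measurable_EFinP; apply: measurable_indic; exact: measurable_annulus.
- by rewrite lee_fin; case/andP: t01.
rewrite area_integral; last exact: measurable_annulus.
by rewrite area_annulus// -!EFinM; congr _%:E; ring.
Qed.

Lemma exponent_integral lambda (g : (R * R) * R * R -> R) : measurable_fun setT g ->
  (forall x, 0 <= g x <= 1) ->
  exponent lambda U Q g = (lambda%:E * \int[leb2]_x \int[U]_y (1 - average Q g (x, y))%:E)%E.
Proof.
move=> mg g01; congr (_ * _)%E; apply: eq_integral => x _.
by apply: average_complement; [exact: measurable_average|exact: average01].
Qed.

(** Each station moves by a vector depending only on its own angle; for a fixed
    angle this is a translation, which preserves area. *)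
Lemma exponent_shift lambda (m : R -> R * R) (g : (R * R) * R * R -> R) :
  measurable_fun setT m -> measurable_fun setT g -> (forall x, 0 <= g x <= 1) ->
  exponent lambda U Q (fun e => g ((e.1.1.1 + (m e.1.2).1, e.1.1.2 + (m e.1.2).2), e.1.2, e.2)) =
  exponent lambda U Q g.
Proof.
move=> mm mg g01.
pose s (e : (R * R) * R) : (R * R) * R := ((e.1.1 + (m e.2).1, e.1.2 + (m e.2).2), e.2).
have ms : measurable_fun setT s.
  have m2 : measurable_fun setT (fun e : (R * R) * R => m e.2) by exact: measurableT_comp.
  have m1 : measurable_fun setT (fun e : (R * R) * R => e.1) by exact: measurable_fst.
  apply/measurable_fun_pairP; split; last exact: measurable_snd.
  apply/measurable_fun_pairP; split; apply: measurable_funD.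
  - exact: (measurableT_comp measurable_fst m1).
  - exact: (measurableT_comp measurable_fst m2).
  - exact: (measurableT_comp measurable_snd m1).
  - exact: (measurableT_comp measurable_snd m2).
have mgs : measurable_fun setT (fun e : (R * R) * R * R => g (s e.1, e.2)).
  apply: (measurableT_comp mg); apply/measurable_fun_pairP; split; last exact: measurable_snd.
  exact: (measurableT_comp ms measurable_fst).
apply: (etrans (exponent_integral lambda mgs (fun e => g01 (s e.1, e.2)))).
apply: (etrans _ (esym (exponent_integral lambda mg g01))).
apply: (congr1 (fun z => lambda%:E * z)%E).
pose h (e : (R * R) * R) := (1 - average Q g e)%:E.
have h0 e : (0 <= h e)%E by rewrite lee_fin subr_ge0; case/andP: (average01 Q mg g01 e).
have mh : measurable_fun setT h.
  by apply/measurable_EFinP; apply: measurable_funB => //; exact: measurable_average.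
have mhs : measurable_fun setT (h \o s) by exact: measurableT_comp.
transitivity (\int[leb2]_x \int[U]_y (h \o s) (x, y))%E; first by [].
have E1 := @fubini_tonelli _ _ (measurableTypeR R * measurableTypeR R)%type R R (plane_measure R) U (h \o s) mhs (fun e => h0 (s e)).
have E2 := @fubini_tonelli _ _ (measurableTypeR R * measurableTypeR R)%type R R (plane_measure R) U h mh h0.
apply: (etrans E1); apply: (etrans _ (esym E2)).
apply: eq_integral => y _.
rewrite [RHS](@integral_affine2 _ 1 ltr01 (m y).1 (m y).2); last 2 first.
- by apply: measurableT_comp mh _; exact: pair2_measurable.
- by move=> x; exact: h0.
rewrite expr1n mul1e; apply: eq_integral => x _.
by rewrite /= /s/= !mul1r.
Qed.

End marked_points.

(** The dilation contributes the Jacobian [c ^+ 2], absorbed by the intensity. *)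
Lemma exponent_scale (R : realType) (lambda c b : R) (U Q Q' : probability R R)
    (g : (R * R) * R * R -> R) : 0 < c ->
  (forall A : set R, measurable A -> Q' A = Q ((fun r => b * r) @^-1` A)) ->
  measurable_fun setT g -> (forall x, 0 <= g x <= 1) ->
  exponent lambda U Q (fun e => g ((c * e.1.1.1, c * e.1.1.2), e.1.2, b * e.2)) =
  exponent (lambda / c ^+ 2) U Q' g.
Proof.
move=> c0 QQ' mg g01.
have mb : measurable_fun setT (fun r : R => b * r) by exact: measurable_funM.
have avE (y : (R * R) * R) : average Q (fun e => g (e.1, b * e.2)) y = average Q' g y.
  rewrite /average; congr fine.
  have mgy : measurable_fun setT (fun z => (g (y, z))%:E).
    by apply/measurable_EFinP; apply: measurableT_comp => //; exact: pair1_measurable.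
  have gy0 z : (0 <= (g (y, z))%:E)%E by rewrite lee_fin; case/andP: (g01 (y, z)).
  rewrite -(integral_rv Q mb mgy gy0); apply: eq_measure_integral => A mA _.
  exact/esym/QQ'.
pose h x := (1 - average U (average Q' g) x)%:E.
have mh : measurable_fun setT h.
  apply/measurable_EFinP; apply: measurable_funB => //.
  by apply: measurable_average; [exact: measurable_average|exact: average01].
have h0 x : (0 <= h x)%E.
  rewrite lee_fin subr_ge0; case/andP: (average01 U (measurable_average Q' mg g01) (average01 Q' mg g01) x) => //.
rewrite /exponent [in RHS](integral_affine2 c0 0 0 mh h0) muleA -EFinM divfK; last by rewrite expf_neq0 ?gt_eqF.
apply: (congr1 (fun z => lambda%:E * z)%E); apply: eq_integral => x _; rewrite /h !addr0.
apply: (congr1 (fun z => (1 - z)%:E)).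
rewrite /average; congr fine; apply: eq_integral => y _; congr _%:E.
exact: (avE (c * x.1, c * x.2, y)).
Qed.

(** * The marked network *)

Section identically_distributed.
Context d d' (Om : measurableType d) (T : measurableType d') (R : realType).
Variables (P : probability Om R) (nu : probability T R).
Variables (J : Type) (X : J -> Om -> T).
Hypothesis mX : forall j, measurable_fun setT (X j).
Hypothesis lawX : forall j A, measurable A -> P (X j @^-1` A) = nu A.
Hypothesis indX : independent_family P X.

Lemma expectation_product m (h : 'I_m -> J) (f : 'I_m -> T -> R) : injective h ->
  (forall i, measurable_fun setT (f i)) -> (forall i x, 0 <= f i x <= 1) ->
  (\int[P]_w (\prod_i f i (X (h i) w))%:E = \prod_i \int[nu]_y (f i y)%:E)%E.
Proof.
move=> inj mf f01; rewrite (@independent_expectation _ _ _ _ _ P m (fun i => X (h i)) _ _ f)//.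
  apply: eq_bigr => i _; have f0 y : (0 <= (f i y)%:E)%E by rewrite lee_fin; case/andP: (f01 i y).
  have mfi : measurable_fun setT (EFin \o f i) by exact/measurable_EFinP.
  rewrite -(integral_rv P (mX (h i)) mfi f0); apply: eq_measure_integral => A mA _.
  exact: lawX.
move=> n i E injE; exact: indX (fun k => h (i k)) E (inj_comp inj injE).
Qed.

Lemma measurable_box n (x : 'I_n -> J) (D : 'I_n -> set T) : (forall j, measurable (D j)) ->
  measurable [set w | forall j, D j (X (x j) w)].
Proof.
move=> mD; rewrite (_ : [set w | _] = \bigcap_(j in [set: 'I_n]) (X (x j) @^-1` D j)).
  by apply: fin_bigcap_measurable => // j _; exact: measurable_preimage.
by apply/seteqP; split => w h' j; [move=> _|]; exact: h'.
Qed.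

Lemma box_indic n (x : 'I_n -> J) (D : 'I_n -> set T) w :
  \1_[set w | forall j, D j (X (x j) w)] w = \prod_j \1_(D j) (X (x j) w) :> R.
Proof.
rewrite indicE; have [/set_mem Bw|nBw] := boolP (w \in _).
  by rewrite big1// => j _; rewrite indicE mem_set//; exact: Bw.
have [j] : exists j, ~ D j (X (x j) w) by apply/existsNP => h'; move/negP: nBw; apply; exact/mem_set.
by move=> nj; rewrite (bigD1 j)//= indicE memNset// mul0r.
Qed.

Lemma box_probability n (x : 'I_n -> J) (D : 'I_n -> set T) :
  injective x -> (forall j, measurable (D j)) ->
  (P [set w | forall j, D j (X (x j) w)] = \prod_j nu (D j))%E.
Proof.
move=> injx mD.
have -> : (\prod_j nu (D j) = \prod_j \int[nu]_y (\1_(D j) y)%:E)%E.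
  by apply: eq_bigr => j _; rewrite integral_indic// setIT.
rewrite -(@expectation_product n x (fun j => \1_(D j)))//.
- transitivity (\int[P]_w (\1_[set w | forall j, D j (X (x j) w)] w)%:E)%E.
    by rewrite integral_indic// ?setIT//; exact: measurable_box.
  by apply: eq_integral => w _; rewrite box_indic.
- by move=> j y; rewrite indicE; case: (_ \in _); rewrite ?lexx ler01.
Qed.

(** The marks of the points together with the event that some other marks of the
    family lie in a box; the indicator of the box is again a product. *)
Lemma expectation_product_event n m (x : 'I_n -> J) (h : 'I_m -> J) (D : 'I_n -> set T)
    (f : 'I_m -> T -> R) :
  injective x -> injective h -> (forall j i, x j <> h i) -> (forall j, measurable (D j)) ->
  (forall i, measurable_fun setT (f i)) -> (forall i y, 0 <= f i y <= 1) ->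
  (\int[P]_w ((\prod_i f i (X (h i) w)) * \1_[set w | forall j, D j (X (x j) w)] w)%:E =
    (\prod_i \int[nu]_y (f i y)%:E) * P [set w | forall j, D j (X (x j) w)])%E.
Proof.
move=> injx injh xh mD mf f01.
have E1 := box_indic x D.
pose hx (k : 'I_(m + n)) := match fintype.split k with inl i => h i | inr j => x j end.
pose fD (k : 'I_(m + n)) := match fintype.split k with inl i => f i | inr j => \1_(D j) end.
have injhx : injective hx.
  move=> k k' E; rewrite -[k]splitK -[k']splitK; congr unsplit; move: E; rewrite /hx.
  case: (fintype.split k) => i; case: (fintype.split k') => j /= E.
  - by rewrite (injh _ _ E).
  - by case: (xh j i); rewrite E.
  - by case: (xh i j); rewrite E.
  - by rewrite (injx _ _ E).
under eq_integral do rewrite E1.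
rewrite box_probability//.
have -> : (\prod_j nu (D j) = \prod_j \int[nu]_y (\1_(D j) y)%:E)%E.
  by apply: eq_bigr => j _; rewrite integral_indic// setIT.
transitivity (\int[P]_w (\prod_k fD k (X (hx k) w))%:E)%E.
  apply: eq_integral => w _; congr _%:E; rewrite [RHS]big_split_ord/=; congr (_ * _).
    by apply: eq_bigr => i _; rewrite /fD /hx -[lshift _ _]/(unsplit (inl i)) unsplitK.
  by apply: eq_bigr => i _; rewrite /fD /hx -[rshift _ _]/(unsplit (inr i)) unsplitK.
rewrite expectation_product//; last 2 first.
- by move=> k; rewrite /fD; case: (fintype.split k).
- move=> k y; rewrite /fD; case: (fintype.split k) => i //.
  by rewrite indicE; case: (_ \in _); rewrite ?lexx ler01.
rewrite big_split_ord/=; congr (_ * _)%E.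
  by apply: eq_bigr => i _; rewrite /fD -[lshift _ _]/(unsplit (inl i)) unsplitK.
by apply: eq_bigr => i _; rewrite /fD -[rshift _ _]/(unsplit (inr i)) unsplitK.
Qed.
End identically_distributed.

Section void_probability.
Context d d' (Om : measurableType d) (T : measurableType d') (R : realType).
Variables (P : probability Om R) (e : nat -> Om -> T).
Hypothesis me : forall i, measurable_fun setT (e i).

(** At the indicator of the complement of [C] the partial products are indicators
    of decreasing events. *)
Lemma pgf_void B Psi (C : set T) : measurable B -> measurable C -> pgf P e B Psi ->
  P ([set w | forall i, ~ C (e i w)] `&` B) = (expeR (- Psi (\1_(~` C))) * P B)%E.
Proof.
move=> mB mC Pe.
have := Pe (\1_(~` C)) (measurable_indic (measurableC mC)).
move=> /(_ ltac:(by move=> x; rewrite indicE; case: (_ \in _); rewrite ?lexx ler01)) cv.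
pose F m := [set w | forall i, (i < m)%N -> ~ C (e i w)] `&` B.
have mF m : measurable (F m).
  apply: measurableI => //.
  rewrite (_ : [set w | _] = \bigcap_(i in `I_m) (e i @^-1` (~` C))).
    apply: fin_bigcap_measurable => // i _; apply: measurable_preimage => //; exact: measurableC.
  by apply/seteqP; split => w h i; exact: h.
have FE : [set w | forall i, ~ C (e i w)] `&` B = \bigcap_m F m.
  apply/seteqP; split => w.
    by move=> [h Bw] m _; split.
  by move=> h; split; [move=> i; exact: ((h i.+1 I).1 i)|exact: (h 0%N I).2].
have cvF : (P \o F) x @[x --> \oo] --> P (\bigcap_m F m).
  apply: nonincreasing_cvg_mu => //.
  - by apply: (le_lt_trans (probability_le1 P (mF 0%N))); rewrite ltry.
  - by apply: bigcap_measurable => // m _; exact: mF.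
  - move=> m n mn; apply/subsetPset => w [h Bw]; split => // i im; apply: h; exact: leq_trans mn.
rewrite FE; apply: (cvg_unique _ cvF); last first.
  rewrite (_ : P \o F = (fun m => \int[P]_w ((\prod_(i < m) \1_(~` C) (e i w)) * \1_B w)%:E)%E)//.
  apply/funext => m /=; rewrite -[F m]setIT -integral_indic//; apply: eq_integral => w _.
  congr _%:E; rewrite indicI; congr (_ * _); rewrite indicE.
  have [/set_mem h|nh] := boolP (w \in _).
    by rewrite big1// => i _; rewrite indicE mem_set//; exact: h.
  have [i] : exists i : 'I_m, C (e i w).
    apply: contrapT => nC; move/negP: nh; apply; apply/mem_set => i im Ci.
    by apply: nC; exists (Ordinal im).
  by move=> Ci; rewrite (bigD1 i)//= indicE memNset ?mul0r//=; apply.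
exact: ereal_hausdorff.
Qed.
End void_probability.

Section marked_networks.
Context (R : realType).
Local Notation mu := (@lebesgue_measure R).
Local Notation marked := (marked R).

(** The fading marks not attached to a numbered station. *)
Definition extra (j : 'I_3) : fading_index :=
  match val j with 0%N => Rho | 1%N => Rho' | _ => Rho'' end.

Lemma extra_inj : injective extra.
Proof. by move=> [[|[|[|//]]] p] [[|[|[|//]]] q] //= _; apply: val_inj. Qed.

(** The law of the positions, angles and fading marks of the stations, jointly with
    the extra marks [z], in the only form used to compare networks. *)
Definition marked_network d (Om : measurableType d) (P : probability Om R) (lambda : R)
    (U Q : probability R R) (e : nat -> Om -> marked) (z : 'I_3 -> Om -> R) : Prop :=
  [/\ forall i, measurable_fun setT (e i), forall j, measurable_fun setT (z j) &
   forall D : 'I_3 -> set R, (forall j, measurable (D j)) ->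
    pgf P e [set w | forall j, D j (z j w)] (exponent lambda U Q) /\
    P [set w | forall j, D j (z j w)] = (\prod_j Q (D j))%E].

Section construction.
Context d (Om : measurableType d) (P : probability Om R) (lambda : R).
Variables (N : network P lambda) (U Q : probability R R) (mark : fading_index -> Om -> R).
Hypothesis lambda0 : 0 <= lambda.
Hypothesis mmark : forall j, measurable_fun setT (mark j).
Hypothesis lawU : forall A, measurable A -> distribution P (angle N 0%N) A = U A.
Hypothesis lawQ : forall j A, measurable A -> P (mark j @^-1` A) = Q A.
Hypothesis ind_mark : independent_family P mark.
Hypothesis network_mark : independent_pair P
  (sigma_generated (fun i w => (station N i w, angle N i w))) (sigma_generated mark).

Lemma network_marked : marked_network P lambda U Q
  (fun i w => (station N i w, angle N i w, mark (RhoAt i) w)) (fun j => mark (extra j)).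
Proof.
have msa i : measurable_fun setT (fun w => (station N i w, angle N i w)).
  by apply/measurable_fun_pairP; split; exact: measurable_funP.
split=> [i|j //|D mD].
  by apply/measurable_fun_pairP; split; [exact: msa|exact: mmark].
have RhoAt_inj n : injective (fun i : 'I_n => RhoAt i) by move=> i j [/val_inj].
have gmark i A : measurable A -> sigma_generated mark (mark i @^-1` A).
  by move=> mA; apply: sub_sigma_algebra; exists i => //; exists A => //; rewrite setTI.
split.
  have pSA : pgf P (fun i w => (station N i w, angle N i w)) setT
      (fun g => lambda%:E * \int[mu \x mu]_x (1 - average U g x)%:E)%E.
    apply: (@marking _ _ _ _ _ _ _ P U (station N) _ (angle N) id _ _ _ setT _ _
      (fun g => lambda%:E * \int[mu \x mu]_x (1 - g x)%:E)%E).
    - by move=> i; exact: measurable_funP.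
    - by move=> i; exact: measurable_funP.
    - exact: station_angle_independent.
    - exact: (@measurableT _ (g_sigma_algebraType _)).
    - move=> m f mf f01; rewrite [P setT]probability_setT mule1.
      under eq_integral do rewrite indicT mulr1.
      apply: (@expectation_product _ _ _ _ _ P U _ (angle N)) => //.
      + move=> j A mA; rewrite -lawU//.
        by rewrite -[LHS]/(distribution P (angle N j) A) !angle_uniform.
      + exact: angle_independent.
      + exact: val_inj.
    - by apply: poisson_pgf lambda0 _ (station_poisson N) => i; exact: measurable_funP.
  apply: (@marking _ _ _ _ _ _ _ P Q _ _ mark RhoAt _ _ _ _ _ _ _ pSA) => //.
  - rewrite (_ : [set w | _] = \bigcap_(j in [set: 'I_3]) (mark (extra j) @^-1` D j)).
      apply: (@fin_bigcap_measurable _ (g_sigma_algebraType _)) => // j _.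
      exact: gmark.
    by apply/seteqP; split => w h j; [move=> _|]; exact: h.
  - move=> m f mf f01; apply: (@expectation_product_event _ _ _ _ _ P Q _ mark) => //.
    + exact: extra_inj.
    + by case=> [[|[|[|//]]] p].
exact: (box_probability _ _ _ extra_inj).
Qed.
End construction.

Definition shift_mark (m : R -> R * R) (x : marked) : marked :=
  ((x.1.1.1 + (m x.1.2).1, x.1.1.2 + (m x.1.2).2), x.1.2, x.2).

Definition scale_mark (c b : R) (x : marked) : marked :=
  ((c * x.1.1.1, c * x.1.1.2), x.1.2, b * x.2).

Lemma measurable_marked_x : measurable_fun setT (fun x : marked => x.1.1.1).
Proof. by apply: (measurableT_comp measurable_fst); apply: (measurableT_comp measurable_fst); exact: measurable_fst. Qed.

Lemma measurable_marked_y : measurable_fun setT (fun x : marked => x.1.1.2).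
Proof. by apply: (measurableT_comp measurable_snd); apply: (measurableT_comp measurable_fst); exact: measurable_fst. Qed.

Lemma measurable_marked_angle : measurable_fun setT (fun x : marked => x.1.2).
Proof. by apply: (measurableT_comp measurable_snd); exact: measurable_fst. Qed.

Lemma measurable_shift_mark m : measurable_fun setT m -> measurable_fun setT (shift_mark m).
Proof.
move=> mm; have ma := measurableT_comp mm measurable_marked_angle.
apply/measurable_fun_pairP; split; last exact: measurable_snd.
apply/measurable_fun_pairP; split; last exact: measurable_marked_angle.
apply/measurable_fun_pairP; split; apply: measurable_funD.
- exact: measurable_marked_x.
- exact: (measurableT_comp measurable_fst ma).
- exact: measurable_marked_y.
- exact: (measurableT_comp measurable_snd ma).
Qed.

Lemma measurable_scale_mark c b : measurable_fun setT (scale_mark c b).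
Proof.
apply/measurable_fun_pairP; split; last by apply: measurable_funM => //; exact: measurable_snd.
apply/measurable_fun_pairP; split; last exact: measurable_marked_angle.
apply/measurable_fun_pairP; split; apply: measurable_funM => //.
- exact: measurable_marked_x.
- exact: measurable_marked_y.
Qed.

Lemma marked_network_shift d (Om : measurableType d) (P : probability Om R) lambda U Q e z m :
  measurable_fun setT m -> marked_network P lambda U Q e z ->
  marked_network P lambda U Q (fun i w => shift_mark m (e i w)) z.
Proof.
move=> mm [me mz ez]; split => // [i|D mD].
  by apply: measurableT_comp (me i); exact: measurable_shift_mark.
split; last exact: (ez D mD).2.
move=> g mg g01; rewrite -(exponent_shift U Q lambda mm mg g01).
apply: (ez D mD).1 => [|x]; last exact: g01.
exact: (measurableT_comp mg (measurable_shift_mark mm)).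
Qed.

Lemma marked_network_scale d (Om : measurableType d) (P : probability Om R) lambda (U Q Q' : probability R R) e z (c b : R) :
  0 < c -> (forall A : set R, measurable A -> Q' A = Q ((fun r => b * r) @^-1` A)) ->
  marked_network P lambda U Q e z ->
  marked_network P (lambda / c ^+ 2) U Q' (fun i w => scale_mark c b (e i w)) (fun j w => b * z j w).
Proof.
move=> c0 QQ' [me mz ez].
have mb : measurable_fun setT (fun r : R => b * r) by exact: measurable_funM.
split => [i|j|D mD].
- by apply: measurableT_comp (me i); exact: measurable_scale_mark.
- by apply: measurableT_comp (mz j).
have [h1 h2] := ez (fun j => (fun r => b * r) @^-1` D j) (fun j => measurable_preimage mb (mD j)).
split; last by rewrite h2; apply: eq_bigr => j _; rewrite QQ'.
move=> g mg g01; rewrite -(exponent_scale lambda U c0 QQ' mg g01).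
apply: h1 => [|x]; last exact: g01.
exact: (measurableT_comp mg (measurable_scale_mark c b)).
Qed.

(** The square of the initial distance to the origin. *)
Definition mark_key (x : marked) : R := sqr_norm x.1.1.

Lemma measurable_mark_key : measurable_fun setT mark_key.
Proof.
apply: (measurableT_comp (@measurable_sqr_norm R)).
by apply: (measurableT_comp measurable_fst); exact: measurable_fst.
Qed.

Section same_law.
Context (lambda : R) (U Q : probability R R).
Hypothesis lambda0 : 0 <= lambda.

Lemma marked_network_keyed d (Om : measurableType d) (P : probability Om R) e z :
  marked_network P lambda U Q e z -> {ae P, forall w, keyed mark_key (e^~ w)}.
Proof.
move=> [me mz ez]; apply: (@ae_keyed _ _ _ _ _ _ _ _ (lambda * unit_area R)) => //.
- exact: measurable_mark_key.
- by move=> x; rewrite /mark_key /sqr_norm addr_ge0// sqr_ge0.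
- by rewrite mulr_ge0// unit_area_ge0.
move=> p q t pq t01.
have [pgfe _] := ez (fun=> setT) (fun=> measurableT).
have mslice : measurable (mark_key @^-1` [set` `[p, q[]).
  by apply: measurable_preimage => //; exact: measurable_mark_key.
have := pgfe (fun x => 1 - t * \1_(mark_key @^-1` [set` `[p, q[]) x).
have -> : [set w | forall j : 'I_3, setT (z j w)] = setT by apply/seteqP; split => w.
rewrite exponent_annulus// probability_setT mule1 => h.
rewrite (_ : (fun m => _) = fun m => (\int[P]_w ((\prod_(i < m)
  (1 - t * \1_(mark_key @^-1` [set` `[p, q[]) (e i w))) * \1_setT w)%:E)%E); last first.
  by apply/funext => m; apply: eq_integral => w _; rewrite indicT mulr1.
apply: h => [|x].
  by apply: measurable_funB => //; apply: measurable_funM => //; exact: measurable_indic.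
case/andP: t01 => t0 t1; rewrite indicE; case: (_ \in _); rewrite ?mulr1 ?mulr0 ?subr0 ?lexx ?ler01//.
by rewrite subr_ge0 t1 gerBl t0.
Qed.

Lemma marked_network_same_integral
    d (Om : measurableType d) (P : probability Om R) e z
    d' (Om' : measurableType d') (P' : probability Om' R) e' z'
    (G : g_sigma_algebraType (@cylinders _ _ marked R 3) -> \bar R) :
  marked_network P lambda U Q e z -> marked_network P' lambda U Q e' z' ->
  measurable_fun setT G -> (forall x, 0 <= G x)%E ->
  (forall (x : config marked R 3) s, bijective s -> G (x.1 \o s, x.2) = G x) ->
  (\int[P]_w G (conf e z w) = \int[P']_w G (conf e' z' w))%E.
Proof.
move=> M M'; have [me mz ez] := M; have [me' mz' ez'] := M'.
apply: (same_law_integral measurable_mark_key) => //.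
- exact: marked_network_keyed M.
- exact: marked_network_keyed M'.
move=> C D mC mD; have [h1 h2] := ez D mD; have [h1' h2'] := ez' D mD.
have mB d0 (O : measurableType d0) (y : 'I_3 -> O -> R) : (forall j, measurable_fun setT (y j)) ->
  measurable [set w | forall j, D j (y j w)] by move=> my; exact: (measurable_box my id).
rewrite -[LHS]/(P ([set w | forall i, ~ C (e i w)] `&` [set w | forall j, D j (z j w)])).
rewrite -[RHS]/(P' ([set w | forall i, ~ C (e' i w)] `&` [set w | forall j, D j (z' j w)])).
by rewrite (pgf_void me (mB _ _ _ mz) mC h1) (pgf_void me' (mB _ _ _ mz') mC h1') h2 h2'.
Qed.
End same_law.
End marked_networks.

(** The mean of an exponential variable is a scale parameter. *)
Lemma exponential_prob_scale (R : realType) (mu1 mu2 : R) (A : set R) : 0 < mu1 -> 0 < mu2 ->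
  measurable A -> exponential_prob mu2 A = exponential_prob mu1 ((fun r => mu1 / mu2 * r) @^-1` A).
Proof.
move=> mu10 mu20 mA; have b0 : 0 < mu1 / mu2 by rewrite divr_gt0.
rewrite /exponential_prob integral_mkcond (integral_affine b0 0); last 2 first.
- apply/(measurable_restrictT _ mA); apply: measurable_funTS; apply/measurable_EFinP.
  exact: measurable_exponential_pdf.
- move=> x; apply: erestrict_ge0 => y _; rewrite lee_fin.
  by apply: exponential_pdf_ge0; exact: ltW.
have mb : measurable_fun setT (fun r : R => mu1 / mu2 * r) by exact: measurable_funM.
rewrite [RHS]integral_mkcond -ge0_integralZl//; last 3 first.
- apply: (measurableT_comp (f := (fun x => (exponential_pdf mu2 x)%:E) \_ A)).
    apply/(measurable_restrictT _ mA); apply: measurable_funTS; apply/measurable_EFinP.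
    exact: measurable_exponential_pdf.
  by under eq_fun do rewrite addr0.
- move=> x _; apply: erestrict_ge0 => y _; rewrite lee_fin.
  by apply: exponential_pdf_ge0; exact: ltW.
- by rewrite lee_fin ltW.
apply: eq_integral => x _; rewrite addr0 !patchE.
have -> : (x \in (fun r : R => mu1 / mu2 * r) @^-1` A) = (mu1 / mu2 * x \in A).
  by apply/idP/idP => /set_mem h; exact/mem_set.
case: ifP => _; last by rewrite mule0.
rewrite -EFinM; congr _%:E; have [x0|x0] := leP 0 x.
  rewrite !exponential_pdfE//; last by rewrite mulr_ge0// ltW.
  rewrite mulrA divfK ?gt_eqF//; congr (_ * expR _).
  by rewrite mulrA !mulNr mulrCA divff ?mulr1 ?gt_eqF.
rewrite !lt0_exponential_pdf ?mulr0//; by rewrite pmulr_rlt0.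
Qed.

(** * Measurability and homogeneity of the received powers *)

Section measurability.
Context d (T : measurableType d) (R : realType).

Lemma measurable_set_bool (b : T -> bool) : measurable_fun setT b -> measurable [set x | b x].
Proof. by move=> mb; rewrite -[X in measurable X]setTI; exact: (mb measurableT [set true]). Qed.

Lemma measurable_fun_opp (f : T -> R) : measurable_fun setT f -> measurable_fun setT (fun x => - f x).
Proof. by move=> mf; under eq_fun do rewrite -sub0r; exact: measurable_funB. Qed.

(** The inverse is a real power on either side of 0. *)
Lemma measurable_fun_inv (f : T -> R) : measurable_fun setT f -> measurable_fun setT (fun x => (f x)^-1).
Proof.
move=> mf.
rewrite (_ : (fun x => _) = fun x => if 0 <= f x then f x `^ (- 1) else - (- f x) `^ (- 1)).
  apply: measurable_fun_ifT.
  - exact: measurable_fun_ler.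
  - by apply: (measurableT_comp (measurable_powR (- 1)) mf).
  - apply: measurable_fun_opp; apply: (measurableT_comp (measurable_powR (- 1))).
    exact: measurable_fun_opp.
apply/funext => x; case: ifPn => [h|]; first by rewrite powR_inv1.
by rewrite -ltNge => h; rewrite powR_inv1 ?oppr_ge0 ?ltW// invrN opprK.
Qed.

Lemma measurable_fun_inve (f : T -> \bar R) : measurable_fun setT f ->
  measurable_fun setT (fun x => (f x)^-1%E).
Proof.
move=> mf.
rewrite (_ : (fun x => _) = fun x => if f x == 0%E then +oo%E else
    if f x == -oo%E then -oo%E else ((fine (f x))^-1)%:E).
  apply: measurable_fun_ifT; [exact: measurable_fun_eqe|exact: measurable_cst|].
  apply: measurable_fun_ifT; [exact: measurable_fun_eqe|exact: measurable_cst|].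
  apply/measurable_EFinP; apply: measurable_fun_inv.
  exact: (measurableT_comp (f := fine)).
apply/funext => x; case: (f x) => [r| |] //=; rewrite ?invr0//.
Qed.

Lemma measurable_ereal_sup (f : nat -> T -> \bar R) : (forall n, measurable_fun setT (f n)) ->
  measurable_fun setT (fun x => ereal_sup (range (f^~ x))).
Proof.
move=> mf; rewrite (_ : (fun x => _) = fun x => esups (f^~ x) 0); first exact: measurable_fun_esups.
by apply/funext => x; rewrite /esups; congr ereal_sup; apply/seteqP; split => y [n _ <-]; exists n.
Qed.

Lemma ereal_sup_unpickle (I : countType) (K : set I) (u : I -> \bar R) :
  ereal_sup [set u i | i in K] =
  ereal_sup (range (fun n => if unpickle n is Some i then if i \in K then u i else -oo%E else -oo%E)).
Proof.
apply/eqP; rewrite eq_le; apply/andP; split; apply: ge_ereal_sup.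
  move=> _ [i Ki <-]; apply: ereal_sup_ubound; exists (pickle i) => //.
  by rewrite pickleK mem_set.
move=> _ [n _ <-]; case: unpickle => [i|]; last exact: leNye.
case: ifPn => [/set_mem Ki|_]; last exact: leNye.
by apply: ereal_sup_ubound; exists i.
Qed.

(** Both aggregates are suprema over countable families, of finite sums or of single
    terms. *)
Lemma measurable_aggregate m (K : set nat) (p : nat -> T -> R) :
  (forall k, measurable_fun setT (p k)) -> measurable_fun setT (fun x => aggregate m K (p^~ x)).
Proof.
move=> mp; case: m => /=.
  rewrite (_ : (fun x => _) = fun x => ereal_sup
    [set (\sum_(k <- A) (p k x)%:E)%E | A in [set A : seq nat | uniq A /\ [set` A] `<=` K]]).
    under eq_fun do rewrite ereal_sup_unpickle.
    apply: (measurable_ereal_sup (f := fun n x => if unpickle n is Some A then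
      if A \in [set A : seq nat | uniq A /\ [set` A] `<=` K] then (\sum_(k <- A) (p k x)%:E)%E
      else -oo%E else -oo%E)) => n; case: unpickle => [A|]; last exact: measurable_cst.
    case: (A \in _); last exact: measurable_cst.
    by apply: emeasurable_sum => k; exact/measurable_EFinP.
  apply/funext => x; rewrite /esum; congr ereal_sup; apply/seteqP; split => [_ [A [fA AK] <-]|_ [A [uA AK] <-]].
    have /finite_seqP[l Al] := fA.
    have Al' : A = [set` undup l] by rewrite Al; apply/seteqP; split => k /=; rewrite mem_undup.
    exists (undup l); first by split; [exact: undup_uniq|rewrite -Al'].
    by rewrite Al' -fsbig_seq// undup_uniq.
  exists [set` A]; first by split => //; exact: finite_seq.
  by rewrite -fsbig_seq.
under eq_fun do rewrite ereal_sup_unpickle.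
apply: (measurable_ereal_sup (f := fun n x => if unpickle n is Some k then
  if k \in K then (p k x)%:E else -oo%E else -oo%E)) => n; case: unpickle => [i|]; last exact: measurable_cst.
by case: (i \in _); [exact/measurable_EFinP|exact: measurable_cst].
Qed.
End measurability.

Section aggregate.
Context (R : realType).

Lemma aggregate_scale m (K : set nat) (p : nat -> R) (c : R) : 0 < c ->
  aggregate m K (fun k => c * p k) = (c%:E * aggregate m K p)%E.
Proof.
move=> c0; case: m => /=.
  rewrite /esum -ereal_sup_pZl// image_comp; congr ereal_sup.
  apply: eq_imagel => A [fA _] /=.
  rewrite !fsbig_finite//= !sumEFin -EFinM; congr _%:E.
  by rewrite mulr_sumr.
by rewrite -ereal_sup_pZl// image_comp.
Qed.

Lemma aggregate_reindex m (K K' : set nat) (p : nat -> R) (s : nat -> nat) : bijective s ->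
  K = s @^-1` K' -> aggregate m K (p \o s) = aggregate m K' p.
Proof.
move=> bs ->.
have sK : s @` (s @^-1` K') = K'.
  apply: image_preimage; apply/seteqP; split => // y _; have [g gK sK] := bs.
  by exists (g y).
case: m => /=.
  rewrite (@reindex_esum _ _ _ (s @^-1` K') K' s)//.
  split => // [x y _ _|y K'y]; first exact: bij_inj.
  by rewrite -{1}sK in K'y.
by rewrite -{2}sK image_comp.
Qed.

Lemma combine_scale m (x y : \bar R) (c : R) : 0 < c ->
  combine m (c%:E * x) (c%:E * y) = (c%:E * combine m x y)%E.
Proof.
move=> c0; case: m => /=.
  case: x y => [x| |] [y| |]//=; rewrite ?gt0_muley ?gt0_muleNy ?lte_fin//.
  by rewrite -!EFinM -EFinD mulrDr.
by rewrite maxe_pMr// lee_fin ltW.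
Qed.

(** At zero interference the value depends only on the sign of the signal, which a
    positive factor does not change. *)
Lemma ratio_scale (x c : R) (y : \bar R) : 0 < c ->
  Defs.ratio 0 (c * x) (c%:E * y) = Defs.ratio 0 x y.
Proof.
move=> c0; rewrite /Defs.ratio expr0n/= !add0e.
case: y => [r| |].
- rewrite -EFinM /inve mulf_eq0 gt_eqF//=; case: ifP => [_|r0].
    have [x0|x0|<-] := ltgtP 0 x; last by rewrite mulr0.
      by rewrite !gt0_muley ?lte_fin ?mulr_gt0.
    by rewrite !lt0_muley ?lte_fin ?pmulr_rlt0.
  rewrite -!EFinM; congr _%:E; field.
  by rewrite r0 gt_eqF.
- by rewrite gt0_muley ?lte_fin//= !mule0.
- rewrite gt0_muleNy ?lte_fin//=.
  have [x0|x0|<-] := ltgtP 0 x; last by rewrite mulr0.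
    by rewrite !gt0_muleNy ?lte_fin ?mulr_gt0.
  by rewrite !lt0_muleNy ?lte_fin ?pmulr_rlt0.
Qed.
End aggregate.

(** * Epochs as events of a configuration *)

Section events.
Context (R : realType) (m : interference) (alpha : R).
Implicit Types (o : option epoch) (D : nat -> R -> R) (rho : fading_index -> R) (s t : R).

(** [None] stands for an observation at a fixed time, so that it is treated
    along with the four epochs. *)
Definition observed o D s (i j l : nat) : Prop :=
  match o with
  | None => nearest_at D s i
  | Some Handover => handover_at D s i j
  | Some MaxSignal => max_signal_at D s i
  | Some MaxInterference => max_interference_at D s i j
  | Some MinInterference => min_interference_at D s i j l
  end.

Definition observed_metric o rho D s (i j l : nat) : \bar R :=
  let others := others_interference m alpha rho D s in
  let near f k := power alpha (rho f) (D k s) in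
  match o with
  | None | Some MaxSignal => Defs.ratio 0 (near Rho i) (others [set k | k <> i])
  | Some Handover => Defs.ratio 0 (near Rho i)
      (combine m (near Rho' i)%:E (others [set k | k <> i /\ k <> j]))
  | Some MaxInterference => Defs.ratio 0 (near Rho j)
      (combine m (near Rho' i)%:E (others [set k | k <> i /\ k <> j]))
  | Some MinInterference => Defs.ratio 0 (near Rho l)
      (combine m (combine m (near Rho' i)%:E (near Rho'' i)%:E)
        (others [set k | [/\ k <> i, k <> j & k <> l]]))
  end.

(** The times at which the metric is observed with a value in [Q].  All epochs
    are obtained for the full [Q], the covered ones for a half-line. *)
Definition events o (Q : set (\bar R)) rho D : set R := [set s |
  exists i j l, observed o D s i j l /\ Q (observed_metric o rho D s i j l)].

Lemma epoch_timesE ep rho D : epoch_times ep D = events (Some ep) setT rho D.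
Proof.
apply/seteqP; split => s; case: ep => /=.
- by move=> [i [j h]]; exists i, j, 0%N.
- by move=> [i h]; exists i, 0%N, 0%N.
- by move=> [i [j h]]; exists i, j, 0%N.
- by move=> [i [j [l h]]]; exists i, j, l.
- by move=> [i [j [l [h _]]]]; exists i, j.
- by move=> [i [j [l [h _]]]]; exists i.
- by move=> [i [j [l [h _]]]]; exists i, j.
- by move=> [i [j [l [h _]]]]; exists i, j, l.
Qed.

Lemma exceeds_epoch_metric ep tau rho D s :
  exceeds tau (epoch_metric m 0 alpha ep rho D s) <->
  events (Some ep) [set x | (tau%:E <= x)%E] rho D s.
Proof.
case: ep; split.
- by move=> [_ [i [j [h ->]]] tx]; exists i, j, 0%N.
- by move=> [i [j [l [h tx]]]]; eexists; [exists i, j; split; [exact: h|reflexivity]|].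
- by move=> [_ [i [h ->]] tx]; exists i, 0%N, 0%N.
- by move=> [i [j [l [h tx]]]]; eexists; [exists i; split; [exact: h|reflexivity]|].
- by move=> [_ [i [j [h ->]]] tx]; exists i, j, 0%N.
- by move=> [i [j [l [h tx]]]]; eexists; [exists i, j; split; [exact: h|reflexivity]|].
- by move=> [_ [i [j [l [h ->]]]] tx]; exists i, j, l.
- by move=> [i [j [l [h tx]]]]; eexists; [exists i, j, l; split; [exact: h|reflexivity]|].
Qed.

Lemma exceeds_typical_metric tau rho D s :
  exceeds tau (typical_metric m 0 alpha rho D s) <->
  events None [set x | (tau%:E <= x)%E] rho D s.
Proof.
split.
- by move=> [_ [i [h ->]] tx]; exists i, 0%N, 0%N.
- by move=> [i [j [l [h tx]]]]; eexists; [exists i; split; [exact: h|reflexivity]|].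
Qed.

Section time_change.
Variables (rho rho' : fading_index -> R) (D D' : nat -> R -> R) (c b : R) (f : R -> R).
Hypotheses (c0 : 0 < c) (b0 : 0 < b) (D0 : forall i t, 0 <= D i t).
Hypothesis DD' : forall i t, D' i t = c * D i (f t).
Hypothesis fsurj : forall t, exists t', f t' = t.
Hypothesis rhorho' : forall j, rho' j = b * rho j.

Let le_D i j s t : (D' i s <= D' j t) = (D i (f s) <= D j (f t)).
Proof. by rewrite !DD' ler_pM2l. Qed.

Let lt_D i j s t : (D' i s < D' j t) = (D i (f s) < D j (f t)).
Proof. by rewrite !DD' ltr_pM2l. Qed.

Let eq_D i j s : (D' i s = D' j s) = (D i (f s) = D j (f s)).
Proof.
apply/propext; rewrite !DD'; split => [|->//]; apply: mulfI; by rewrite gt_eqF.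
Qed.

Let closestE s i : closest_approach D' s i = closest_approach D (f s) i.
Proof.
apply/propext; split => h t; last by rewrite le_D.
by have [t' <-] := fsurj t; rewrite -le_D.
Qed.

Let nearestE s i : nearest_at D' s i = nearest_at D (f s) i.
Proof. by apply/propext; split => h k; move: (h k); rewrite le_D. Qed.

(** Only comparisons between distances matter, and [c > 0] preserves them; the
    surjectivity of [f] is for the minimum over all times in
    [closest_approach]. *)
Lemma observed_time_change o s i j l : observed o D' s i j l <-> observed o D (f s) i j l.
Proof.
case: o => [[]|] /=; rewrite /handover_at /max_signal_at /max_interference_at /min_interference_at.
- rewrite eq_D; split => -[ij Dij h]; split => // k; move: (h k); by rewrite lt_D.
- by rewrite closestE nearestE.
- rewrite closestE; split => -[h h']; split => // k; by rewrite -h' lt_D.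
- rewrite eq_D; split => -[ij Dij h]; split => // k; by rewrite -h lt_D.
- by rewrite nearestE.
Qed.

(** All powers are multiplied by [b * c `^ (- alpha)]. *)
Lemma observed_metric_time_change o s i j l :
  observed_metric o rho' D' s i j l = observed_metric o rho D (f s) i j l.
Proof.
pose k0 := b * c `^ (- alpha).
have k00 : 0 < k0 by rewrite mulr_gt0// powR_gt0.
have pE x k : power alpha (rho' x) (D' k s) = k0 * power alpha (rho x) (D k (f s)).
  by rewrite /power rhorho' DD' powRM ?(ltW c0)// mulrACA.
have oE K : others_interference m alpha rho' D' s K =
    (k0%:E * others_interference m alpha rho D (f s) K)%E.
  by rewrite /others_interference -aggregate_scale//; congr aggregate; apply/funext => k; exact: pE.
by case: o => [[]|] /=; rewrite !pE oE ?EFinM ?combine_scale// ratio_scale.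
Qed.

Lemma events_time_change o Q s : events o Q rho' D' s <-> events o Q rho D (f s).
Proof.
split => -[i [j [l [h q]]]]; exists i, j, l; split.
- exact/observed_time_change.
- by rewrite -observed_metric_time_change.
- exact/observed_time_change.
- by rewrite observed_metric_time_change.
Qed.
End time_change.

Section index_change.
Variables (rho rho' : fading_index -> R) (D D' : nat -> R -> R) (g h : nat -> nat).
Hypotheses (gh : cancel g h) (hg : cancel h g).
Hypothesis DD' : forall i t, D' i t = D (g i) t.
Hypothesis rhoAt : forall k, rho' (RhoAt k) = rho (RhoAt (g k)).
Hypothesis rhoE : forall j, rho' (extra j) = rho (extra j).

Let nearestE s i : nearest_at D' s i -> nearest_at D s (g i).
Proof. by move=> n k; have := n (h k); rewrite !DD' hg. Qed.

Let lt_iff s i (k : nat) : (forall k', D' k' s < D' i s <-> k' = k) ->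
  forall k', D k' s < D (g i) s <-> k' = g k.
Proof.
move=> n k'; have := n (h k'); rewrite !DD' hg => ->; split => [<-|->]; first by rewrite hg.
by rewrite gh.
Qed.

Lemma observed_index_change o s i j l : observed o D' s i j l -> observed o D s (g i) (g j) (g l).
Proof.
have ng a b : a <> b -> g a <> g b by move=> ab /(can_inj gh).
case: o => [[]|] /=.
- move=> [ij Dij n]; split; [exact: ng|by rewrite -!DD'|].
  by move=> k; have := n (h k); rewrite !DD' hg.
- move=> [ca n]; split; last exact: nearestE.
  by move=> t; have := ca t; rewrite !DD'.
- move=> [ca n]; split; last exact: lt_iff.
  by move=> t; have := ca t; rewrite !DD'.
- move=> [ij Dij n]; split; [exact: ng|by rewrite -!DD'|exact: lt_iff].
- exact: nearestE.
Qed.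

Lemma observed_metric_index_change o s i j l :
  observed_metric o rho' D' s i j l = observed_metric o rho D s (g i) (g j) (g l).
Proof.
have gE a b : (g a = g b) = (a = b) by apply/propext; split => [/(can_inj gh)|->].
have pE x k : power alpha (rho' (extra x)) (D' k s) = power alpha (rho (extra x)) (D (g k) s).
  by rewrite /power rhoE DD'.
have oE K K' : K = g @^-1` K' ->
    others_interference m alpha rho' D' s K = others_interference m alpha rho D s K'.
  move=> KK'; rewrite /others_interference -(aggregate_reindex m _ (Bijective gh hg) KK').
  by congr aggregate; apply/funext => k; rewrite /power/= rhoAt DD'.
have E0 := pE (Ordinal (isT : 0 < 3)%N); have E1 := pE (Ordinal (isT : 1 < 3)%N).
have E2 := pE (Ordinal (isT : 2 < 3)%N); rewrite /= in E0 E1 E2.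
case: o => [[]|] /=; rewrite ?E0 ?E1 ?E2; (erewrite oE; [reflexivity|]);
  by apply/seteqP; split => k /=; rewrite !gE.
Qed.

Lemma events_index_change o Q s : events o Q rho' D' s -> events o Q rho D s.
Proof.
move=> [i [j [l [ob q]]]]; exists (g i), (g j), (g l); split.
- exact: observed_index_change.
- by rewrite -observed_metric_index_change.
Qed.
End index_change.

Section measurable_events.
Context d (T : measurableType d).
Variables (rho : T -> fading_index -> R) (D : T -> nat -> R -> R) (t : T -> R) (Q : set (\bar R)).
Hypothesis mrho : forall j, measurable_fun setT (rho^~ j).
Hypothesis mD : forall i, measurable_fun setT (fun x => D x i (t x)).
Hypothesis mclosest : forall i, measurable [set x | closest_approach (D x) (t x) i].
Hypothesis mQ : measurable Q.

Let mlt i j : measurable [set x | D x i (t x) < D x j (t x)].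
Proof. by apply: measurable_set_bool; exact: measurable_fun_ltr. Qed.

Let measurable_cond (p : Prop) (A : set T) : measurable A -> measurable [set x | A x <-> p].
Proof.
move=> mA; have [hp|np] := pselect p.
  by rewrite (_ : [set x | _] = A)//; apply/seteqP; split => x /=; tauto.
by rewrite (_ : [set x | _] = ~` A); [exact: measurableC|apply/seteqP; split => x /=; tauto].
Qed.

Let measurable_all (A : nat -> set T) : (forall k, measurable (A k)) ->
  measurable [set x | forall k, A k x].
Proof.
move=> mA; rewrite (_ : [set x | _] = \bigcap_k A k); first exact: bigcap_measurableType.
by apply/seteqP; split => x h k; [move=> _|]; exact: h.
Qed.

Let measurable_ex (A : nat -> set T) : (forall k, measurable (A k)) ->
  measurable [set x | exists k, A k x].
Proof.
move=> mA; rewrite (_ : [set x | _] = \bigcup_k A k); first exact: bigcupT_measurable.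
by apply/seteqP; split => x [k]; exists k.
Qed.

Let measurable_and3 (p : Prop) (A B : set T) : measurable A -> measurable B ->
  measurable [set x | [/\ p, A x & B x]].
Proof.
move=> mA mB; have [hp|np] := pselect p.
  rewrite (_ : [set x | _] = A `&` B); first exact: measurableI.
  by apply/seteqP; split => x [].
by rewrite (_ : [set x | _] = set0)//; apply/seteqP; split => x [].
Qed.

Let measurable_eqD i j : measurable [set x | D x i (t x) = D x j (t x)].
Proof.
rewrite (_ : [set x | _] = [set x | D x i (t x) == D x j (t x)]).
  by apply: measurable_set_bool; exact: measurable_fun_eqr.
by apply/seteqP; split => x /eqP.
Qed.

Let measurable_nearest i : measurable [set x | nearest_at (D x) (t x) i].
Proof.
apply: (measurable_all (A := fun k => [set x | D x i (t x) <= D x k (t x)])) => k.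
by apply: measurable_set_bool; exact: measurable_fun_ler.
Qed.

Lemma measurable_observed o i j l : measurable [set x | observed o (D x) (t x) i j l].
Proof.
case: o => [[]|] /=.
- apply: measurable_and3; first exact: measurable_eqD.
  apply: (measurable_all (A := fun k => ~` [set x | D x k (t x) < D x i (t x)])) => k.
  exact: measurableC.
- exact: (measurableI _ _ (mclosest i) (measurable_nearest i)).
- apply: (measurableI _ _ (mclosest i)).
  apply: (measurable_all (A := fun k => [set x | D x k (t x) < D x i (t x) <-> k = j])) => k.
  exact: (measurable_cond _ (mlt k i)).
- apply: measurable_and3; first exact: measurable_eqD.
  apply: (measurable_all (A := fun k => [set x | D x k (t x) < D x i (t x) <-> k = l])) => k.
  exact: (measurable_cond _ (mlt k i)).
- exact: measurable_nearest.
Qed.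

Let measurable_power f k : measurable_fun setT (fun x => power alpha (rho x f) (D x k (t x))).
Proof.
apply: measurable_funM => //; exact: (measurableT_comp (measurable_powR (- alpha)) (mD k)).
Qed.

Let measurable_combine (f g : T -> \bar R) : measurable_fun setT f -> measurable_fun setT g ->
  measurable_fun setT (fun x => combine m (f x) (g x)).
Proof. by case: m => /= mf mg; [exact: emeasurable_funD|exact: measurable_maxe]. Qed.

Let measurable_ratio (f : T -> R) (g : T -> \bar R) : measurable_fun setT f -> measurable_fun setT g ->
  measurable_fun setT (fun x => Defs.ratio 0 (f x) (g x)).
Proof.
move=> mf mg; apply: emeasurable_funM; first exact/measurable_EFinP.
by apply: measurable_fun_inve; exact: emeasurable_funD.
Qed.

Let measurable_others K : measurable_fun setT (fun x => others_interference m alpha (rho x) (D x) (t x) K).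
Proof. exact: measurable_aggregate. Qed.

Lemma measurable_observed_metric o i j l :
  measurable_fun setT (fun x => observed_metric o (rho x) (D x) (t x) i j l).
Proof.
case: o => [[]|] /=; apply: measurable_ratio => //; do ?apply: measurable_combine => //;
  exact/measurable_EFinP.
Qed.

Lemma measurable_events o : measurable [set x | events o Q (rho x) (D x) (t x)].
Proof.
apply: measurable_ex => i; apply: measurable_ex => j; apply: measurable_ex => l.
apply: measurableI; first exact: measurable_observed.
exact: (measurable_preimage (measurable_observed_metric o i j l) mQ).
Qed.
End measurable_events.
End events.

Section tally.
Context (R : realType).

Definition tally (A : set R) : \bar R := (\esum_(t in A) 1)%E.

(** The first index at which each element of [A] is attained. *)
Lemma tally_enumerated (t : nat -> R) (A : set R) : A `<=` range t ->
  tally A = (\sum_(0 <= n <oo) (\1_[set n | A (t n) /\ forall k, (k < n)%N -> t k <> t n] n)%:E)%E.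
Proof.
move=> At; set N := [set n | _].
rewrite nneseries_esumT => [|n]; last by rewrite lee_fin.
rewrite /tally (reindex_esum N A t); last first.
  split => [n []//|n k|s As].
    move=> /set_mem[_ hn] /set_mem[_ hk] E; apply/eqP; rewrite eqn_leq; apply/andP; split; rewrite leqNgt; apply/negP.
      by move=> /hn; rewrite E.
    by move=> /hk; rewrite E.
  have ex : exists n, t n == s by have [n _ tn] := At s As; exists n; rewrite tn.
  exists (ex_minn ex); case: ex_minnP => n /eqP ts mn //; split; first by rewrite ts.
  by move=> k kn; rewrite ts => /eqP/mn; rewrite leqNgt kn.
rewrite esum_mkcond; apply: eq_esum => n _; rewrite indicE.
by case: (n \in N).
Qed.

Lemma tally_image (f : R -> R) (A : set R) : injective f -> tally (f @` A) = tally A.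
Proof.
move=> inj; rewrite /tally (reindex_esum A (f @` A) f)//.
by split => [x Ax|x y _ _ /inj//|y []]; [exists x|move=> x; exists x].
Qed.

Lemma tally_ge0 A : (0 <= tally A)%E.
Proof. exact: esum_ge0. Qed.

Lemma tallyU (A B : set R) : A `&` B = set0 -> tally (A `|` B) = (tally A + tally B)%E.
Proof.
move=> AB; rewrite /tally [in LHS]esum_mkcond [in X in (X + _)%E]esum_mkcond [in X in (_ + X)%E]esum_mkcond.
rewrite -esumD; last 2 first.
- by move=> s _; case: ifP.
- by move=> s _; case: ifP.
apply: eq_esum => s _; rewrite in_setU.
have [/set_mem sA|sA] := boolP (s \in A); have [/set_mem sB|sB] := boolP (s \in B); rewrite /= ?adde0 ?add0e//.
by have : (A `&` B) s by []; rewrite AB.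
Qed.

Lemma tally_indic (A : set R) (E : set R) : (\esum_(t in A) (\1_E t)%:E)%E = tally (E `&` A).
Proof.
rewrite /tally [in LHS]esum_mkcond [in RHS]esum_mkcond; apply: eq_esum => s _.
by rewrite in_setI indicE; case: (s \in A); case: (s \in E).
Qed.
End tally.

Section geometry.
Context (R : realType) (v : R).
Hypothesis v0 : 0 < v.
Local Notation marked := (marked R).
Local Notation Conf := (g_sigma_algebraType (@cylinders _ _ marked R 3)).

Definition moving_distance (x : marked) (s : R) : R := euclidean_norm (position v x.1.1 x.1.2 s).

(** The coefficient of the linear term, in the variable [v * s], of the squared
    distance at time [s]. *)
Definition radial (x : marked) : R := x.1.1.1 * cos x.1.2 + x.1.1.2 * sin x.1.2.

Definition sqr_distance (x : marked) (s : R) : R :=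
  mark_key x + 2 * (v * s) * radial x + (v * s) ^+ 2.

Lemma sqr_distanceE x s : sqr_distance x s =
  (position v x.1.1 x.1.2 s).1 ^+ 2 + (position v x.1.1 x.1.2 s).2 ^+ 2.
Proof.
rewrite /sqr_distance /position /mark_key /sqr_norm /radial/=.
have := cos2Dsin2 x.1.2; move: (cos _) (sin _) => C S h.
have -> : (v * s) ^+ 2 = (v * s) ^+ 2 * (C ^+ 2 + S ^+ 2) by rewrite h mulr1.
ring.
Qed.

Lemma sqr_distance_ge0 x s : 0 <= sqr_distance x s.
Proof. by rewrite sqr_distanceE addr_ge0// sqr_ge0. Qed.

Lemma moving_distanceE x s : moving_distance x s = Num.sqrt (sqr_distance x s).
Proof. by rewrite sqr_distanceE. Qed.

Lemma moving_distance_ge0 x s : 0 <= moving_distance x s.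
Proof. exact: sqrtr_ge0. Qed.

Lemma le_moving_distance x s y t :
  (moving_distance x s <= moving_distance y t) = (sqr_distance x s <= sqr_distance y t).
Proof. by rewrite !moving_distanceE ler_sqrt// sqr_distance_ge0. Qed.

Lemma eq_moving_distance x s y t :
  moving_distance x s = moving_distance y t -> sqr_distance x s = sqr_distance y t.
Proof. by rewrite !moving_distanceE => /(congr1 (fun r => r ^+ 2)); rewrite !sqr_sqrtr ?sqr_distance_ge0. Qed.

Definition distances (y : config marked R 3) (i : nat) (s : R) : R := moving_distance (y.1 i) s.

Definition marks (y : config marked R 3) (j : fading_index) : R :=
  match j with
  | Rho => y.2 (Ordinal (isT : 0 < 3)%N)
  | Rho' => y.2 (Ordinal (isT : 1 < 3)%N)
  | Rho'' => y.2 (Ordinal (isT : 2 < 3)%N)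
  | RhoAt k => (y.1 k).2
  end.

Lemma closest_approachE y i s : closest_approach (distances y) s i <-> s = - (radial (y.1 i) / v).
Proof.
have E t : sqr_distance (y.1 i) t = mark_key (y.1 i) - radial (y.1 i) ^+ 2 + (v * t + radial (y.1 i)) ^+ 2.
  by rewrite /sqr_distance; ring.
have vK : v * - (radial (y.1 i) / v) = - radial (y.1 i).
  by rewrite mulrN mulrCA divff ?mulr1// gt_eqF.
split => [/(_ (- (radial (y.1 i) / v)))|->].
  rewrite /distances le_moving_distance !E lerD2l vK addNr expr0n/=.
  move=> h; have : v * s + radial (y.1 i) == 0 by rewrite -sqrf_eq0 eq_le h sqr_ge0.
  rewrite addr_eq0 => /eqP vs; apply: (@mulfI _ v); first by rewrite gt_eqF.
  by rewrite vs vK.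
move=> t; rewrite /distances le_moving_distance !E lerD2l vK addNr expr0n/=.
exact: sqr_ge0.
Qed.

(** The time of closest approach of station [i] when [i = j], otherwise the time at
    which stations [i] and [j] are at the same distance.  If they have the same
    radial component there is no such time, and the value is 0. *)
Definition candidate (y : config marked R 3) (i j : nat) : R :=
  if i == j then - (radial (y.1 i) / v)
  else (mark_key (y.1 j) - mark_key (y.1 i)) / (2 * v * (radial (y.1 i) - radial (y.1 j))).

Definition simple (y : config marked R 3) := injective (fun i => mark_key (y.1 i)).

(** The squared distances are quadratic in time with the same leading coefficient,
    so their equality is a linear equation; distinct initial distances make it
    nontrivial. *)
Lemma events_candidate m alpha ep Q y : simple y ->
  events m alpha (Some ep) Q (marks y) (distances y) `<=` [set s | exists i j, s = candidate y i j].
Proof.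
move=> sy.
have equi i j s : i <> j -> distances y i s = distances y j s -> s = candidate y i j.
  move=> ij /eq_moving_distance; rewrite /candidate; case: eqP => // _.
  rewrite /sqr_distance; set ki := mark_key (y.1 i); set kj := mark_key (y.1 j).
  set ri := radial (y.1 i); set rj := radial (y.1 j) => E.
  have E' : kj - ki = s * (2 * v * (ri - rj)) by lra.
  have r0 : 2 * v * (ri - rj) != 0.
    apply: contra_notN ij => /eqP r0; apply: sy; apply/esym/eqP.
    by rewrite -subr_eq0 -/ki -/kj E' r0 mulr0.
  by rewrite E' mulfK.
have near i s : closest_approach (distances y) s i -> s = candidate y i i.
  by move=> /closest_approachE ->; rewrite /candidate eqxx.
move=> s [i [j [l [+ _]]]]; case: ep => /=.
- by move=> [ij Dij _]; exists i, j; exact: equi.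
- by move=> [/near si _]; exists i, i.
- by move=> [/near si _]; exists i, i.
- by move=> [ij Dij _]; exists i, j; exact: equi.
Qed.

Lemma measurable_point i : measurable_fun setT (fun y : Conf => y.1 i : marked).
Proof.
by move=> _ A mA; rewrite setTI; apply: sub_sigma_algebra; left; exists i, A.
Qed.

Lemma measurable_extra j : measurable_fun setT (fun y : Conf => y.2 j : R).
Proof.
by move=> _ A mA; rewrite setTI; apply: sub_sigma_algebra; right; exists j, A.
Qed.

Lemma measurable_marks j : measurable_fun setT (fun y : Conf => marks y j).
Proof.
case: j => [|||k] /=; try exact: measurable_extra.
exact: (measurableT_comp measurable_snd (measurable_point k)).
Qed.

Lemma measurable_radial : measurable_fun setT radial.
Proof.
have ma := @measurable_marked_angle R.
apply: measurable_funD; apply: measurable_funM.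
- exact: measurable_marked_x.
- by apply: measurableT_comp ma; apply: continuous_measurable_fun; exact: continuous_cos.
- exact: measurable_marked_y.
- by apply: measurableT_comp ma; apply: continuous_measurable_fun; exact: continuous_sin.
Qed.

Lemma measurable_distances i (t : Conf -> R) : measurable_fun setT t ->
  measurable_fun setT (fun y : Conf => distances y i (t y)).
Proof.
move=> mt; rewrite (_ : (fun y => _) = fun y : Conf => sqr_distance (y.1 i) (t y) `^ 2^-1).
  apply: (measurableT_comp (measurable_powR 2^-1)).
  have mvt : measurable_fun setT (fun y => v * t y) by exact: measurable_funM.
  apply: measurable_funD; last exact: measurable_funX.
  apply: measurable_funD.
    exact: (measurableT_comp (@measurable_mark_key R) (measurable_point i)).
  apply: measurable_funM; first exact: measurable_funM.
  exact: (measurableT_comp measurable_radial (measurable_point i)).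
by apply/funext => y; rewrite /distances moving_distanceE powR12_sqrt// sqr_distance_ge0.
Qed.

Lemma measurable_candidate i j : measurable_fun setT (fun y : Conf => candidate y i j).
Proof.
have mr k := measurableT_comp measurable_radial (measurable_point k).
have mk k := measurableT_comp (@measurable_mark_key R) (measurable_point k).
rewrite /candidate; case: (i == j).
  by apply: measurable_fun_opp; exact: (measurable_funM (mr i) (measurable_cst _)).
apply: measurable_funM; first exact: (measurable_funB (mk j) (mk i)).
apply: measurable_fun_inv; apply: measurable_funM => //.
exact: (measurable_funB (mr i) (mr j)).
Qed.

Lemma measurable_events_at m alpha o Q (t : Conf -> R) : measurable Q -> measurable_fun setT t ->
  measurable [set y : Conf | events m alpha o Q (marks y) (distances y) (t y)].
Proof.
move=> mQ mt; apply: measurable_events => //.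
- exact: measurable_marks.
- by move=> i; exact: measurable_distances.
move=> i; rewrite (_ : [set y | _] = [set y : Conf | t y == - (radial (y.1 i) / v)]).
  apply: measurable_set_bool; apply: measurable_fun_eqr => //.
  apply: measurable_fun_opp; apply: measurable_funM => //.
  exact: (measurableT_comp measurable_radial (measurable_point i)).
by apply/seteqP; split => y /=; rewrite closest_approachE => /eqP.
Qed.

Lemma measurable_simple : measurable (simple : set Conf).
Proof.
have mk k := measurableT_comp (@measurable_mark_key R) (measurable_point k).
rewrite (_ : simple = \bigcap_i \bigcap_j
   [set y : Conf | (i == j) || ~~ (mark_key (y.1 i) == mark_key (y.1 j))]).
  apply: bigcap_measurableType => // i _; apply: bigcap_measurableType => // j _.
  apply: measurable_set_bool; case: (i == j) => /=; first exact: measurable_cst.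
  by apply: measurable_neg; exact: (measurable_fun_eqr (mk i) (mk j)).
apply/seteqP; split => y.
  move=> sy i _ j _ /=; case: eqP => //= ij; apply/eqP => k; exact/ij/sy.
by move=> h i j /= k; move: (h i I j I) => /=; case: eqP => //=; rewrite k eqxx.
Qed.

Section count.
Variables (m : interference) (alpha : R) (ep : epoch) (Q : set (\bar R)).
Hypothesis mQ : measurable Q.

Definition occurrences (y : config marked R 3) : set R := events m alpha (Some ep) Q (marks y) (distances y).

(** Outside simple configurations two stations may stay at the same distance
    forever; such configurations have probability 0 and the count is set to 0
    there so as to be measurable everywhere. *)
Definition simple_count (W : set R) (y : config marked R 3) : \bar R :=
  if `[< simple y >] then tally (occurrences y `&` W) else 0%E.

Lemma simple_count_ge0 W y : (0 <= simple_count W y)%E.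
Proof. by rewrite /simple_count; case: ifP => // _; exact: tally_ge0. Qed.

(* The candidate times in one sequence; the default only repeats one of them. *)
Let tn (y : Conf) (n : nat) : R := if unpickle n is Some (i, j) then candidate y i j else candidate y 0%N 0%N.

Let measurable_tn n : measurable_fun setT (tn^~ n).
Proof. by rewrite /tn; case: unpickle => [[i j]|]; exact: measurable_candidate. Qed.

Lemma measurable_simple_count W : measurable W -> measurable_fun setT (simple_count W : Conf -> \bar R).
Proof.
move=> mW.
pose V n : set Conf := [set y | (occurrences y `&` W) (tn y n) /\
  forall k, (k < n)%N -> tn y k <> tn y n].
rewrite (_ : simple_count W = fun y : Conf => if `[< simple y >] then
    (\sum_(0 <= n <oo) (\1_(V n) y)%:E)%E else 0%E).
  apply: measurable_fun_ifT => //.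
    have ms := measurable_simple.
    apply: (measurable_fun_bool true); rewrite setTI.
    by rewrite (_ : _ @^-1` _ = simple)//; apply/seteqP; split => y /= /asboolP.
  apply: (@ge0_emeasurable_sum _ _ _ _ _ predT) => // n _.
  apply/measurable_EFinP; apply: measurable_indic.
  apply: measurableI; first apply: measurableI.
  - exact: measurable_events_at.
  - exact: (measurable_preimage (measurable_tn n)).
  rewrite (_ : (fun y => _) = \bigcap_(k in `I_n) [set y | ~~ (tn y k == tn y n)]).
    apply: fin_bigcap_measurable => // k _; apply: measurable_set_bool.
    by apply: measurable_neg; exact: measurable_fun_eqr.
  by apply/seteqP; split => y h k kn; [apply/eqP|apply/eqP]; exact: h.
apply/funext => y; rewrite /simple_count; case: asboolP => // sy.
rewrite (tally_enumerated (t := tn y)) => [|s [/(events_candidate sy)[i [j ->]] _]].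
  apply: eq_eseriesr => n _; congr _%:E; rewrite !indicE; congr ((_ : bool)%:R).
by exists (pickle (i, j)) => //; rewrite /tn pickleK.
Qed.

Lemma simple_count_permutation W (y : config marked R 3) (s : nat -> nat) : bijective s ->
  simple_count W (y.1 \o s, y.2) = simple_count W y.
Proof.
move=> bs; have [h sh hs] := bs.
have sE : simple (y.1 \o s, y.2) <-> simple y.
  split => sy i j /= k; last by apply: (can_inj sh); exact: sy.
  by apply: (can_inj hs); apply: sy; rewrite /= !hs.
have oE : occurrences (y.1 \o s, y.2) = occurrences y.
  apply/seteqP; split => t.
    by apply: (events_index_change sh hs) => // -[[|[|[|//]]] p].
  by apply: (events_index_change hs sh) => [i u|k|[[|[|[|//]]] p]] //=; rewrite /distances/= hs.
by rewrite /simple_count oE (asbool_equiv_eq sE).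
Qed.
End count.
End geometry.

(** * Mean counts and stationarity *)

Section integral_ae.
Context d (Om : measurableType d) (R : realType) (mu : {measure set Om -> \bar R}).

(** The integral of a nonnegative function is a supremum over the simple functions
    below it, and a simple function below [f], cut off on a negligible set, is
    below [g].  This covers integrands that are not known to be measurable. *)
Lemma le_integral_ae (f g : Om -> \bar R) : (forall w, 0 <= f w)%E -> (forall w, 0 <= g w)%E ->
  {ae mu, forall w, f w = g w} -> (\int[mu]_w f w <= \int[mu]_w g w)%E.
Proof.
move=> f0 g0 [N [mN N0 sN]]; rewrite !ge0_integralTE//.
apply: ge_ereal_sup => _ [h hf <-].
pose h' := mul_nnsfun h (indic_nnsfun R (measurableC mN)).
have -> : sintegral mu h = sintegral mu h'.
  rewrite -!integralT_nnsfun; apply: ge0_ae_eq_integral => //.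
  - exact/measurable_EFinP.
  - exact/measurable_EFinP.
  - by move=> w _; rewrite lee_fin.
  - by move=> w _; rewrite lee_fin.
  exists N; split => // w /= hw; apply: contrapT => nN; apply: hw => _.
  by rewrite /h'/= mindicE mem_set// mulr1.
apply: ereal_sup_ubound; exists h' => //= w; rewrite mindicE.
have [/set_mem nN|nN] := boolP (w \in ~` N); last by rewrite mulr0; exact: g0.
rewrite mulr1 (le_trans (hf w))//.
by rewrite (_ : f w = g w)//; apply: contrapT => fg; apply: nN; exact: sN.
Qed.

Lemma eq_integral_ae (f g : Om -> \bar R) : (forall w, 0 <= f w)%E -> (forall w, 0 <= g w)%E ->
  {ae mu, forall w, f w = g w} -> (\int[mu]_w f w = \int[mu]_w g w)%E.
Proof.
move=> f0 g0 fg; apply/eqP; rewrite eq_le !le_integral_ae//.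
by apply: filterS fg => w ->.
Qed.
End integral_ae.

Section additive.
Context (R : realType) (L : R -> \bar R).
Hypothesis L0 : forall x, (0 <= L x)%E.
Hypothesis LD : forall x y, 0 <= x -> 0 <= y -> L (x + y) = (L x + L y)%E.

Lemma additive_le x y : 0 <= x -> x <= y -> (L x <= L y)%E.
Proof.
move=> x0 xy; rewrite -(subrK x y) addrC LD ?subr_ge0//.
by rewrite leeDl.
Qed.

Lemma additive_natmul n x : 0 <= x -> L (n.+1%:R * x) = (n.+1%:R%:E * L x)%E.
Proof.
move=> x0; elim: n => [|n IH]; first by rewrite mul1r mul1e.
rewrite -[in LHS]natr1 mulrDl mul1r LD ?mulr_ge0// IH.
by rewrite -[in RHS]natr1 EFinD ge0_muleDl ?lee_fin// mul1e.
Qed.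

(** Cauchy's equation for a nonnegative function, [L 1 = +oo] included: an
    additive nonnegative function is monotone, and linear at the multiples of
    [1 / n]. *)
Lemma additive_linear x : 0 < x -> L x = (x%:E * L 1)%E.
Proof.
move=> x0; have := L0 1; case E1 : (L 1) => [r| |] // r0; last first.
  rewrite gt0_muley ?lte_fin//.
  have [n nx] : exists n : nat, 1 <= n.+1%:R * x.
    exists (Num.bound x^-1); rewrite -ler_pdivrMr// div1r.
    rewrite (le_trans (ltW (archi_boundP _)))// ?ler_nat//.
    by rewrite invr_ge0 ltW.
  have := additive_le ler01 nx; rewrite E1 additive_natmul; last exact: ltW.
  by have := L0 x; case: (L x) => [y| |]// _; rewrite -EFinM leNgt ltry.
rewrite lee_fin in r0.
have Ln n : L n.+1%:R = (n.+1%:R * r)%:E by rewrite -[n.+1%:R]mulr1 additive_natmul// E1 mulr1.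
have fLx : exists y, L x = y%:E.
  have := @additive_le x (Num.bound x).+1%:R (ltW x0).
  rewrite Ln => h; have {}h := h (le_trans (ltW (archi_boundP (ltW x0))) (eqbRL (ler_nat _ _ _) (leqnSn _))).
  by move: h (L0 x); case: (L x) => [y| |]// _ _; exists y.
have [y Ly] := fLx; rewrite Ly -EFinM; congr _%:E.
(* [n.+1 * x] lies between consecutive integers [k] and [k + 1]; monotonicity puts
   both [n.+1 * y] and [n.+1 * x * r] between [k * r] and [(k + 1) * r]. *)
have bnd n : `|y - x * r| * n.+1%:R <= r.
  have nx0 : 0 <= n.+1%:R * x by rewrite mulr_ge0// ltW.
  have /andP[h1 h2] := truncn_itv nx0; set k := Num.truncn _ in h1 h2.
  have Ly' : L (n.+1%:R * x) = (n.+1%:R * y)%:E by rewrite additive_natmul ?ltW// Ly.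
  have up : n.+1%:R * y <= k.+1%:R * r.
    by rewrite -lee_fin -Ly' -Ln; apply: additive_le => //; exact: ltW.
  have lo : k%:R * r <= n.+1%:R * y.
    case: k {up h2} h1 => [|k] h1; first by rewrite mul0r -lee_fin -Ly'.
    by rewrite -lee_fin -Ly' -Ln; apply: additive_le.
  rewrite -[k.+1%:R]natr1 in h2 up.
  have N0 : 0 <= n.+1%:R :> R by [].
  have h1r : k%:R * r <= n.+1%:R * x * r by rewrite ler_wpM2r.
  have h2r : n.+1%:R * x * r <= (k%:R + 1) * r by rewrite ler_wpM2r// ltW.
  rewrite -(ger0_norm N0) -normrM ler_norml; apply/andP; split; lra.
apply/eqP; rewrite -subr_eq0 -normr_le0; apply/ler_addgt0Pr => eps eps0; rewrite add0r.
pose n := Num.bound (r / eps); have := bnd n; rewrite -ler_pdivlMr// => /le_trans; apply.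
rewrite ler_pdivrMr//.
have := archi_boundP (divr_ge0 r0 (ltW eps0)); rewrite ltr_pdivrMr// => /ltW h.
by rewrite (le_trans h)// mulrC ler_pM2l// ler_nat.
Qed.
End additive.

(** The conventions for the inverses of 0 and of infinity are compatible with
    positive factors. *)
Lemma inve_scale (R : realType) (x y : \bar R) (k : R) : 0 < k ->
  ((k%:E * x)^-1 * (k%:E * y) = x^-1 * y)%E.
Proof.
move=> k0; case: x => [x| |].
- rewrite -EFinM /inve mulf_eq0 gt_eqF//=; case: ifPn => [_|x0].
    by rewrite muleA gt0_mulye ?lte_fin.
  rewrite muleA -EFinM; congr (_%:E * _)%E; field.
  by rewrite x0 gt_eqF.
- by rewrite gt0_muley ?lte_fin//= !mul0e.
- by rewrite gt0_muleNy ?lte_fin//= muleA gt0_mulNye ?lte_fin.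
Qed.

Lemma indic_eq (T : Type) (R : pzRingType) (A : set T) (x y : T) : A x = A y -> \1_A x = \1_A y :> R.
Proof.
move=> E; rewrite !indicE; congr (nat_of_bool _)%:R.
by apply/idP/idP => /set_mem Ax; apply/mem_set; rewrite ?E// -?E.
Qed.

Section invariance.
Context (R : realType) (v alpha : R) (m : interference).
Hypothesis v0 : 0 < v.
Local Notation marked := (marked R).

(** Displacement during a time [a]. *)
Definition drift (a : R) (theta : R) : R * R := (v * a * cos theta, v * a * sin theta).

Lemma measurable_drift a : measurable_fun setT (drift a).
Proof.
apply/measurable_fun_pairP; split; apply: measurable_funM => //.
- by apply: continuous_measurable_fun; exact: continuous_cos.
- by apply: continuous_measurable_fun; exact: continuous_sin.
Qed.

Definition shift_config (a : R) (y : config marked R 3) : config marked R 3 :=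
  (fun i => shift_mark (drift a) (y.1 i), y.2).

Definition scale_config (c b : R) (y : config marked R 3) : config marked R 3 :=
  (fun i => scale_mark c b (y.1 i), fun j => b * y.2 j).

Lemma events_shift o Q a y s :
  events m alpha o Q (marks (shift_config a y)) (distances v (shift_config a y)) s <->
  events m alpha o Q (marks y) (distances v y) (s + a).
Proof.
apply: (@events_time_change _ _ _ _ _ _ _ 1 1 (fun s => s + a)) => //.
- by move=> i t; exact: moving_distance_ge0.
- move=> i t; rewrite mul1r /distances /moving_distance /position/= /drift/=.
  by congr (euclidean_norm (_, _)); ring.
- by move=> t; exists (t - a); rewrite subrK.
- by move=> j; rewrite mul1r; case: j.
Qed.

(** Dilating the positions by [c] while keeping [v] dilates time by [c]. *)
Lemma events_scale o Q c b y s : 0 < c -> 0 < b ->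
  events m alpha o Q (marks (scale_config c b y)) (distances v (scale_config c b y)) s <->
  events m alpha o Q (marks y) (distances v y) (c^-1 * s).
Proof.
move=> c0 b0; apply: (@events_time_change _ _ _ _ _ _ _ c b (fun s => c^-1 * s)) => //.
- by move=> i t; exact: moving_distance_ge0.
- move=> i t; rewrite /distances !moving_distanceE; have {2}-> : c = Num.sqrt (c ^+ 2) by rewrite sqrtr_sqr ger0_norm ?ltW.
  rewrite -sqrtrM ?sqr_ge0//.
  congr Num.sqrt; rewrite /sqr_distance /mark_key /sqr_norm /radial /scale_mark/=.
  by field; rewrite gt_eqF.
- by move=> t; exists (c * t); rewrite mulKf// gt_eqF.
- by case.
Qed.

Section law.
Context (lambda : R) (U Q : probability R R).
Hypothesis lambda0 : 0 <= lambda.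

Section typical.
Variables (D : set (\bar R)).
Hypothesis mD : measurable D.

Definition seen_at t (y : config marked R 3) : Prop :=
  events m alpha None D (marks y) (distances v y) t.

(** Being seen at a fixed time is a symmetric measurable event. *)
Lemma same_seen_at t
    d (Om : measurableType d) (P : probability Om R) e z
    d' (Om' : measurableType d') (P' : probability Om' R) e' z' :
  marked_network P lambda U Q e z -> marked_network P' lambda U Q e' z' ->
  P [set w | seen_at t (conf e z w)] = P' [set w | seen_at t (conf e' z' w)].
Proof.
move=> M M'; have [me mz _] := M; have [me' mz' _] := M'.
have mS := measurable_events_at v0 m alpha None mD (measurable_cst t).
have H := marked_network_same_integral lambda0 M M'
  (G := fun y => (\1_[set y | seen_at t y] y)%:E).
rewrite -[LHS](integral_indic_comp P (measurable_conf me mz) mS).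
rewrite -[RHS](integral_indic_comp P' (measurable_conf me' mz') mS).
apply: H.
- by apply/measurable_EFinP; exact: (measurable_indic mS).
- by move=> x; rewrite lee_fin.
move=> x s [h sh hs]; apply: (congr1 EFin); apply: indic_eq; apply/propext; split.
  by apply: (events_index_change sh hs) => // -[[|[|[|//]]] p].
by apply: (events_index_change hs sh) => [i u|k|[[|[|[|//]]] p]] //=; rewrite /distances/= hs.
Qed.
End typical.

Section counts.
Variables (ep : epoch) (D : set (\bar R)).
Hypothesis mD : measurable D.
Local Notation occurrences := (occurrences v m alpha ep D).
Local Notation simple_count := (simple_count v m alpha ep D).

Section mean_count.
Context d (Om : measurableType d) (P : probability Om R) (e : nat -> Om -> marked) (z : 'I_3 -> Om -> R).
Hypothesis M : marked_network P lambda U Q e z.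

Definition mean_count (W : set R) : \bar R := (\int[P]_w tally (occurrences (conf e z w) `&` W))%E.

(** The integrand of the left-hand side need not be measurable, but it coincides
    with [simple_count] almost surely. *)
Lemma mean_count_simple W : mean_count W = (\int[P]_w simple_count W (conf e z w))%E.
Proof.
apply: eq_integral_ae.
- by move=> w; exact: tally_ge0.
- by move=> w; exact: simple_count_ge0.
apply: filterS (marked_network_keyed lambda0 M) => w [inj _].
by rewrite /simple_count; case: asboolP => // -[]; exact: inj.
Qed.

Lemma mean_count_ge0 W : (0 <= mean_count W)%E.
Proof. by apply: integral_ge0 => w _; exact: tally_ge0. Qed.

Lemma mean_countU A B : measurable A -> measurable B -> A `&` B = set0 ->
  mean_count (A `|` B) = (mean_count A + mean_count B)%E.
Proof.
move=> mA mB AB; rewrite !mean_count_simple -ge0_integralD//; last 4 first.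
- by move=> w _; exact: simple_count_ge0.
- by apply: measurableT_comp (measurable_simple_count v0 m alpha ep mD mA) _; have [? ? _] := M; exact: measurable_conf.
- by move=> w _; exact: simple_count_ge0.
- by apply: measurableT_comp (measurable_simple_count v0 m alpha ep mD mB) _; have [? ? _] := M; exact: measurable_conf.
apply: eq_integral => w _; rewrite /simple_count; case: asboolP => _; last by rewrite adde0.
rewrite setIUr tallyU// setIACA AB setI0//.
Qed.

Lemma mean_count_sub A B : measurable A -> measurable B -> A `<=` B ->
  (mean_count A <= mean_count B)%E.
Proof.
move=> mA mB AB; have mBA : measurable (B `\` A) by exact: measurableD.
rewrite -(setDUK AB) mean_countU//; last by rewrite setDE setICA setICr setI0.
by rewrite leeDl// mean_count_ge0.
Qed.
End mean_count.

Lemma mean_count_same d (Om : measurableType d) (P : probability Om R) e z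
    d' (Om' : measurableType d') (P' : probability Om' R) e' z' W :
  marked_network P lambda U Q e z -> marked_network P' lambda U Q e' z' -> measurable W ->
  mean_count P e z W = mean_count P' e' z' W.
Proof.
move=> M M' mW; rewrite (mean_count_simple M) (mean_count_simple M').
apply: (marked_network_same_integral lambda0 M M').
- exact: measurable_simple_count.
- by move=> x; exact: simple_count_ge0.
- by move=> x s bs; exact: simple_count_permutation.
Qed.

Lemma tally_time_change (f : R -> R) (y y' : config marked R 3) W : injective f ->
  (forall s, occurrences y' s <-> occurrences y (f s)) ->
  tally (occurrences y' `&` W) = tally (occurrences y `&` f @` W).
Proof.
move=> inj yy'; rewrite -(tally_image _ inj); congr tally.
apply/seteqP; split => [_ [s [/yy' ys Ws] <-]|s' [ys [s Ws E]]]; first by split => //; exists s.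
by move: ys; rewrite -E => /yy' ys; exists s; [exact: (conj ys Ws)|].
Qed.

Section stationary.
Context d (Om : measurableType d) (P : probability Om R) (e : nat -> Om -> marked) (z : 'I_3 -> Om -> R).
Hypothesis M : marked_network P lambda U Q e z.
Local Notation J := (mean_count P e z).

(** Letting the stations move for a time [a] preserves the law of the marked network
    and moves the window. *)
Lemma mean_count_stationary a W : measurable W -> J W = J ((fun s => s + a) @` W).
Proof.
move=> mW; have M' := marked_network_shift (measurable_drift a) M.
rewrite (mean_count_same M M' mW); apply: eq_integral => w _.
apply: tally_time_change; first exact: addIr.
by move=> s; exact: (events_shift (Some ep) D a (conf e z w) s).
Qed.

Let shift_itv (b1 b2 : bool) x y a :
  (fun s => s + a) @` [set` Interval (BSide b1 x) (BSide b2 y)] =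
  [set` Interval (BSide b1 (x + a)) (BSide b2 (y + a))] :> set R.
Proof.
apply/seteqP; split => [_ [s + <-]|s].
  by rewrite /= !itv_boundlr /= /Order.le/= !lteifD2r.
move=> h; exists (s - a); last by rewrite subrK.
by move: h; rewrite /= !itv_boundlr /= /Order.le/= lteifBrDr lteifBlDr.
Qed.

Lemma mean_count_linear x : 0 < x -> J `[0, x[ = (x%:E * J `[0%R, 1%R[)%E.
Proof.
move=> x0; apply: (@additive_linear _ (fun x => J `[0, x[)) => // {x x0} [x|x y x0 y0].
  exact: mean_count_ge0.
rewrite [in X in (_ + X)%E](mean_count_stationary x)// shift_itv add0r [y + x]addrC.
rewrite -mean_countU//.
  congr (J _); apply/seteqP; split => s; rewrite /= !in_itv/=.
    by move=> /andP[s0 sxy]; case: (ltP s x) => sx; [left|right]; apply/andP.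
  by move=> [/andP[s0 sx]|/andP[xs sxy]]; apply/andP; split => //; lra.
apply/seteqP; split => // s [] /=; rewrite !in_itv/=; lra.
Qed.

Lemma mean_count_point s : J [set s] = J [set 0].
Proof.
by rewrite (mean_count_stationary s (measurable_set1 0)) image_set1 add0r.
Qed.

(** The mean number of occurrences at a fixed time is by stationarity the same,
    [J [set 0]], for all times.  If it is not 0, then every window, split into [n.+1] equal
    parts, has a mean count of at least [n.+1] times this number, one
    for the left endpoint of each part, and so
    both sides are infinite. *)
Lemma mean_count_closed x : 0 < x -> J `[0, x] = J `[0, x[.
Proof.
move=> x0; have -> : `[0, x]%classic = `[0, x[%classic `|` [set x].
  by rewrite setUitv1//= bnd_simp ltW.
rewrite mean_countU//; last first.
  by apply/seteqP; split => // s [] /= + sx; rewrite sx in_itv/= ltxx andbF.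
rewrite mean_count_point; have q0 := mean_count_ge0 P e z [set 0].
have [->|qn0] := eqVneq (J [set 0]) 0%E; first by rewrite adde0.
have qgt0 : (0 < J [set 0%R])%E by rewrite lt_neqAle eq_sym qn0.
suff -> : J `[0, x[ = +oo%E by rewrite addye// gt_eqF// (lt_le_trans _ q0) ?ltNy0.
have le n : (n.+1%:R%:E * J [set 0%R] <= J `[0%R, x[)%E.
  have xn : 0 < x / n.+1%:R by rewrite divr_gt0.
  have -> : J `[0, x[ = (n.+1%:R%:E * J `[0%R, (x / n.+1%:R)%R[)%E.
    rewrite (mean_count_linear x0) (mean_count_linear xn) muleA -EFinM.
    by rewrite [n.+1%:R * _]mulrC divfK.
  rewrite lee_pmul2l// ?lte_fin//; apply: mean_count_sub => //.
  by move=> s /= ->; rewrite in_itv/= lexx.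
move: le (mean_count_ge0 P e z `[0, x[); case: (J `[0, x[) => [r| |]// le _.
move: qgt0 le; case: (J [set 0]) => [q| |]//; last first.
  by move=> _ /(_ 0%N); rewrite mul1e.
rewrite lte_fin => q00 le; have := le (Num.bound (r / q)).
rewrite -EFinM lee_fin -ler_pdivlMr// => h.
have r0 : 0 <= r / q by rewrite (le_trans _ h).
have := archi_boundP r0; rewrite ltNge (le_trans _ h)// ler_nat//.
Qed.

Lemma mean_count_window x : 0 < x -> J `[0, x] = (x%:E * J `[0%R, 1%R])%E.
Proof. by move=> x0; rewrite !mean_count_closed// mean_count_linear. Qed.
End stationary.
End counts.
End law.
End invariance.

(** * Scale invariance of the coverage probabilities *)

Section scale_invariance.
Context (R : realType) (v alpha : R) (m : interference).
Hypothesis v0 : 0 < v.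
Local Notation marked := (marked R).
Context (lambda c b : R) (U Q Q' : probability R R).
Hypotheses (lambda0 : 0 <= lambda) (c0 : 0 < c) (b0 : 0 < b).
Hypothesis QQ' : forall A : set R, measurable A -> Q' A = Q ((fun r => b * r) @^-1` A).
Context d1 (Om1 : measurableType d1) (P1 : probability Om1 R).
Context d2 (Om2 : measurableType d2) (P2 : probability Om2 R).
Variables (e1 : nat -> Om1 -> marked) (z1 : 'I_3 -> Om1 -> R).
Variables (e2 : nat -> Om2 -> marked) (z2 : 'I_3 -> Om2 -> R).
Hypothesis M1 : marked_network P1 lambda U Q e1 z1.
Hypothesis M2 : marked_network P2 (lambda / c ^+ 2) U Q' e2 z2.

Let lambda0' : 0 <= lambda / c ^+ 2.
Proof. by rewrite divr_ge0// sqr_ge0. Qed.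

Let M1' := marked_network_scale c0 QQ' M1.

Lemma mean_count_scale ep D : measurable D ->
  mean_count v alpha m ep D P2 e2 z2 `[0, 1] =
  (c^-1%:E * mean_count v alpha m ep D P1 e1 z1 `[0%R, 1%R])%E.
Proof.
move=> mD; have ci0 : 0 < c^-1 by rewrite invr_gt0.
rewrite (mean_count_same alpha m v0 lambda0' ep mD M2 M1')//.
rewrite -(mean_count_window alpha m v0 lambda0 ep mD M1 ci0).
apply: eq_integral => w _.
rewrite (@tally_time_change _ _ _ _ _ _ (fun s => c^-1 * s) (conf e1 z1 w)); last 2 first.
- by apply: mulfI; rewrite gt_eqF.
- by move=> s; exact: (events_scale v alpha m (Some ep) D (conf e1 z1 w) s c0 b0).
congr (tally (_ `&` _)); apply/seteqP; split => [_ [s + <-]|s] /=; rewrite !in_itv/=.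
  by move=> /andP[s0 s1]; rewrite mulr_ge0 ?(ltW ci0)//= -[leRHS]mulr1 ler_pM2l.
move=> /andP[s0 s1]; exists (c * s); last by rewrite mulKf// gt_eqF.
by rewrite in_itv/= mulr_ge0 ?(ltW c0)//= mulrC -ler_pdivlMr// div1r.
Qed.

(** The numerator and the denominator of the Palm quotient are both multiplied by
    [c^-1]. *)
Lemma palm_scale ep D : measurable D ->
  ((mean_count v alpha m ep setT P2 e2 z2 `[0%R, 1%R])^-1 *
    mean_count v alpha m ep D P2 e2 z2 `[0%R, 1%R] =
   (mean_count v alpha m ep setT P1 e1 z1 `[0%R, 1%R])^-1 *
    mean_count v alpha m ep D P1 e1 z1 `[0%R, 1%R])%E.
Proof.
by move=> mD; rewrite !mean_count_scale// inve_scale ?invr_gt0.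
Qed.

(** The dilated first network at time [t] is the first network at time [c^-1 * t],
    which stationarity moves to [t]. *)
Lemma seen_at_scale D t : measurable D ->
  P2 [set w | seen_at v alpha m D t (conf e2 z2 w)] = P1 [set w | seen_at v alpha m D t (conf e1 z1 w)].
Proof.
move=> mD; pose a := c^-1 * t - t.
have M1'' := marked_network_shift (measurable_drift v a) M1.
have E y : seen_at v alpha m D t (scale_config c b y) = seen_at v alpha m D t (shift_config v a y).
  apply/propext; have S := events_scale v alpha m None D y t c0 b0.
  have := events_shift v alpha m None D a y t; rewrite addrCA subrr addr0 => T.
  exact: iff_trans S (iff_sym T).
apply: (etrans (same_seen_at alpha m v0 lambda0' mD t M2 M1')).
apply: (etrans _ (same_seen_at alpha m v0 lambda0 mD t M1'' M1)).
apply: (congr1 P1); apply/funext => w; exact: (E (conf e1 z1 w)).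
Qed.
End scale_invariance.

Section coverage.
Context d (Om : measurableType d) (R : realType) (P : probability Om R).
Variables (lambda v alpha tau : R) (m : interference) (N : network P lambda).
Variables (mark : fading_index -> Om -> R).

Definition marked_station (i : nat) (w : Om) : marked R := (station N i w, angle N i w, mark (RhoAt i) w).

Definition extra_mark (j : 'I_3) : Om -> R := mark (extra j).

Let rho (w : Om) (j : fading_index) : R := mark j w.

Let rhoE w : marks (conf marked_station extra_mark w) = rho w.
Proof. by apply/funext; case. Qed.

(** A covered epoch is an epoch, so the Palm expectation counts the occurrences at
    which the metric is at least [tau]. *)
Lemma coverage_probability_epoch ep :
  coverage_probability N v 0 alpha tau rho m (AtEpoch R ep) =
  ((mean_count v alpha m ep setT P marked_station extra_mark `[0%R, 1%R])^-1 *
    mean_count v alpha m ep [set x | (tau%:E <= x)%E] P marked_station extra_mark `[0%R, 1%R])%E.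
Proof.
have E D w : occurrences v m alpha ep D (conf marked_station extra_mark w) =
    events m alpha (Some ep) D (rho w) (distance N v w).
  by rewrite /occurrences rhoE.
rewrite /coverage_probability /palm_probability /palm_expectation /intensity.
congr (_^-1 * _)%E; apply: eq_integral => w _.
  by rewrite -/(tally _) (epoch_timesE m alpha ep (rho w)) -E.
rewrite tally_indic E; congr tally; apply/seteqP; split => s.
  by move=> [h [_ Ws]]; split => //; exact/exceeds_epoch_metric.
move=> [h Ws]; split; first exact/exceeds_epoch_metric.
split => //; rewrite (epoch_timesE m alpha ep (rho w)).
by have [i [j [l [h' _]]]] := h; exists i, j, l.
Qed.

Lemma coverage_probability_time t :
  coverage_probability N v 0 alpha tau rho m (AtTime t) =
  P [set w | seen_at v alpha m [set x | (tau%:E <= x)%E] t (conf marked_station extra_mark w)].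
Proof.
apply: (congr1 P); apply/funext => w.
rewrite [RHS]/(events m alpha None _ (marks (conf marked_station extra_mark w)) (distance N v w) t) rhoE.
apply/propext; exact: exceeds_typical_metric.
Qed.
End coverage.

(** The marks [mark2] have the law of [b] times [mark1]: equal marks for [b = 1],
    exponential ones for [b = mu1 / mu2]. *)
Lemma coverage_probability_scale (R : realType) (v alpha tau lambda1 lambda2 b : R) (Q1 Q2 : probability R R)
    d1 (Om1 : measurableType d1) (P1 : probability Om1 R) (N1 : network P1 lambda1)
    (mark1 : fading_index -> Om1 -> R)
    d2 (Om2 : measurableType d2) (P2 : probability Om2 R) (N2 : network P2 lambda2)
    (mark2 : fading_index -> Om2 -> R) (m : interference) (star : vantage R) :
  0 < v -> 0 < lambda1 -> 0 < lambda2 -> 0 < b ->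
  (forall A : set R, measurable A -> Q2 A = Q1 ((fun r => b * r) @^-1` A)) ->
  (forall j, measurable_fun setT (mark1 j)) -> (forall j, measurable_fun setT (mark2 j)) ->
  (forall j A, measurable A -> P1 (mark1 j @^-1` A) = Q1 A) ->
  (forall j A, measurable A -> P2 (mark2 j @^-1` A) = Q2 A) ->
  independent_family P1 mark1 -> independent_family P2 mark2 ->
  independent_pair P1 (sigma_generated (fun i w => (station N1 i w, angle N1 i w))) (sigma_generated mark1) ->
  independent_pair P2 (sigma_generated (fun i w => (station N2 i w, angle N2 i w))) (sigma_generated mark2) ->
  coverage_probability N1 v 0 alpha tau (fun w j => mark1 j w) m star =
  coverage_probability N2 v 0 alpha tau (fun w j => mark2 j w) m star.
Proof.
move=> v0 l10 l20 b0 QQ m1 m2 law1 law2 ind1 ind2 nm1 nm2.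
pose U := distribution P1 (angle N1 0%N).
pose c := Num.sqrt (lambda1 / lambda2).
have c0 : 0 < c by rewrite sqrtr_gt0 divr_gt0.
have M1 : marked_network P1 lambda1 U Q1 (marked_station N1 mark1) (extra_mark mark1).
  exact: (network_marked (ltW l10) m1 _ law1 ind1 nm1).
have M2 : marked_network P2 (lambda1 / c ^+ 2) U Q2 (marked_station N2 mark2) (extra_mark mark2).
  rewrite (_ : lambda1 / c ^+ 2 = lambda2); last first.
    rewrite sqr_sqrtr; last by rewrite ltW// divr_gt0.
    by field; rewrite !gt_eqF.
  apply: (network_marked (ltW l20) m2 _ law2 ind2 nm2) => A mA.
  exact: (etrans (angle_uniform N2 0%N mA) (esym (angle_uniform N1 0%N mA))).
have mtau : measurable [set x : \bar R | (tau%:E <= x)%E].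
  rewrite (_ : [set x | _] = `[tau%:E, +oo[%classic); first exact: emeasurable_itv.
  by apply/seteqP; split => x /=; rewrite in_itv/= andbT.
case: star => [ep|t].
  rewrite !coverage_probability_epoch.
  exact/esym/(palm_scale alpha m v0 (ltW l10) c0 b0 QQ M1 M2).
rewrite !coverage_probability_time.
exact/esym/(seen_at_scale alpha m v0 (ltW l10) c0 b0 QQ M1 M2).
Qed.

Lemma independent_family_cst d (Om : measurableType d) (R : realType) (P : probability Om R) (J : Type)
    d' (T : measurableType d') (r : T) : independent_family P (fun (_ : J) (_ : Om) => r).
Proof.
move=> n i E _ hE.
have {}hE k : E k = setT \/ E k = set0.
  have [A mA <-] := hE k; rewrite setTI; have [Ar|nAr] := pselect (A r).
    by left; apply/seteqP; split.
  by right; apply/seteqP; split.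
have [[k0 Ek0]|ne] := pselect (exists k, E k = set0).
  rewrite (bigD1 k0)//= Ek0 measure0 mul0e (_ : \bigcap_(k in _) _ = set0) ?measure0//.
  by apply/seteqP; split => // w /(_ k0 I); rewrite Ek0.
have ET k : E k = setT by case: (hE k) => // h; case: ne; exists k.
rewrite big1 => [|k _]; last by rewrite ET; exact: probability_setT.
rewrite (_ : \bigcap_(k in _) _ = setT); first exact: probability_setT.
by apply/seteqP; split => // w _ k _; rewrite ET.
Qed.

Lemma independent_pair_cst d (Om : measurableType d) (R : realType) (P : probability Om R) (J : Type)
    d' (T : measurableType d') (r : T) (F : set_system Om) :
  independent_pair P F (sigma_generated (fun (_ : J) (_ : Om) => r)).
Proof.
move=> A B _; suff sub : sigma_generated (fun (_ : J) (_ : Om) => r) `<=` [set B | B = set0 \/ B = setT].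
  move=> /sub[->|->]; first by rewrite setI0 measure0 mule0.
  by rewrite setIT probability_setT mule1.
apply: smallest_sub.
  split; first by left.
    by move=> _ [->|->]; [right; rewrite setD0|left; rewrite setDv].
  move=> G hG; have [[n Gn]|ne] := pselect (exists n, G n = setT).
    by right; apply/seteqP; split => // w _; exists n => //; rewrite Gn.
  left; apply/seteqP; split => // w [n _]; case: (hG n) => [->//|Gn]; by case: ne; exists n.
move=> X [j _ [C mC <-]]; rewrite setTI.
have [Cr|nCr] := pselect (C r); [right|left]; by apply/seteqP; split.
Qed.

Theorem theorem8 (R : realType) (v alpha tau lambda1 lambda2 : R)
    (v_gt0 : 0 < v) (alpha_ge2 : 2 <= alpha) (tau_gt0 : 0 < tau)
    (lambda1_gt0 : 0 < lambda1) (lambda2_gt0 : 0 < lambda2)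
    (d1 d2 : measure_display)
    (Omega1 : measurableType d1) (Omega2 : measurableType d2)
    (P1 : probability Omega1 R) (P2 : probability Omega2 R)
    (N1 : network P1 lambda1) (N2 : network P2 lambda2) :
  (forall (m : interference) (star : vantage R),
     coverage_probability N1 v 0 alpha tau (@no_fading R Omega1) m star =
     coverage_probability N2 v 0 alpha tau (@no_fading R Omega2) m star) /\
  (forall (mu1 mu2 : R) (mu1_gt0 : 0 < mu1) (mu2_gt0 : 0 < mu2)
     (F1 : exponential_fading N1 mu1) (F2 : exponential_fading N2 mu2)
     (m : interference) (star : vantage R),
     coverage_probability N1 v 0 alpha tau (fun w j => fading F1 j w) m star =
     coverage_probability N2 v 0 alpha tau (fun w j => fading F2 j w) m star).
Proof.
split => [m star|mu1 mu2 mu10 mu20 F1 F2 m star].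
  pose Q := distribution P1 (rv P1 (@measurable_cst _ _ Omega1 R setT 1)).
  have QE A : Q A = ((1 \in A)%:R)%:E.
    rewrite /Q distribution_rvE; have [/set_mem A1|nA1] := boolP (1 \in A).
      by rewrite (_ : _ @^-1` _ = setT) ?probability_setT//; apply/seteqP; split.
    by rewrite (_ : _ @^-1` _ = set0) ?measure0//; apply/seteqP; split => // w A1; rewrite mem_set in nA1.
  have law d (Om : measurableType d) (P : probability Om R) (j : fading_index) A :
      P ((fun w => no_fading R w j) @^-1` A) = Q A.
    rewrite QE; have [/set_mem A1|nA1] := boolP (1 \in A).
      by rewrite (_ : _ @^-1` _ = setT) ?probability_setT//; apply/seteqP; split.
    by rewrite (_ : _ @^-1` _ = set0) ?measure0//; apply/seteqP; split => // w A1; rewrite mem_set in nA1.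
  apply: (@coverage_probability_scale R v alpha tau lambda1 lambda2 1 Q Q _ _ _ N1
    (fun j w => no_fading R w j) _ _ _ N2 (fun j w => no_fading R w j)) => //.
  - by move=> A mA; congr (Q _); apply/seteqP; split => r /=; rewrite mul1r.
  - exact: independent_family_cst.
  - exact: independent_family_cst.
  - exact: independent_pair_cst.
  - exact: independent_pair_cst.
apply: (@coverage_probability_scale R v alpha tau lambda1 lambda2 (mu1 / mu2)
  (distribution P1 (fading F1 Rho)) (distribution P2 (fading F2 Rho))) => //.
- exact: divr_gt0.
- move=> A mA.
  have mb : measurable_fun setT (fun r : R => mu1 / mu2 * r) by exact: measurable_funM.
  apply: (etrans (fading_exponential F2 Rho mA)); apply: (etrans (exponential_prob_scale mu10 mu20 mA)).
  exact/esym/(fading_exponential F1 Rho (measurable_preimage mb mA)).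
- by move=> j A mA; exact: (etrans (fading_exponential F1 j mA) (esym (fading_exponential F1 Rho mA))).
- by move=> j A mA; exact: (etrans (fading_exponential F2 j mA) (esym (fading_exponential F2 Rho mA))).
- exact: fading_independent.
- exact: fading_independent.
- exact: network_fading_independent.
- exact: network_fading_independent.
Qed.
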